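(* Let $0<\alpha\le 1$. Assume that the maps $t\mapsto b(t,\cdot)$ and $t\mapsto b_1(t,\cdot)$ belong to $\mathcal{C}^0([0,+\infty);\mathcal{C}^{1+\alpha}(\mathbb{R}^d))$ (velocity fields with values in $\mathbb{R}^d$), that $w\in\mathcal{C}^{1+\alpha}([0,\infty)\times\mathbb{R}^d)$ (real-valued), and let $\mu_0\in\mathcal{P}(\mathbb{R}^d)$. For $h\in[-\tfrac12,\tfrac12]$ put $b^h(t,x):=b(t,x)+h\,b_1(t,x)$ and let $t\mapsto\mu_t^h$ be the weak solution of $$\partial_t\mu_t^h+\mathrm{div}_x\big(b^h(t,x)\mu_t^h\big)=w(t,x)\,\mu_t^h\quad\text{in }(\mathcal{C}^1_c([0,\infty)\times\mathbb{R}^d))^*,\qquad \mu^h_{t=0}=\mu_0 .$$ Then (for every $t\in[0,\infty)$) the mapping $$[-\tfrac12,\tfrac12]\ni h\mapsto \mu_t^h\in\mathcal{P}(\mathbb{R}^d)$$ is differentiable in $Z$, i.e. $\partial_h\mu_t^h\in Z$.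
   Context: $\mathcal{P}(\mathbb{R}^d)$ is the set of Borel probability measures on $\mathbb{R}^d$, and $\mathcal{M}(\mathbb{R}^d)$ is the space of bounded (signed) Radon measures on $\mathbb{R}^d$. $\mathcal{C}^{1+\alpha}(\mathbb{R}^d)$ is the Banach space of functions on $\mathbb{R}^d$ (real-valued, or $\mathbb{R}^d$-valued for velocity fields) whose first order partial derivatives are Hölder continuous with exponent $\alpha$, with finite norm $$\|f\|_{\mathcal{C}^{1+\alpha}(\mathbb{R}^d)}=\sup_{x}|f(x)|+\sup_x|\nabla_x f(x)|+\sup_{x_1\ne x_2}\frac{|\nabla_xf(x_1)-\nabla_xf(x_2)|}{|x_1-x_2|^\alpha};$$ $\mathcal{C}^{1+\alpha}([0,\infty)\times\mathbb{R}^d)$ is defined in the same way in the variables $(t,x)$. $\mathcal{C}^1_c([0,\infty)\times\mathbb{R}^d)$ is the space of compactly supported $\mathcal{C}^1$ functions, and $(\cdot)^*$ denotes the topological dual. Each $\mu\in\mathcal{M}(\mathbb{R}^d)$ is identified with the functional $f\mapsto\int f\,d\mu$ in the dual $(\mathcal{C}^{1+\alpha}(\mathbb{R}^d))^*$ of the space of real-valued $\mathcal{C}^{1+\alpha}$ functions, and $$Z:=\overline{\mathcal{M}(\mathbb{R}^d)}^{(\mathcal{C}^{1+\alpha}(\mathbb{R}^d))^*}$$ is the closure in the dual norm, a Banach space equipped with the dual norm $\|\cdot\|_{(\mathcal{C}^{1+\alpha}(\mathbb{R}^d))^*}$. The derivative $\partial_h\mu_t^h$ is the limit, in the norm of $Z$,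 of the difference quotients $\frac{\mu_t^{h+\lambda}-\mu_t^h}{\lambda}$ as $\lambda\to0$. Weak solution: a curve $[0,\infty)\ni t\mapsto\mu_t\in\mathcal{P}(\mathbb{R}^d)$ that is narrowly continuous (i.e. $t\mapsto\int_{\mathbb{R}^d}\eta\,d\mu_t$ is continuous for every bounded continuous $\eta$ on $\mathbb{R}^d$) is a weak solution of $\partial_t\mu_t+\mathrm{div}_x(b\mu_t)=w\mu_t$, $\mu_{t=0}=\mu_0$, if for all $\varphi\in\mathcal{C}^1_c([0,\infty)\times\mathbb{R}^d)$ $$\int_0^\infty\!\!\int_{\mathbb{R}^d}\big(\partial_t\varphi+b\cdot\nabla_x\varphi\big)\,d\mu_t\,dt+\int_{\mathbb{R}^d}\varphi(0,\cdot)\,d\mu_0=-\int_0^\infty\!\!\int_{\mathbb{R}^d}w\,\varphi\,d\mu_t\,dt ;$$ for the perturbed problem, $b$ is replaced by $b^h$. Existence and uniqueness of the solution are taken from a result of Maniglia, which gives a unique narrowly continuous family of Borel finite positive measures solving the problem in the distributional sense, with the formula $\mu_t=X_b(t,\cdot)\#\big(e^{\int_0^tw(s,X_b(s,\cdot))\,ds}\cdot\mu_0\big)$, where $X_b$ is the flow $\dot X_b(t,y)=b(t,X_b(t,y))$, $X_b(0,y)=y$, and $\#$ denotes push-forward. *)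

(* Defs.v *)
From HB Require Import structures.
From mathcomp Require Import all_boot all_order all_algebra.
From mathcomp Require Import all_classical all_reals all_analysis.

Set Implicit Arguments.
Unset Strict Implicit.
Unset Printing Implicit Defensive.

Import Order.TTheory GRing.Theory Num.Theory.
Import numFieldNormedType.Exports.

Local Open Scope classical_set_scope.
Local Open Scope ring_scope.

(* R^d is 'rV[R]_d with the library norm, i.e. the max norm; the norm of a
   Jacobian is the max of its entries and the norm of a pair (t, x) is the max
   of `|t| and `|x|. All norms on these finite-dimensional spaces being
   equivalent, the function spaces and the topologies below do not depend on
   this choice. *)

(* Every finite signed Borel measure on R^d is Radon, so M(R^d) is
   {charge set (borel R d) -> \bar R}. *)
Notation borel R d := (g_sigma_algebraType (@open 'rV[R]_d)).

(* sup_D |f| + sup_D |Df| + the alpha-Hoelder seminorm of Df on D *)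
Definition holder1_norm (R : realType) (V W G : normedModType R) (alpha : R)
    (D : set V) (f : V -> W) (Df : V -> G) : \bar R :=
  (ereal_sup [set (`|f x|)%:E | x in D]
   + ereal_sup [set (`|Df x|)%:E | x in D]
   + ereal_sup [set (`|Df z.1 - Df z.2| / `|z.1 - z.2| `^ alpha)%:E
               | z in [set z : V * V | [/\ D z.1, D z.2 & z.1 != z.2]]])%E.

Definition has_partials (R : realType) (d : nat) (W : normedModType R)
    (f : 'rV[R]_d -> W) (x : 'rV[R]_d) : Prop :=
  forall i : 'I_d, derivable f x (delta_mx 0 i).

Definition grad (R : realType) (d : nat) (f : 'rV[R]_d -> R) (x : 'rV[R]_d) :
    'rV[R]_d :=
  \row_i 'D_(delta_mx 0 i) f x.

(* entry (i, j) is the i-th partial derivative of the j-th component, the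
   library's convention for 'J *)
Definition jac (R : realType) (d m : nat) (b : 'rV[R]_d -> 'rV[R]_m)
    (x : 'rV[R]_d) : 'M[R]_(d, m) :=
  \matrix_(i, j) ('D_(delta_mx 0 i) b x) 0 j.

Definition C1a_norm (R : realType) (d : nat) (alpha : R) (f : 'rV[R]_d -> R) :
    \bar R :=
  holder1_norm alpha setT (f : 'rV[R]_d -> R^o) (grad f).

Definition C1a (R : realType) (d : nat) (alpha : R) (f : 'rV[R]_d -> R) : Prop :=
  (forall x, has_partials (f : 'rV[R]_d -> R^o) x) /\ (C1a_norm alpha f < +oo)%E.

Definition C1a_field_norm (R : realType) (d : nat) (alpha : R)
    (b : 'rV[R]_d -> 'rV[R]_d) : \bar R :=
  holder1_norm alpha setT b (jac b).

Definition C1a_field (R : realType) (d : nat) (alpha : R)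
    (b : 'rV[R]_d -> 'rV[R]_d) : Prop :=
  (forall x, has_partials b x) /\ (C1a_field_norm alpha b < +oo)%E.

Definition C0_C1a_field (R : realType) (d : nat) (alpha : R)
    (b : R -> 'rV[R]_d -> 'rV[R]_d) : Prop :=
  forall t, 0 <= t ->
    C1a_field alpha (b t) /\
    C1a_field_norm alpha (fun x => b s x - b t x)
      @[s --> within [set s | 0 <= s] (nbhs t)] --> 0%E.

Definition spacetime (R : realType) (d : nat) : set (R * 'rV[R]_d) :=
  [set z | 0 <= z.1].

(* difference quotients stay in [0, +oo[, so the time derivative is one-sided
   at t = 0 *)
Definition dt_quotient (R : realType) (d : nat) (f : R -> 'rV[R]_d -> R)
    (t : R) (x : 'rV[R]_d) : set_system R :=
  (s^-1 * (f (t + s) x - f t x))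
    @[s --> within [set s | 0 <= t + s] (0 : R)^'].

Definition dt (R : realType) (d : nat) (f : R -> 'rV[R]_d -> R)
    (t : R) (x : 'rV[R]_d) : R :=
  lim (dt_quotient f t x).

Definition has_spacetime_partials (R : realType) (d : nat)
    (f : R -> 'rV[R]_d -> R) : Prop :=
  forall t x, 0 <= t ->
    cvg (dt_quotient f t x) /\ has_partials (f t : 'rV[R]_d -> R^o) x.

Definition C1a_spacetime (R : realType) (d : nat) (alpha : R)
    (w : R -> 'rV[R]_d -> R) : Prop :=
  has_spacetime_partials w /\
  (holder1_norm alpha (@spacetime R d) (fun z => w z.1 z.2 : R^o)
     (fun z => (dt w z.1 z.2, grad (w z.1) z.2)) < +oo)%E.

Definition C1c_spacetime (R : realType) (d : nat)
    (phi : R -> 'rV[R]_d -> R) : Prop :=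
  [/\ has_spacetime_partials phi,
      {within @spacetime R d, continuous (fun z => phi z.1 z.2)},
      {within @spacetime R d, continuous (fun z => dt phi z.1 z.2)},
      {within @spacetime R d, continuous (fun z => grad (phi z.1) z.2)} &
      compact (closure (@spacetime R d `&` [set z | phi z.1 z.2 != 0]))].

Definition narrowly_continuous (R : realType) (d : nat)
    (mu : R -> {finite_measure set (borel R d) -> \bar R}) : Prop :=
  forall eta : 'rV[R]_d -> R, continuous eta -> bounded_fun eta ->
    {within [set t | 0 <= t], continuous (fun t : R => \int[mu t]_x eta x)}.

(* mu_t is only required to be a finite positive measure: the growth term w
   does not preserve the total mass. Solutions made of probability measures
   are the special case. *)
Definition weak_solution (R : realType) (d : nat)
    (b : R -> 'rV[R]_d -> 'rV[R]_d) (w : R -> 'rV[R]_d -> R)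
    (mu0 : probability (borel R d) R)
    (mu : R -> {finite_measure set (borel R d) -> \bar R}) : Prop :=
  narrowly_continuous mu /\
  forall phi : R -> 'rV[R]_d -> R, C1c_spacetime phi ->
    \int[lebesgue_measure]_(t in `[0, +oo[)
       (\int[mu t]_x (dt phi t x + \sum_i b t x 0 i * grad (phi t) x 0 i))
    + \int[mu0]_x phi 0 x
    = - \int[lebesgue_measure]_(t in `[0, +oo[) (\int[mu t]_x (w t x * phi t x)).

(* An element of the dual of C^{1+alpha}(R^d) is represented by a map on all
   functions R^d -> R of which only the values on C^{1+alpha} matter. *)
Definition dual_norm (R : realType) (d : nat) (alpha : R)
    (T : ('rV[R]_d -> R) -> R) : \bar R :=
  ereal_sup [set (`|T f|)%:E
            | f in [set f | C1a alpha f /\ (C1a_norm alpha f <= 1)%E]].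

Definition in_dual (R : realType) (d : nat) (alpha : R)
    (T : ('rV[R]_d -> R) -> R) : Prop :=
  (forall (a : R) f g, C1a alpha f -> C1a alpha g ->
     T (fun x => a * f x + g x) = a * T f + T g) /\
  (dual_norm alpha T < +oo)%E.

Definition charge_pairing (R : realType) (d : nat)
    (nu : {charge set (borel R d) -> \bar R}) (P N : set (borel R d))
    (nuPN : hahn_decomposition nu P N) (f : 'rV[R]_d -> R) : R :=
  \int[jordan_pos nuPN]_x f x - \int[jordan_neg nuPN]_x f x.

Definition in_Z (R : realType) (d : nat) (alpha : R)
    (T : ('rV[R]_d -> R) -> R) : Prop :=
  in_dual alpha T /\
  forall e : R, 0 < e ->
    exists (nu : {charge set (borel R d) -> \bar R}) (P N : set (borel R d))
           (nuPN : hahn_decomposition nu P N),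
      (dual_norm alpha (fun f => T f - charge_pairing nuPN f)%R < e%:E)%E.

(* h + l stays in I, so derivatives at the endpoints of I are one-sided *)
Definition is_Z_derivative (R : realType) (d : nat) (alpha : R) (I : set R)
    (nu : R -> {finite_measure set (borel R d) -> \bar R}) (h : R)
    (T : ('rV[R]_d -> R) -> R) : Prop :=
  in_Z alpha T /\
  dual_norm alpha (fun f : 'rV[R]_d -> R =>
      l^-1 * (\int[nu (h + l)]_x f x - \int[nu h]_x f x) - T f)
    @[l --> within [set l | I (h + l)] (0 : R)^'] --> 0%E.

(* Main.v *)
(* No flow of the ODE is needed: everything is done by duality, with one Euler
   step P_tau f (x) = (1 + tau w(t,x)) f(x + tau b(t,x)) of the dual equation.
   It maps the ball of radius K of C^{1+alpha} into the ball of radius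
   K (1 + C tau), and the weak formulation gives
     \int f dmu_{t+tau} = \int P_tau f dmu_t + o(tau) K
   uniformly over that ball. A Gronwall argument for functionals on C^{1+alpha}
   then yields in turn: a bound on the masses uniform in h, the Lipschitz
   dependence of mu_t^h on h in the dual norm, and the Cauchy property of the
   difference quotients in h as the step tends to 0. In the last one the source
   term is \int b1 . grad f d(mu_t^{h+l} - mu_t^{h+l'}), whose integrand is only
   C^alpha; it is replaced by the quotient (f(x + eta b1(x)) - f(x)) / eta, which
   is C^{1+alpha} with norm O(1/eta) and uniformly O(eta^alpha)-close.
   The limit of the quotients is the derivative; it lies in Z because each
   quotient is the pairing with a charge. *)
Require Import Defs.
From HB Require Import structures.
From mathcomp Require Import all_boot all_order all_algebra.
From mathcomp Require Import all_classical all_reals all_analysis.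
From mathcomp Require Import measurable_realfun ring lra.
Import Order.TTheory GRing.Theory Num.Theory.
Import numFieldNormedType.Exports.
Set Implicit Arguments.
Unset Strict Implicit.
Unset Printing Implicit Defensive.
Local Open Scope classical_set_scope.
Local Open Scope ring_scope.

(** * Functions with Hoelder partial derivatives *)

(** The weak equation accepts only compactly supported test functions, so each estimate is first
    proved for those, with constants independent of the support; multiplication by cutoffs bounded
    in C^{1+alpha} and dominated convergence then lift the restriction. The factor 1 + C tau of an
    Euler step must have leading coefficient exactly 1: of the order of 1 / tau steps are composed,
    and a fixed loss per step would blow up as tau tends to 0. The dual generator f -> b . grad f +
    w f maps C^{1+alpha} only into C^alpha, so its values cannot be tested again. This obstacle
    occurs twice, in the error of one Euler step and in the source of the difference quotients. Both
    times a quotient of step eta replaces it; eta is fixed first, from the accuracy wanted, and only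
    then is the time step, respectively the increment in h, made small compared with eta. No
    candidate for the derivative is written down: the quotients converge on each f because R is
    complete, and uniformity of the Cauchy estimate over C^{1+alpha} balls turns this into
    convergence in the dual norm. *)

Section RowVectors.
Variables (R : realType) (d : nat).
Implicit Types (x v : 'rV[R]_d) (i j : 'I_d).

Lemma rV_norm_ge x i : `|x 0 i| <= `|x|.
Proof. by rewrite [leRHS]/Num.Def.normr/= mx_normrE; exact: (le_bigmax _ _ (0, i)). Qed.

Lemma rV_norm_le x (K : R) : 0 <= K -> (forall i, `|x 0 i| <= K) -> `|x| <= K.
Proof.
move=> K0 xK; rewrite /Num.Def.normr/= mx_normrE; apply: bigmax_le => // -[i j] _ /=.
by rewrite (ord1 i).
Qed.

Lemma sum_le_dK (F : 'I_d -> R) (K : R) : (forall i, F i <= K) -> \sum_i F i <= d%:R * K.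
Proof.
move=> FK; rewrite mulr_natl -[in leRHS](card_ord d) -sumr_const.
exact: ler_sum.
Qed.

Lemma normr_sum_le_dK (F : 'I_d -> R) (K : R) :
  (forall i, `|F i| <= K) -> `|\sum_i F i| <= d%:R * K.
Proof. by move=> FK; apply: le_trans (ler_norm_sum _ _ _) _; exact: sum_le_dK. Qed.

Lemma MVT_line (f : 'rV[R]_d -> R) x i (r : R) :
  (forall y, has_partials (f : _ -> R^o) y) ->
  exists c : R, `|c| <= `|r| /\
    f (x + r *: delta_mx 0 i) - f x = r * 'D_(delta_mx 0 i) f (x + c *: delta_mx 0 i).
Proof.
move=> fd.
pose e : 'rV[R]_d := delta_mx 0 i.
pose g (s : R) := f (x + s *: e).
pose dg (s : R) := 'D_e f (x + s *: e).
have dgE (s : R) : is_derive s 1 g (dg s).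
  have E : (fun h : R => h^-1 *: ((g \o shift s) (h *: (1 : R^o)) - g s)) =
           (fun h : R => h^-1 *: ((f \o shift (x + s *: e)) (h *: e) - f (x + s *: e))).
    apply/funext => h; rewrite /g /shift /=; congr (_ *: (f _ - _)).
    by rewrite [h%:A]mulr1 scalerDl addrCA.
  split; first by rewrite /derivable E; exact: fd.
  by rewrite /derive E.
have gc a b : {within `[a, b], continuous g}.
  by apply: derivable_within_continuous => y _; exact: (@ex_derive _ _ _ _ _ _ _ (dgE y)).
have [r0|r0] := leP 0 r.
- have [c /[!in_itv]/= /andP[c0 cr]] := MVT_segment r0 (fun s _ => dgE s) (gc 0 r).
  rewrite /g scale0r addr0 subr0 => ->; exists c; split.
    by rewrite !ger0_norm.
  by rewrite mulrC.
- have [c /[!in_itv]/= /andP[c0 cr]] := MVT_segment (ltW r0) (fun s _ => dgE s) (gc r 0).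
  rewrite /g scale0r addr0 => E; exists c; split.
    by rewrite !ler0_norm ?lerN2// ltW.
  by rewrite -opprB E /dg sub0r mulrN opprK mulrC.
Qed.

(* walk from x to x + v along the coordinate directions *)
Lemma MVT_rV (f : 'rV[R]_d -> R) x v :
  (forall y, has_partials (f : _ -> R^o) y) ->
  exists z : 'I_d -> 'rV[R]_d, (forall i, `|z i - x| <= `|v|) /\
    f (x + v) - f x = \sum_i v 0 i * 'D_(delta_mx 0 i) f (z i).
Proof.
move=> fd.
(* Induction over the list of coordinates already walked. As no coordinate occurs twice, each
   coordinate of [z i - x] stays below that of v in absolute value, which is what the max norm asks
   for. *)
suff H (s : seq 'I_d) : uniq s -> exists z : 'I_d -> 'rV[R]_d,
    (forall i, `|z i - x| <= `|v|) /\
    f (x + \sum_(i <- s) v 0 i *: delta_mx 0 i) - f x =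
      \sum_(i <- s) v 0 i * 'D_(delta_mx 0 i) f (z i).
  have [z [zv zE]] := H _ (index_enum_uniq 'I_d).
  exists z; split => //; rewrite -zE; congr (f (_ + _) - _).
  by rewrite {1}(row_sum_delta v).
elim: s => [_|i s IH /= /andP[iNs us]].
  by exists (fun=> x); split=> [i|]; rewrite ?big_nil ?addr0 ?subrr ?normr0.
have [z [zv zE]] := IH us.
set y := \sum_(i <- s) _ in zE.
have [c [cr cE]] := MVT_line (x + y) i (v 0 i) fd.
exists (fun j => if j == i then x + y + c *: delta_mx 0 i else z j); split=> [j|].
- case: eqP => // _.
  rewrite (_ : _ - x = y + c *: delta_mx 0 i); last by rewrite -!addrA addrC -!addrA addNr addr0.
  apply: rV_norm_le => // k; rewrite !mxE /= {1}/y summxE.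
  have yk : (y 0 k = if k \in s then v 0 k else 0).
    rewrite /y summxE; case: ifPn => ks.
      rewrite (bigD1_seq k) //= !mxE !eqxx mulr1 big1 ?addr0// => l lk.
      by rewrite !mxE eqxx /= eq_sym (negbTE lk) mulr0.
    rewrite big_seq big1// => l ls; rewrite !mxE eqxx /=.
    by case: eqP ks => [->|_]; rewrite ?ls// mulr0.
  rewrite -summxE -/y yk; have [->|ki] := eqVneq k i.
    by rewrite (negbTE iNs) add0r mulr1 (le_trans cr)// rV_norm_ge.
  by rewrite mulr0 addr0; case: ifP => _; rewrite ?normr0 ?rV_norm_ge.
- rewrite !big_cons eqxx.
  rewrite (_ : \sum_(j <- s) v 0 j * _ = \sum_(j <- s) v 0 j * 'D_(delta_mx 0 j) f (z j)).
    rewrite -zE -cE -/y [_ *: _ + y]addrC addrA.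
    by rewrite addrA subrK.
  rewrite big_seq [RHS]big_seq; apply: eq_bigr => j js.
  by case: eqP => // ji; move: iNs; rewrite -ji js.
Qed.

End RowVectors.

(** The covector comes first, so that [dotv c] is a linear map that can be identified with a
    differential. *)
Definition dotv (R : realType) (d : nat) (c v : 'rV[R]_d) : R :=
  \sum_i v 0 i * c 0 i.

Fact dotv_is_linear (R : realType) (d : nat) (c : 'rV[R]_d) :
  linear (dotv c : 'rV[R]_d -> R^o).
Proof.
move=> a u v; rewrite /dotv scaler_sumr -big_split; apply: eq_bigr => i _ /=.
by rewrite !mxE mulrDl -mulrA.
Qed.

HB.instance Definition _ (R : realType) (d : nat) (c : 'rV[R]_d) :=
  GRing.isLinear.Build R 'rV[R]_d R^o *:%R (dotv c) (@dotv_is_linear R d c).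

Section ContinuousPartials.
Variables (R : realType) (d : nat).
Implicit Types (x v : 'rV[R]_d) (f : 'rV[R]_d -> R).

Lemma norm_dotv_le (c v : 'rV[R]_d) : `|dotv c v| <= d%:R * `|c| * `|v|.
Proof.
rewrite -mulrA; apply: normr_sum_le_dK => i; rewrite normrM mulrC.
by rewrite ler_pM// rV_norm_ge.
Qed.

(** The points supplied by [MVT_rV] lie within [|v|] of x, so continuity of the partials at x
    controls every term of the increment. *)
Lemma differentiable_partials f x :
  (forall y, has_partials (f : _ -> R^o) y) ->
  (forall i, {for x, continuous (fun y => 'D_(delta_mx 0 i) f y : R)}) ->
  differentiable (f : _ -> R^o) x /\ 'd (f : _ -> R^o) x = dotv (grad f x) :> (_ -> _).
Proof.
move=> fd fc.
have dc : continuous (dotv (grad f x) : 'rV[R]_d -> R^o).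
  apply: bounded_linear_continuous.
  apply/linear_boundedP; near=> r => v; apply: le_trans (norm_dotv_le _ _) _.
  by apply: ler_wpM2r => //; near: r; exact: nbhs_pinfty_ge.
have E : 'd (f : _ -> R^o) x = dotv (grad f x) :> (_ -> _) /\
    (f : _ -> R^o) \o shift x =
      cst (f x : R^o) + (dotv (grad f x) : 'rV[R]_d -> R^o) +o_ (0 : 'rV[R]_d) id.
  suff E : (f : 'rV[R]_d -> R^o) \o shift x =
      cst (f x : R^o) + (dotv (grad f x) : 'rV[R]_d -> R^o) +o_ (0 : 'rV[R]_d) id.
    split=> //; exact: (diff_unique dc E).
  apply/(@eqaddoP _ _ R^o) => e e0.
  (* Dividing by d + 1 rather than d keeps the share of each coordinate positive when d = 0. *)
  have e1 : 0 < e / d.+1%:R by rewrite divr_gt0.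
  have : \forall y \near x, forall i,
      `|'D_(delta_mx 0 i) f x - 'D_(delta_mx 0 i) f y| <= e / d.+1%:R.
    apply: (@filter_forall _ _ (fun i => [set y | `|'D_(delta_mx 0 i) f x - 'D_(delta_mx 0 i) f y| <= e / d.+1%:R]) (nbhs x)) => i.
    by move/cvgrPdist_le : (fc i) => /(_ _ e1).
  move=> /nbhs_ballP[r /= r0 rf].
  apply/nbhs_ballP; exists r => //= v.
  rewrite -ball_normE /= sub0r normrN => vr.
  rewrite /cst/= !fctE.
  have [z [zv]] := MVT_rV x v fd.
  rewrite [v + x]addrC opprD addrA => ->.
  rewrite /dotv -sumrB.
  apply: (@le_trans _ _ (d%:R * (e / d.+1%:R * `|v|))).
    apply: normr_sum_le_dK => i.
    rewrite !mxE -mulrBr normrM mulrC ler_pM ?rV_norm_ge//.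
    rewrite distrC; apply: rf.
    rewrite -ball_normE /= distrC (le_lt_trans (zv i))//.
  rewrite mulrA ler_wpM2r// mulrCA ger_pMr//.
  by rewrite ler_pdivrMr// mul1r ler_nat.
have [dE fE] := E.
by split=> //; apply/diff_locallyP; rewrite dE; split.
Unshelve. all: by end_near. Qed.

End ContinuousPartials.

(** Working substitute for the C^{1+alpha} norm: real bounds with one common constant instead of a
    sum of suprema in the extended reals. For d > 0 it contains the ball of radius K of [C1a_norm]
    ([C1a_C1bd]), so bounds that are uniform over it bound dual norms. *)
Definition C1bd (R : realType) (d : nat) (alpha K : R) (f : 'rV[R]_d -> R) : Prop :=
  [/\ forall x, has_partials (f : 'rV[R]_d -> R^o) x,
      forall x, `|f x| <= K,
      forall x i, `|'D_(delta_mx 0 i) f x| <= K &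
      forall x y i, `|'D_(delta_mx 0 i) f x - 'D_(delta_mx 0 i) f y|
                    <= K * `|x - y| `^ alpha].

(** * Powers with exponent alpha and Hoelder continuity *)

Section HoelderReal.
Variables (R : realType) (alpha : R).
Hypothesis a01 : 0 < alpha <= 1.

Let a0 : 0 < alpha. Proof. by case/andP: a01. Qed.
Let a1 : alpha <= 1. Proof. by case/andP: a01. Qed.

Lemma powRa_le (x y : R) : 0 <= x -> x <= y -> x `^ alpha <= y `^ alpha.
Proof.
move=> x0 xy; apply: ge0_ler_powR => //; rewrite ?nnegrE ?(ltW a0)//.
exact: le_trans xy.
Qed.

Lemma powRa_ge_id (x : R) : 0 <= x -> x <= 1 -> x <= x `^ alpha.
Proof.
rewrite le_eqVlt => /predU1P[<- _|x0 x1]; first exact: powR_ge0.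
by apply: ger1_powR => //; rewrite x0.
Qed.

Lemma powRaM_le (c x : R) : 1 <= c -> 0 <= x -> (c * x) `^ alpha <= c * x `^ alpha.
Proof.
move=> c1 x0; have c0 : 0 <= c by apply: le_trans c1.
by rewrite powRM// ler_wpM2r ?powR_ge0// ler1_powR.
Qed.

Lemma powRa_small (e : R) : 0 < e ->
  exists2 r : R, 0 < r & forall x, 0 <= x -> x <= r -> x `^ alpha <= e.
Proof.
move=> e0; exists (e `^ alpha^-1); first by rewrite powR_gt0.
move=> x x0 xr; apply: le_trans (powRa_le x0 xr) _.
by rewrite -powRrM mulVf ?gt_eqF// powRr1// ltW.
Qed.

Lemma hoelder_continuous (V W : normedModType R) (g : V -> W) (K : R) :
  (forall x y, `|g x - g y| <= K * `|x - y| `^ alpha) -> continuous g.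
Proof.
move=> gK x; apply/cvgrPdist_le => e e0.
(* Adding 1 to a nonnegative constant to make it a legitimate divisor is a device that recurs
   throughout. *)
have K1 : 0 < `|K| + 1 by rewrite ltr_wpDl.
have [r r0 rE] := powRa_small (divr_gt0 e0 K1).
apply/nbhs_ballP; exists r => //= y; rewrite -ball_normE /= => xyr.
apply: le_trans (gK x y) _; apply: (@le_trans _ _ ((`|K| + 1) * (e / (`|K| + 1)))).
  apply: (@le_trans _ _ ((`|K| + 1) * `|x - y| `^ alpha)).
    by rewrite ler_wpM2r ?powR_ge0// (le_trans (ler_norm K))// lerDl.
  by rewrite ler_wpM2l ?(ltW K1)// rE// ltW.
by rewrite mulrCA divff ?gt_eqF// mulr1.
Qed.

End HoelderReal.

(** * Algebra of the bounded C^{1+alpha} classes *)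

Section C1bdTheory.
Variables (R : realType) (d : nat) (alpha : R).
Hypothesis a01 : 0 < alpha <= 1.
Implicit Types (x y u v : 'rV[R]_d) (f g : 'rV[R]_d -> R) (K M : R) (i j : 'I_d).

Let D : R := d%:R.
Let D0 : 0 <= D. Proof. exact: ler0n. Qed.

Lemma C1bd_ge0 K f : C1bd alpha K f -> 0 <= K.
Proof. by case=> _ /(_ 0) + _ _; exact: le_trans. Qed.

Lemma C1bd_le K K' f : K <= K' -> C1bd alpha K f -> C1bd alpha K' f.
Proof.
move=> KK' [fd f0 f1 f2]; split => // [x|x i|x y i].
- exact: le_trans (f0 x) KK'.
- exact: le_trans (f1 x i) KK'.
- by apply: le_trans (f2 x y i) _; rewrite ler_wpM2r ?powR_ge0.
Qed.

Lemma C1bd_intro K f (f' : 'I_d -> 'rV[R]_d -> R) :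
  (forall x i, is_derive x (delta_mx 0 i) (f : _ -> R^o) (f' i x)) ->
  (forall x, `|f x| <= K) -> (forall x i, `|f' i x| <= K) ->
  (forall x y i, `|f' i x - f' i y| <= K * `|x - y| `^ alpha) ->
  C1bd alpha K f.
Proof.
move=> fd f0 f1 f2.
have E x i : 'D_(delta_mx 0 i) f x = f' i x by exact: (@derive_val _ _ _ _ _ _ _ (fd x i)).
split => // [x i|x i|x y i]; rewrite ?E//.
Qed.

Lemma C1bd_is_derive K f x i : C1bd alpha K f ->
  is_derive x (delta_mx 0 i) (f : _ -> R^o) ('D_(delta_mx 0 i) f x).
Proof. by case=> fd _ _ _; split => //; exact: fd. Qed.

Lemma C1bd_partial_continuous K f i : C1bd alpha K f ->
  continuous (fun x => 'D_(delta_mx 0 i) f x : R).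
Proof. by case=> _ _ _ f2; apply: (hoelder_continuous a01 (K := K)) => x y; exact: f2. Qed.

Lemma C1bd_differentiable K f x : C1bd alpha K f ->
  differentiable (f : _ -> R^o) x /\ 'd (f : _ -> R^o) x = dotv (grad f x) :> (_ -> _).
Proof.
move=> fK; apply: differentiable_partials; first by case: fK.
by move=> i; exact: (C1bd_partial_continuous fK).
Qed.

Lemma C1bd_continuous K f : C1bd alpha K f -> continuous f.
Proof.
move=> fK x; exact: (differentiable_continuous (C1bd_differentiable x fK).1).
Qed.

Lemma C1bd_lip K f x y : C1bd alpha K f -> `|f x - f y| <= D * K * `|x - y|.
Proof.
move=> [fd _ f1 _]; have [z [_]] := MVT_rV y (x - y) fd.
rewrite [y + _]addrC subrK => ->; rewrite -mulrA; apply: normr_sum_le_dK => i.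
by rewrite normrM mulrC ler_pM// rV_norm_ge.
Qed.

(** For [|x - y| <= 1] the Lipschitz bound D K wins, as s <= s^alpha on [0, 1]; beyond, the sup
    bound 2 K does. The constant is the sum of the two. *)
Lemma C1bd_hoelder K f x y : C1bd alpha K f ->
  `|f x - f y| <= (D + 2) * K * `|x - y| `^ alpha.
Proof.
move=> fK; have K0 := C1bd_ge0 fK; have [_ f0 _ _] := fK.
have [xy1|/ltW xy1] := leP `|x - y| 1.
  apply: le_trans (C1bd_lip x y fK) _; apply: ler_pM => //; first by rewrite mulr_ge0.
    by rewrite ler_wpM2r// lerDl.
  exact: powRa_ge_id.
apply: (@le_trans _ _ (2 * K * 1)).
  by rewrite mulr1 mulr_natl mulr2n (le_trans (ler_normB _ _))// lerD.
apply: ler_pM => //; first by rewrite mulr_ge0.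
  by rewrite ler_wpM2r// lerDr.
by have := powRa_le a01 ler01 xy1; rewrite powR1.
Qed.

(** The increment starts at x + v while the gradient is taken at x. The case v = 0 serves the
    consistency of one Euler step, v = tau b(x) the comparison of two Euler steps. *)
Lemma C1bd_taylor K f x v u : C1bd alpha K f ->
  `|f (x + v + u) - f (x + v) - dotv (grad f x) u| <=
    D * K * `|u| * (`|u| + `|v|) `^ alpha.
Proof.
move=> fK; have K0 := C1bd_ge0 fK; have [fd _ _ f2] := fK.
have [z [zE ->]] := MVT_rV (x + v) u fd.
rewrite /dotv -sumrB -!mulrA; apply: normr_sum_le_dK => i.
rewrite !mxE -mulrBr normrM mulrCA ler_pM ?rV_norm_ge//.
apply: le_trans (f2 _ _ _) _; rewrite ler_wpM2l// powRa_le//.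
by rewrite -(subrK v (z i - x)) (le_trans (ler_normD _ _))// lerD2r -addrA -opprD.
Qed.

Lemma C1bdD K M f g : C1bd alpha K f -> C1bd alpha M g ->
  C1bd alpha (K + M) (fun x => f x + g x).
Proof.
move=> fK gM; have [_ f0 f1 f2] := fK; have [_ g0 g1 g2] := gM.
apply: (@C1bd_intro _ _ (fun i x => 'D_(delta_mx 0 i) f x + 'D_(delta_mx 0 i) g x)).
- move=> x i; have := C1bd_is_derive x i fK; have := C1bd_is_derive x i gM.
  by move=> gd fd; exact: (@is_deriveD _ _ R^o f g x _ _ _ fd gd).
- by move=> x; rewrite (le_trans (ler_normD _ _))// lerD.
- by move=> x i; rewrite (le_trans (ler_normD _ _))// lerD.
- move=> x y i; rewrite opprD addrACA (le_trans (ler_normD _ _))// mulrDl.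
  by rewrite lerD.
Qed.

Lemma C1bdZ K f (c : R) : C1bd alpha K f -> C1bd alpha (`|c| * K) (fun x => c * f x).
Proof.
move=> fK; have [_ f0 f1 f2] := fK.
apply: (@C1bd_intro _ _ (fun i x => c * 'D_(delta_mx 0 i) f x)).
- move=> x i; exact: (@is_deriveZ _ _ R^o f c x _ _ (C1bd_is_derive x i fK)).
- by move=> x; rewrite normrM ler_wpM2l.
- by move=> x i; rewrite normrM ler_wpM2l.
- by move=> x y i; rewrite -mulrBr normrM -mulrA ler_wpM2l.
Qed.

Lemma normrMB_le (a b a' b' A B eA eB : R) : `|a| <= A -> `|b'| <= B ->
  `|a - a'| <= eA -> `|b - b'| <= eB -> `|a * b - a' * b'| <= A * eB + B * eA.
Proof.
move=> aA bB ae be.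
rewrite (_ : _ - _ = a * (b - b') + b' * (a - a')); last by ring.
by rewrite (le_trans (ler_normD _ _))// !normrM lerD// ler_pM.
Qed.

(** The constant comes from the Hoelder bound of the derivative: each of the two products costs 1
    from the derivative factor and D + 2 from [C1bd_hoelder]. *)
Lemma C1bdM K M f g : C1bd alpha K f -> C1bd alpha M g ->
  C1bd alpha ((2 * D + 6) * (K * M)) (fun x => f x * g x).
Proof.
move=> fK gM; have [_ f0 f1 f2] := fK; have [_ g0 g1 g2] := gM.
have K0 := C1bd_ge0 fK; have M0 := C1bd_ge0 gM.
have KM0 : 0 <= K * M by rewrite mulr_ge0.
have DKM : 0 <= D * (K * M) by rewrite mulr_ge0.
have KMC2 : 2 * (K * M) <= (2 * D + 6) * (K * M).
  by rewrite ler_wpM2r//; have := D0; lra.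
have KMC : K * M <= (2 * D + 6) * (K * M) by apply: le_trans KMC2; lra.
apply: (@C1bd_intro _ _
  (fun i x => f x * 'D_(delta_mx 0 i) g x + g x * 'D_(delta_mx 0 i) f x)).
- move=> x i; have := C1bd_is_derive x i fK; have := C1bd_is_derive x i gM.
  move=> gd fd; exact: (@is_deriveM _ _ f g x _ _ _ fd gd).
- by move=> x; rewrite normrM (le_trans _ KMC)// ler_pM.
- move=> x i; rewrite (le_trans (ler_normD _ _))// !normrM.
  by rewrite (le_trans _ KMC2)// mulr2n mulrDl mul1r [in X in _ <= _ + X]mulrC lerD// ler_pM.
- move=> x y i; set h := _ `^ _.
  have h0 : 0 <= h := powR_ge0 _ _.
  rewrite opprD addrACA (le_trans (ler_normD _ _))//.
  have A := normrMB_le (f0 x) (g1 y i) (C1bd_hoelder x y fK) (g2 x y i).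
  have B := normrMB_le (g0 x) (f1 y i) (C1bd_hoelder x y gM) (f2 x y i).
  apply: le_trans (lerD A B) _; rewrite -/h le_eqVlt; apply/orP; left; apply/eqP; ring.
Qed.

End C1bdTheory.

(** * The Euler step of the dual equation *)

Definition fbd (R : realType) (d : nat) (alpha M : R) (b : 'rV[R]_d -> 'rV[R]_d) : Prop :=
  forall j, C1bd alpha M (fun x => b x 0 j).

Definition csupp (R : realType) (d : nat) (r : R) (f : 'rV[R]_d -> R) : Prop :=
  forall x, r < `|x| -> f x = 0.

(* one explicit Euler step, of length tau and backwards in time, of the dual
   equation dt f + b . grad f + w f = 0 *)
Definition euler (R : realType) (d : nat) (tau : R) (b : 'rV[R]_d -> 'rV[R]_d)
    (w f : 'rV[R]_d -> R) (x : 'rV[R]_d) : R :=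
  (1 + tau * w x) * f (x + tau *: b x).

Section EulerStep.
Variables (R : realType) (d : nat) (alpha : R).
Hypothesis a01 : 0 < alpha <= 1.
Implicit Types (x y u v : 'rV[R]_d) (f g w : 'rV[R]_d -> R) (K tau : R) (i j : 'I_d).
Implicit Type b : 'rV[R]_d -> 'rV[R]_d.

Let D : R := d%:R.
Let D0 : 0 <= D. Proof. exact: ler0n. Qed.

Lemma C1bd0 : C1bd alpha 0 ((fun=> 0) : 'rV[R]_d -> R).
Proof.
apply: (@C1bd_intro _ _ _ _ _ (fun _ _ => 0)) => *; rewrite ?subrr ?normr0 ?mul0r//.
Qed.

Lemma fbd_norm_le (M : R) b x : 0 <= M -> fbd alpha M b -> `|b x| <= M.
Proof. by move=> M0 bM; apply: rV_norm_le => // j; have [_ + _ _] := bM j; exact. Qed.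

Lemma fbd_lip (M : R) b x y : 0 <= M -> fbd alpha M b ->
  `|b x - b y| <= D * M * `|x - y|.
Proof.
move=> M0 bM; apply: rV_norm_le => [|j]; first by rewrite !mulr_ge0.
by rewrite !mxE; have := C1bd_lip x y (bM j).
Qed.

Lemma fbdD (M N : R) b c : fbd alpha M b -> fbd alpha N c ->
  fbd alpha (M + N) (fun x => b x + c x).
Proof.
move=> bM cN j; have := C1bdD (bM j) (cN j); congr C1bd; apply/funext => x.
by rewrite mxE.
Qed.

Lemma fbdZ (M : R) (k : R) b : fbd alpha M b -> fbd alpha (`|k| * M) (fun x => k *: b x).
Proof.
move=> bM j; have := C1bdZ k (bM j); congr C1bd; apply/funext => x.
by rewrite mxE.
Qed.

Lemma fbd_differentiable (M : R) b x : fbd alpha M b -> differentiable b x.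
Proof.
move=> bM; have -> : b = fun y => \sum_j (b y 0 j *: delta_mx 0 j : 'rV[R]_d).
  by apply/funext => y; rewrite {1}(row_sum_delta (b y)).
rewrite -fct_sumE; apply: differentiable_sum => j.
exact: (differentiableZl _ (C1bd_differentiable a01 x (bM j)).1).
Qed.

Lemma is_derive_comp_flow (K M tau : R) f b x i : C1bd alpha K f -> fbd alpha M b ->
  is_derive x (delta_mx 0 i) (fun y => f (y + tau *: b y) : R^o)
   ('D_(delta_mx 0 i) f (x + tau *: b x) + tau * \sum_j
      'D_(delta_mx 0 i) (fun y => b y 0 j) x * 'D_(delta_mx 0 j) f (x + tau *: b x)).
Proof.
move=> fK bM; have bd := fbd_differentiable x bM.
pose Phi (y : 'rV[R]_d) := y + tau *: b y.
have Phid : differentiable Phi x.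
  by apply: differentiableD => //; exact: differentiableZ.
have bdd v : derivable b x v by exact: diff_derivable.
have [fd fE] := C1bd_differentiable a01 (Phi x) fK.
have cd : differentiable (f \o Phi : _ -> R^o) x by exact: differentiable_comp.
split; first exact: diff_derivable.
rewrite [LHS](deriveE _ cd) diff_comp// fE /=.
rewrite -(deriveE _ Phid).
have -> : 'D_(delta_mx 0 i) Phi x = delta_mx 0 i + tau *: 'D_(delta_mx 0 i) b x.
  by rewrite deriveD ?derive_id ?deriveZ//; exact: derivableZ.
rewrite derive_mx//.
rewrite /dotv (eq_bigr (fun j => (delta_mx 0 i : 'rV[R]_d) 0 j * 'D_(delta_mx 0 j) f (Phi x)
   + tau * ('D_(delta_mx 0 i) (fun y => b y 0 j) x * 'D_(delta_mx 0 j) f (Phi x)))); last first.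
  by move=> j _; rewrite !mxE mulrDl -mulrA.
rewrite big_split /= -mulr_sumr; congr (_ + _).
rewrite (bigD1 i)//= big1 => [|j ji]; rewrite mxE !eqxx ?mul1r ?addr0//=.
by rewrite (negbTE ji) mul0r.
Qed.

Variable M : R.
Hypothesis M1 : 1 <= M.
Let M0 : 0 <= M. Proof. exact: le_trans M1. Qed.
Let DM0 : 0 <= D * M. Proof. exact: mulr_ge0. Qed.

(** The worst term is the Hoelder seminorm of the derivative. Here x + tau b(x) is Lipschitz with
    constant 1 + tau D M, whose power alpha is at most itself; the corrections of order tau are D M
    from the main term and D M (1 + D M) + D M from the sum over j. *)
Lemma C1bd_comp_flow K tau f b : 0 <= tau <= 1 -> C1bd alpha K f -> fbd alpha M b ->
  C1bd alpha (K * (1 + D * M * (3 + D * M) * tau)) (fun y => f (y + tau *: b y)).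
Proof.
move=> /andP[t0 t1] fK bM; have K0 := C1bd_ge0 fK; have [_ f0 f1 f2] := fK.
have tDM0 : 0 <= tau * (D * M) by rewrite mulr_ge0.
have tDM : tau * (D * M) <= D * M by rewrite ler_piMl.
have tDM2 : 0 <= tau * (D * M) * (D * M) by rewrite mulr_ge0.
apply: (C1bd_intro (fun x i => is_derive_comp_flow tau x i fK bM)).
- move=> x; apply: le_trans (f0 _) _; rewrite ler_peMr// lerDl.
  by rewrite !mulr_ge0// addr_ge0.
- move=> x i; rewrite (le_trans (ler_normD _ _))//.
  apply: (@le_trans _ _ (K + tau * (D * (M * K)))).
    rewrite lerD// normrM (ger0_norm t0) ler_wpM2l//.
    apply: normr_sum_le_dK => j; rewrite normrM ler_pM//.
    by have [_ _ + _] := bM j; exact.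
  rewrite (_ : K + _ = K * (1 + tau * (D * M))); last by ring.
  rewrite ler_wpM2l// lerD2l (_ : _ * tau = 3 * (tau * (D * M)) + tau * (D * M) * (D * M)).
    by lra.
  by ring.
- move=> x y i; set h := `|x - y| `^ alpha.
  have h0 : 0 <= h := powR_ge0 _ _.
  set Phi := fun z : 'rV[R]_d => z + tau *: b z.
  have PhiE : `|Phi x - Phi y| <= (1 + tau * (D * M)) * `|x - y|.
    rewrite /Phi opprD addrACA -scalerBr mulrDl mul1r (le_trans (ler_normD _ _))//.
    by rewrite lerD// normrZ (ger0_norm t0) -!mulrA ler_wpM2l// mulrA fbd_lip.
  have fPhi j : `|'D_(delta_mx 0 j) f (Phi x) - 'D_(delta_mx 0 j) f (Phi y)| <=
      K * ((1 + tau * (D * M)) * h).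
    apply: le_trans (f2 _ _ _) _; rewrite ler_wpM2l//.
    apply: le_trans (powRa_le a01 _ PhiE) _ => //.
    by rewrite powRaM_le// lerDl.
  rewrite opprD addrACA -mulrBr -sumrB (le_trans (ler_normD _ _))//.
  apply: (@le_trans _ _ (K * ((1 + tau * (D * M)) * h) +
      tau * (D * (M * (K * ((1 + D * M) * h)) + K * (M * h))))).
    rewrite lerD// normrM (ger0_norm t0) ler_wpM2l//.
    apply: (@le_trans _ _ (D * (M * (K * ((1 + tau * (D * M)) * h)) + K * (M * h)))).
      apply: normr_sum_le_dK => j; have [_ _ b1 b2] := bM j.
      exact: normrMB_le.
    rewrite ler_wpM2l// lerD2r ler_wpM2l// ler_wpM2l// ler_wpM2r//.
    by rewrite lerD2l.
  by rewrite le_eqVlt; apply/orP; left; apply/eqP; ring.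
Qed.

Lemma euler_C1bd : exists2 C : R, 0 <= C & forall tau K b w f, 0 <= tau <= 1 ->
  fbd alpha M b -> C1bd alpha M w -> C1bd alpha K f ->
  C1bd alpha (K * (1 + C * tau)) (euler tau b w f).
Proof.
pose c := D * M * (3 + D * M); pose c' := (2 * D + 6) * M.
have c0 : 0 <= c by rewrite !mulr_ge0// addr_ge0.
have c'0 : 0 <= c' by rewrite !mulr_ge0// addr_ge0// mulr_ge0.
(* Expansion of (1 + c tau)(1 + c' tau), the term in tau^2 being absorbed by tau <= 1; c is the cost
   of the displacement and c' that of the factor w. *)
exists (c + c' + c * c'); first by rewrite !addr_ge0// mulr_ge0.
move=> tau K b w f t01 bM wM fK; have K0 := C1bd_ge0 fK.
have t0 : 0 <= tau by case/andP: t01.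
have t1 : tau <= 1 by case/andP: t01.
have FK := C1bd_comp_flow t01 fK bM.
have := C1bdD FK (C1bdZ tau (C1bdM a01 wM FK)).
rewrite (_ : (fun x => _) = euler tau b w f); last first.
  by apply/funext => x; rewrite /euler; ring.
apply: C1bd_le; rewrite (ger0_norm t0) -/D -/c.
rewrite [leLHS](_ : _ = K * (1 + (c + c') * tau + c * c' * (tau * tau))); last by rewrite /c'; ring.
rewrite ler_wpM2l// -addrA lerD2l [leRHS]mulrDl lerD2l (ler_wpM2l (mulr_ge0 c0 c'0))//.
by rewrite ler_piMl.
Qed.

Lemma euler_csupp r tau b w f : 0 <= tau <= 1 -> fbd alpha M b -> csupp r f ->
  csupp (r + M) (euler tau b w f).
Proof.
move=> /andP[t0 t1] bM fr x rx; rewrite /euler fr ?mulr0//.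
have : `|tau *: b x| <= M.
  rewrite normrZ (ger0_norm t0) (@le_trans _ _ (1 * M)) ?mul1r//.
  by rewrite -[leRHS]mul1r ler_pM// fbd_norm_le.
move=> tM; rewrite -(ltrD2r M); apply: (lt_le_trans rx).
rewrite -{1}(addrK (tau *: b x) x) (le_trans (ler_normB _ _))//.
by rewrite lerD2l.
Qed.

Lemma dotv_grad_le K f x u : C1bd alpha K f -> `|dotv (grad f x) u| <= D * K * `|u|.
Proof.
move=> [_ _ f1 _]; rewrite -mulrA; apply: normr_sum_le_dK => i.
by rewrite normrM mulrC !mxE ler_pM// rV_norm_ge.
Qed.

Lemma dotvZ c (k : R) u : dotv c (k *: u) = k * dotv c u.
Proof. by rewrite /dotv mulr_sumr; apply: eq_bigr => i _; rewrite mxE mulrA. Qed.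

(** Two errors of equal weight: the Taylor remainder, of order tau^(1 + alpha), and the cross term
    tau w (f(x + tau b) - f(x)), of order tau^2 and hence below tau^(1 + alpha). *)
Lemma euler_consistent : exists2 C : R, 0 <= C & forall tau K b w f x, 0 <= tau <= 1 ->
  fbd alpha M b -> C1bd alpha M w -> C1bd alpha K f ->
  `|euler tau b w f x - f x - tau * (dotv (grad f x) (b x) + w x * f x)|
    <= C * K * tau * tau `^ alpha.
Proof.
exists (2 * (D * M * M)); first by rewrite !mulr_ge0.
move=> tau K b w f x /andP[t0 t1] bM wM fK; have K0 := C1bd_ge0 fK.
have bx := fbd_norm_le x M0 bM.
have tb : `|tau *: b x| <= tau * M by rewrite normrZ (ger0_norm t0) ler_wpM2l.
have ta0 : 0 <= tau `^ alpha := powR_ge0 _ _.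
have A := C1bd_taylor a01 x 0 (tau *: b x) fK.
have B := C1bd_lip (x + tau *: b x) x fK.
rewrite addr0 normr0 addr0 dotvZ in A; rewrite [x + _ - x]addrC addKr in B.
rewrite /euler (_ : _ - _ = (f (x + tau *: b x) - f x - tau * dotv (grad f x) (b x)) +
  tau * (w x * (f (x + tau *: b x) - f x))); last by ring.
apply: (le_trans (ler_normD _ _)).
rewrite (_ : 2 * _ * _ * _ * _ = D * M * M * K * tau * tau `^ alpha +
  D * M * M * K * tau * tau `^ alpha); last by ring.
apply: lerD.
  apply: (le_trans A).
  apply: (@le_trans _ _ (D * K * (tau * M) * (M * tau `^ alpha))).
    rewrite ler_pM ?powR_ge0// ?mulr_ge0// ?ler_wpM2l ?mulr_ge0//.
    by rewrite (le_trans (powRa_le a01 _ tb))// mulrC powRaM_le.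
  by rewrite le_eqVlt; apply/orP; left; apply/eqP; ring.
rewrite normrM (ger0_norm t0) normrM.
apply: (@le_trans _ _ (tau * (M * (D * K * (tau * M))))).
  rewrite ler_wpM2l// ler_pM//; first by have [_ + _ _] := wM; exact.
  by apply: (le_trans B); rewrite ler_wpM2l ?mulr_ge0.
rewrite (_ : tau * _ = D * M * M * K * tau * tau); last by ring.
by rewrite ler_wpM2l ?mulr_ge0// powRa_ge_id.
Qed.

Lemma euler_lip_field : exists2 C : R, 0 <= C & forall tau l K b b1 w f x,
  0 <= tau <= 1 -> fbd alpha M b1 -> C1bd alpha M w -> C1bd alpha K f ->
  `|euler tau (fun y => b y + l *: b1 y) w f x - euler tau b w f x|
    <= C * K * tau * `|l|.
Proof.
exists ((1 + M) * (D * M)); first by rewrite !mulr_ge0// addr_ge0.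
move=> tau l K b b1 w f x /andP[t0 t1] bM wM fK; have K0 := C1bd_ge0 fK.
have bx := fbd_norm_le x M0 bM.
have A := C1bd_lip (x + tau *: (b x + l *: b1 x)) (x + tau *: b x) fK.
rewrite /euler -mulrBr normrM.
rewrite (_ : _ - _ = tau *: (l *: b1 x)) in A; last first.
  by rewrite scalerDr addrA [_ + tau *: (l *: _)]addrC addrK.
apply: (@le_trans _ _ ((1 + M) * (D * K * (tau * (`|l| * M))))).
  apply: ler_pM => //.
    rewrite (le_trans (ler_normD _ _))// normr1 lerD2l normrM (ger0_norm t0).
    by rewrite -[leRHS]mul1r ler_pM//; have [_ + _ _] := wM; exact.
  apply: (le_trans A); rewrite ler_wpM2l ?mulr_ge0// !normrZ (ger0_norm t0).
  by rewrite ler_wpM2l// ler_wpM2l.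
by rewrite le_eqVlt; apply/orP; left; apply/eqP; ring.
Qed.

(** The remainder keeps a full factor [|l|], hence survives division by l uniformly as l tends to 0.
    For this f is compared directly at the two displaced points; comparing each Euler step with f(x)
    would lose that factor. *)
Lemma euler_diff_field : exists2 C : R, 0 <= C & forall tau l K b b1 w f x,
  0 <= tau <= 1 -> `|l| <= 1 ->
  fbd alpha M b -> fbd alpha M b1 -> C1bd alpha M w -> C1bd alpha K f ->
  `|euler tau (fun y => b y + l *: b1 y) w f x - euler tau b w f x
    - tau * l * dotv (grad f x) (b1 x)| <= C * K * tau * `|l| * tau `^ alpha.
Proof.
exists (2 * ((1 + M) * (D * M * M)) + D * M * M).
  by rewrite !(mulr_ge0, addr_ge0).
move=> tau l K b b1 w f x /andP[t0 t1] l1 bM b1M wM fK; have K0 := C1bd_ge0 fK.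
have bx := fbd_norm_le x M0 bM; have b1x := fbd_norm_le x M0 b1M.
have ta0 : 0 <= tau `^ alpha := powR_ge0 _ _.
have tb : `|tau *: b x| <= tau * M by rewrite normrZ (ger0_norm t0) ler_wpM2l.
have tb1 : `|tau *: (l *: b1 x)| <= tau * (`|l| * M).
  by rewrite !normrZ (ger0_norm t0) ler_wpM2l// ler_wpM2l.
have A := C1bd_taylor a01 x (tau *: b x) (tau *: (l *: b1 x)) fK.
rewrite -[x + _ + _]addrA -scalerDr !dotvZ in A.
set F1 := f _ in A; set F0 := f _ in A; set G := dotv _ _ in A.
have GE : `|G| <= D * K * M.
  by apply: (le_trans (dotv_grad_le x (b1 x) fK)); rewrite ler_wpM2l ?mulr_ge0.
have wx : `|w x| <= M by have [_ + _ _] := wM; exact.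
rewrite /euler -/F0 -/F1 -/G.
rewrite (_ : _ - _ = (1 + tau * w x) * (F1 - F0 - tau * (l * G)) +
  tau * w x * (tau * (l * G))); last by ring.
apply: (le_trans (ler_normD _ _)).
rewrite (_ : (_ + D * M * M) * _ * _ * _ * _ =
   2 * ((1 + M) * (D * M * M)) * K * tau * `|l| * tau `^ alpha
   + D * M * M * K * tau * `|l| * tau `^ alpha); last by ring.
apply: lerD.
  rewrite normrM.
  apply: (@le_trans _ _ ((1 + M) * (D * K * (tau * (`|l| * M)) * (2 * M * tau `^ alpha)))).
    apply: ler_pM => //.
      rewrite (le_trans (ler_normD _ _))// normr1 lerD2l normrM (ger0_norm t0).
      by rewrite -[leRHS]mul1r ler_pM.
    apply: (le_trans A); apply: ler_pM; rewrite ?powR_ge0 ?mulr_ge0//.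
      by rewrite ler_wpM2l ?mulr_ge0.
    apply: (@le_trans _ _ ((2 * M * tau) `^ alpha)).
      apply: powRa_le => //.
      rewrite (_ : 2 * M * tau = tau * M + tau * M); last by ring.
      rewrite lerD// (le_trans tb1)// ler_wpM2l// ler_piMl//.
    by apply: powRaM_le => //; have := M1; lra.
  by rewrite le_eqVlt; apply/orP; left; apply/eqP; ring.
rewrite !normrM (ger0_norm t0).
apply: (@le_trans _ _ (tau * M * (tau `^ alpha * (`|l| * (D * K * M))))).
  by rewrite ler_pM ?mulr_ge0// ?ler_wpM2l// ler_pM ?mulr_ge0// ?powRa_ge_id// ler_wpM2l.
by rewrite le_eqVlt; apply/orP; left; apply/eqP; ring.
Qed.

End EulerStep.

(** * Real analysis on the half-line *)

Definition half_line_continuous (R : realType) (m : R -> R) : Prop :=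
  forall t, 0 <= t -> forall e, 0 < e ->
    exists2 r, 0 < r & forall s, 0 <= s -> `|s - t| < r -> `|m s - m t| <= e.

Section RealAnalysis.
Variable R : realType.
Notation leb := (@lebesgue_measure R).

(** Real induction. The supremum c of the initial segments on which P holds belongs to them by the
    left hypothesis, and the right hypothesis pushes past it. *)
Lemma continuous_induction (P : R -> Prop) : P 0 ->
  (forall t : R, 0 <= t -> (forall s, 0 <= s <= t -> P s) ->
     exists2 e : R, 0 < e & forall s, 0 < s < e -> P (t + s)) ->
  (forall t : R, 0 < t -> (forall s, 0 <= s < t -> P s) -> P t) ->
  forall t : R, 0 <= t -> P t.
Proof.
move=> P0 Pright Pleft T T0; apply: contrapT => nPT.
pose S := [set t : R | 0 <= t /\ forall s, 0 <= s <= t -> P s].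
have S0 : S 0 by split => // s /andP[s0 s0']; rewrite (@le_anti _ _ s 0)// s0 s0'.
have ST : ubound S T.
  move=> t [t0 tP]; rewrite leNgt; apply/negP => Tt.
  by apply: nPT; apply: tP; rewrite T0 ltW.
have hS : has_sup S by split; [exists 0|exists T].
set c := sup S; have c0 : 0 <= c by exact: (ub_le_sup hS.2 S0).
have Pc s : 0 <= s < c -> P s.
  move=> /andP[s0 sc]; have [t [t0 tP] st] := sup_gt hS.1 sc.
  by apply: tP; rewrite s0 ltW.
have Sc s : 0 <= s <= c -> P s.
  move=> /andP[s0]; rewrite le_eqVlt => /predU1P[->|sc]; last by apply: Pc; rewrite s0.
  by move: c0; rewrite le_eqVlt => /predU1P[<-//|c0]; exact: Pleft.
have [e e0 Pe] := Pright c c0 Sc.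
have : S (c + e / 2).
  split; first by rewrite addr_ge0// divr_ge0// ltW.
  move=> s /andP[s0 sce]; have [sc|cs] := leP s c; first by apply: Sc; rewrite s0.
  rewrite -(subrK c s) addrC; apply: Pe; rewrite subr_gt0 cs/=.
  by rewrite ltrBlDl (le_lt_trans sce)// ltrD2l ltr_pdivrMr// ltr_pMr// ltr1n.
move=> /(ub_le_sup hS.2); rewrite -/c leNgt ltrDl divr_gt0//.
Qed.

Lemma within_half_line_continuous (m : R -> R) :
  {within [set t | 0 <= t], continuous m} -> half_line_continuous m.
Proof.
move=> /subspace_continuousP mc t t0 e e0.
have /cvgrPdist_le/(_ e e0) := mc t t0.
rewrite near_withinE => /nbhs_ballP[r /= r0 rm]; exists r => // s s0 st.
by rewrite distrC; apply: rm => //; rewrite -ball_normE /= distrC.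
Qed.

Lemma half_line_continuousB (f g : R -> R) : half_line_continuous f ->
  half_line_continuous g -> half_line_continuous (fun s => f s - g s).
Proof.
move=> fc gc t t0 e e0; have e20 : 0 < e / 2 by rewrite divr_gt0.
have [r r0 rP] := fc t t0 _ e20; have [r' r'0 r'P] := gc t t0 _ e20.
exists (Num.min r r'); first by rewrite lt_min r0.
move=> s s0; rewrite lt_min => /andP[sr sr'].
rewrite (_ : _ - _ = (f s - f t) - (g s - g t)); last by ring.
by rewrite (le_trans (ler_normB _ _))// [e]splitr lerD; [ |exact: rP|exact: r'P].
Qed.

Lemma half_line_continuousZ (c : R) (f : R -> R) : half_line_continuous f ->
  half_line_continuous (fun s => c * f s).
Proof.
move=> fc t t0 e e0; have c1 : 0 < `|c| + 1 by rewrite ltr_wpDl.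
have [r r0 rP] := fc t t0 _ (divr_gt0 e0 c1).
exists r => // s s0 sr; rewrite -mulrBr normrM.
apply: (@le_trans _ _ ((`|c| + 1) * (e / (`|c| + 1)))).
  by rewrite ler_pM// ?lerDl//; exact: rP.
by rewrite mulrCA divff ?mulr1// gt_eqF.
Qed.

(** Constant extension to negative times gives access to the theorems on functions continuous on the
    whole line. *)
Lemma half_line_continuous_max (m : R -> R) :
  half_line_continuous m -> continuous (fun s : R => m (Num.max 0 s)).
Proof.
move=> mc t; apply/cvgrPdist_le => e e0.
have mt : 0 <= Num.max 0 t by rewrite le_max lexx.
have [r r0 rm] := mc _ mt e e0.
apply/nbhs_ballP; exists r => //= s ts.
rewrite distrC; apply: rm; first by rewrite le_max lexx.
apply: le_lt_trans ts; rewrite /= [leRHS]distrC.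
have [s0|s0] := leP 0 s; have [t0|t0] := leP 0 t; rewrite ?subrr ?subr0 ?sub0r ?normrN ?normr0//.
- by rewrite !ger0_norm ?subr_ge0//; lra.
- by rewrite ger0_norm// ler0_norm; lra.
Qed.

(** The integral starts at -1 so that 0 is an interior point and the derivative there is
    two-sided. *)
Lemma antiderivative (f : R -> R) : continuous f ->
  exists F : R -> R, forall s : R, -1 < s -> is_derive s 1 F (f s).
Proof.
move=> fc; exists (fun x => \int[leb]_(t in `[-1, x]) f t) => s s1.
have fi : leb.-integrable `[-1, s + 1] (EFin \o f).
  apply: continuous_compact_integrable; first exact: segment_compact.
  exact: continuous_subspaceT.
have ss : s < s + 1 by rewrite ltrDl.
have [dF FE] := continuous_FTC1_closed ss fi s1 (fc s).
split; [exact: dF | by rewrite -FE derive1E].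
Qed.

Lemma is_derive_within_continuous (F f : R -> R) (a b : R) : -1 < a ->
  (forall s : R, -1 < s -> is_derive s 1 F (f s)) -> {within `[a, b], continuous F}.
Proof.
move=> a1 Ff; apply: derivable_within_continuous => s /[!in_itv]/= /andP[as_ _].
by apply: ex_derive; apply: Ff; exact: lt_le_trans as_.
Qed.

Lemma is_derive_MVT (F f : R -> R) (a b : R) : 0 <= a -> a <= b ->
  (forall s : R, -1 < s -> is_derive s 1 F (f s)) ->
  exists2 c, a <= c <= b & F b - F a = (b - a) * f c.
Proof.
move=> a0 ab Ff; have a1 : -1 < a by rewrite (lt_le_trans _ a0)// ltrN10.
have d x : x \in `]a, b[%R -> is_derive x 1 F (f x).
  by move=> /[!in_itv]/= /andP[ax _]; apply: Ff; exact: lt_trans ax.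
have [c] := MVT_segment ab d (is_derive_within_continuous (b := b) a1 Ff).
by rewrite in_itv/= => cab ->; exists c => //; rewrite mulrC.
Qed.

Lemma Rintegral_FTC2 (F f : R -> R) (T : R) : 0 < T ->
  (forall s : R, -1 < s -> is_derive s 1 F (f s)) ->
  {within `[0, T], continuous f} ->
  \int[leb]_(t in `[0, T]) f t = F T - F 0.
Proof.
move=> T0 Ff fc; have d s : 0 <= s -> derivable F s 1.
  by move=> s0; apply: ex_derive; apply: Ff; rewrite (lt_le_trans _ s0)// ltrN10.
have Fc s : 0 <= s -> {for s, continuous F}.
  by move=> /d /derivable1_diffP; exact: differentiable_continuous.
rewrite /Rintegral (@continuous_FTC2 R f F 0 T)//.
  split.
  - by move=> s /[!in_itv]/= /andP[/ltW/d].
  - by apply: cvg_at_right_filter; exact: Fc.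
  - by apply: cvg_at_left_filter; apply: Fc; exact: ltW.
move=> s /[!in_itv]/= /andP[s0 _]; rewrite derive1E; apply: derive_val.
by apply: Ff; exact: lt_trans s0.
Qed.

Lemma is_derive_half_line_continuous (F f : R -> R) :
  (forall s : R, -1 < s -> is_derive s 1 F (f s)) -> half_line_continuous F.
Proof.
move=> Ff t t0 e e0; have t1 : -1 < t by rewrite (lt_le_trans _ t0)// ltrN10.
have /derivable1_diffP/differentiable_continuous/cvgrPdist_le/(_ e e0) :=
  @ex_derive _ _ _ _ _ _ _ (Ff t t1).
move=> /nbhs_ballP[r /= r0 rF]; exists r => // s _ st; rewrite distrC; apply: rF.
by rewrite -ball_normE /= distrC.
Qed.

Lemma continuous_max0 : continuous (fun s : R => Num.max 0 s).
Proof.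
apply: (@half_line_continuous_max id) => t t0 e e0.
by exists e => // s _ /ltW.
Qed.

Lemma Rintegral_half_line (F F' : R -> R) (T : R) :
  (forall s : R, T <= s -> F s = 0) -> (forall s : R, 0 <= s <= T -> F s = F' s) ->
  \int[leb]_(t in `[0, +oo[) F t = \int[leb]_(t in `[0, T]) F' t.
Proof.
move=> F0 FF'; rewrite Rintegral_mkcond [RHS]Rintegral_mkcond; congr Rintegral.
apply/funext => s; rewrite !patchE.
have [s0|s0] := leP 0 s; last first.
  by rewrite !memNset//= in_itv/= leNgt s0.
rewrite (@mem_set _ _ s) /=; last by rewrite in_itv/= s0.
have [sT|Ts] := leP s T.
  by rewrite mem_set /= ?in_itv/= ?s0// FF'// s0.
by rewrite F0 ?ltW// memNset//= in_itv/= s0 /= leNgt Ts.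
Qed.

(* Tested with [chi' s = max (T - s) 0 * (m s - m0 - \int_0^s g)], the weak
   equation forces [\int_0^T (T - s) (m s - m0 - \int_0^s g)^2 = 0]. *)
Lemma weak_equation_MVT (m g1 g2 : R -> R) (m0 : R) :
  half_line_continuous m -> half_line_continuous g1 -> half_line_continuous g2 ->
  (forall chi chi' : R -> R, (forall s : R, -1 < s -> is_derive s 1 chi (chi' s)) ->
     continuous chi' -> (exists2 T, 0 < T & forall s : R, T <= s -> chi s = 0) ->
     \int[leb]_(t in `[0, +oo[) (chi' t * m t + chi t * g1 t) + chi 0 * m0
       = - \int[leb]_(t in `[0, +oo[) (chi t * g2 t)) ->
  m 0 = m0 /\
  forall s t : R, 0 <= s -> s <= t ->
    exists2 c, s <= c <= t & m t - m s = (t - s) * (g1 c + g2 c).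
Proof.
move=> mc g1c g2c weak.
have maxE (s : R) : 0 <= s -> Num.max 0 s = s by move=> s0; apply/max_idPr.
pose m' (s : R) := m (Num.max 0 s); pose h1 (s : R) := g1 (Num.max 0 s); pose h2 (s : R) := g2 (Num.max 0 s).
have m'c : continuous m' := half_line_continuous_max mc.
have h1c : continuous h1 := half_line_continuous_max g1c.
have h2c : continuous h2 := half_line_continuous_max g2c.
have [|G0 G0E] := @antiderivative (h1 \+ h2).
  by move=> s; apply: cvgD; [exact: h1c|exact: h2c].
pose G (s : R) := G0 s - G0 0.
have GE (s : R) : -1 < s -> is_derive s 1 G (h1 s + h2 s).
  move=> s1; rewrite -[h1 s + h2 s]subr0; apply: is_deriveB; exact: G0E.
have Gc : half_line_continuous G := is_derive_half_line_continuous GE.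
have G00 : G 0 = 0 by rewrite /G subrr.
(* [N] is the defect of the integrated equation; everything reduces to its vanishing on the
   half-line. *)
pose N (s : R) := m' s - m0 - G (Num.max 0 s).
have Nc : continuous N.
  move=> s; apply: cvgB; last exact: (half_line_continuous_max Gc).
  by apply: cvgB; [exact: m'c|exact: cvg_cst].
have N0 (T s : R) : 0 < s -> s < T -> N s = 0.
  move=> s0 sT; have T0 : 0 < T := lt_trans s0 sT.
  pose psi (s : R) := Num.max 0 (T - s) * N s.
  have psic : continuous psi.
    move=> z; apply: cvgM; last exact: Nc.
    apply: (@cvg_comp _ _ _ (fun z : R => T - z) (Num.max 0) _ (nbhs (T - z))).
      by apply: cvgB; [exact: cvg_cst|exact: cvg_id].
    exact: continuous_max0.
  have [Psi PsiE] := antiderivative psic.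
  (* Normalised at T: as [psi] vanishes beyond T, so does [chi], which makes it an admissible test
     function. *)
  pose chi s := Psi s - Psi T.
  have chiE (z : R) : -1 < z -> is_derive z 1 chi (psi z).
    move=> z1; rewrite -[psi z]subr0; apply: is_deriveB; exact: PsiE.
  have chiT (z : R) : T <= z -> chi z = 0.
    move=> Tz; have [c /andP[Tc _] E] := is_derive_MVT (ltW T0) Tz PsiE.
    by rewrite /chi E /psi (_ : Num.max 0 (T - c) = 0) ?mul0r ?mulr0//; apply/max_idPl; rewrite subr_le0.
  have psiT (z : R) : T <= z -> psi z = 0.
    by move=> Tz; rewrite /psi (_ : Num.max 0 (T - z) = 0) ?mul0r//; apply/max_idPl; rewrite subr_le0.
  have [|V VE] := @antiderivative (psi \* N).
    by move=> z; apply: cvgM; [exact: psic|exact: Nc].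
  have zero1 : -1 < 0 :> R by exact: ltrN10.
  have chic : {within `[0, T], continuous chi} by exact: is_derive_within_continuous chiE.
  have Gc0T : {within `[0, T], continuous G} by exact: is_derive_within_continuous GE.
  have within (f : R -> R) : continuous f -> {within `[0, T], continuous f}.
    exact: continuous_subspaceT.
  have withinD (f g : R -> R) : {within `[0, T], continuous f} ->
      {within `[0, T], continuous g} -> {within `[0, T], continuous (fun z => f z + g z)}.
    by move=> fc gc z; apply: continuousD; [exact: fc|exact: gc].
  have withinM (f g : R -> R) : {within `[0, T], continuous f} ->
      {within `[0, T], continuous g} -> {within `[0, T], continuous (fun z => f z * g z)}.
    by move=> fc gc z; apply: continuousM; [exact: fc|exact: gc].
  (* On [0, T] this is the integrand psi m + chi (g1 + g2) of the weak equation, rewritten with m =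
     m0 + G + N. The first two terms form the derivative of chi (m0 + G), whose boundary values
     cancel the initial term; what remains is [V T = V 0]. *)
  pose k (z : R) := (psi z * (m0 + G z) + (h1 z + h2 z) * chi z) + psi z * N z.
  have kc : {within `[0, T], continuous k}.
    have psiw := within _ psic; have Nw := within _ Nc.
    have h1w := within _ h1c; have h2w := within _ h2c.
    have m0w := within _ (@cst_continuous _ _ m0).
    exact: (withinD _ _ (withinD _ _ (withinM _ _ psiw (withinD _ _ m0w Gc0T))
      (withinM _ _ (withinD _ _ h1w h2w) chic)) (withinM _ _ psiw Nw)).
  have UE (z : R) : -1 < z -> is_derive z 1 (fun z => chi z * (m0 + G z) + V z) (k z).
    move=> z1; apply: is_deriveD; last exact: VE.
    have chid := chiE z z1; have Gd := GE z z1.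
    have Gd1 : is_derive z 1 (fun z => m0 + G z) (h1 z + h2 z).
      by rewrite -[h1 z + h2 z]add0r; exact: is_deriveD.
    have := @is_deriveM _ _ chi (fun z => m0 + G z) z 1 _ _ chid Gd1.
    congr is_derive; rewrite addrC; congr (_ + _); exact: mulrC.
  have VT0 : V T = V 0.
    have := weak _ _ chiE psic (ex_intro2 _ _ T T0 chiT).
    rewrite (@Rintegral_half_line _ (fun z => psi z * m' z + chi z * h1 z) T); last 2 first.
    - by move=> z Tz; rewrite psiT// chiT// !mul0r addr0.
    - by move=> z /andP[z0 _]; rewrite /m' /h1 maxE.
    rewrite (@Rintegral_half_line _ (fun z => chi z * h2 z) T); last 2 first.
    - by move=> z Tz; rewrite chiT// !mul0r.
    - by move=> z /andP[z0 _]; rewrite /h2 maxE.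
    move/eqP; rewrite -subr_eq0 opprK addrAC -RintegralD//=; last 2 first.
    - apply: continuous_compact_integrable; first exact: segment_compact.
      exact: (withinD _ _ (withinM _ _ (within _ psic) (within _ m'c))
        (withinM _ _ chic (within _ h1c))).
    - apply: continuous_compact_integrable; first exact: segment_compact.
      exact: (withinM _ _ chic (within _ h2c)).
    rewrite (_ : Rintegral _ _ _ = \int[leb]_(z in `[0, T]) k z); last first.
      apply: eq_Rintegral => z /[!inE]/=; rewrite in_itv/= => /andP[z0 _].
      by rewrite /k /N maxE//; ring.
    rewrite (Rintegral_FTC2 T0 UE kc) chiT// G00 => /eqP; lra.
  have Vmono (a b : R) : 0 <= a -> a <= b -> V a <= V b.
    move=> a0 ab; have [c _ E] := is_derive_MVT a0 ab VE.
    rewrite -subr_ge0 E mulr_ge0 ?subr_ge0// /psi /= -mulrA mulr_ge0 ?le_max ?lexx//.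
    by rewrite -expr2 sqr_ge0.
  have Vcst (a : R) : 0 <= a <= T -> V a = V 0.
    by move=> /andP[a0 aT]; apply: le_anti; rewrite -{1}VT0 !Vmono.
  have sT01 : s \in `]0, T[ by rewrite in_itv/= s0.
  (* [V] is nondecreasing with equal end values, hence constant, so every interior point is a
     maximum and V' = (T - s) N^2 vanishes there. *)
  have [||_] := @derive1_at_max _ V 0 T s (ltW T0) _ sT01.
  - move=> z /[!in_itv]/= /andP[z0 _]; apply: ex_derive; apply: VE; exact: lt_trans z0.
  - by move=> z /[!in_itv]/= /andP[/ltW z0 /ltW zT]; rewrite (Vcst s) ?(Vcst z) ?z0 ?zT ?(ltW s0) ?(ltW sT).
  have /@derive_val -> := VE s (lt_trans zero1 s0).
  move=> /eqP; rewrite /= /psi -mulrA -expr2 mulf_eq0 sqrf_eq0 => /orP[|/eqP//].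
  by rewrite (_ : Num.max 0 _ = T - s) ?subr_eq0 ?(gt_eqF sT)//; apply/max_idPr; rewrite subr_ge0 ltW.
have N00 : N 0 = 0.
  apply/eqP; rewrite -normr_le0; apply/ler_addgt0Pl => e e0; rewrite addr0.
  have /cvgrPdist_le/(_ e e0)/nbhs_ballP[r /= r0 rN] := Nc 0.
  have r20 : 0 < r / 2 by rewrite divr_gt0.
  have Nr : N (r / 2) = 0 by apply: (N0 (r / 2 + 1)); rewrite ?ltrDl.
  have rr : `|0 - r / 2| < r.
    by rewrite sub0r normrN gtr0_norm// ltr_pdivrMr// ltr_pMr// ltr1n.
  by have := rN (r / 2) rr; rewrite /= Nr subr0.
have mE (s : R) : 0 <= s -> m s = m0 + G s.
  move=> s0; have : N s = 0.
    by move: s0; rewrite le_eqVlt => /predU1P[<-//|s0]; apply: (N0 (s + 1)); rewrite ?ltrDl.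
  by rewrite /N /m' maxE// => /eqP; rewrite -addrA -opprD subr_eq0 => /eqP.
split=> [|s t s0 st]; first by rewrite mE// G00 addr0.
have [c /andP[sc ct] E] := is_derive_MVT s0 st GE.
exists c; first by rewrite sc.
by rewrite !mE// ?(le_trans s0 st)// opprD addrACA subrr add0r E /h1 /h2 maxE// (le_trans s0).
Qed.

End RealAnalysis.

(** * A dual Gronwall lemma and integrals of continuous functions *)

(* The factor [1 + C tau] allowed per step keeps the class of admissible
   functionals under control; the exponential absorbs it. *)
Lemma dual_gronwall (R : realType) (F : Type) (adm : R -> F -> Prop)
    (L : R -> F -> R) (C a A T : R) :
  0 <= C -> 0 <= a -> 0 <= A ->
  (forall K f, adm K f -> 0 <= K) ->
  (forall K f, adm K f -> half_line_continuous (fun s => L s f)) ->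
  (forall K f, adm K f -> `|L 0 f| <= K * a) ->
  (forall t : R, 0 <= t <= T -> exists2 r : R, 0 < r & forall tau, 0 < tau < r ->
     t + tau <= T -> forall K f, adm K f ->
     exists2 g, adm (K * (1 + C * tau)) g &
       `|L (t + tau) f| <= `|L t g| + tau * A * K) ->
  forall t, 0 <= t <= T -> forall K f, adm K f ->
    `|L t f| <= K * ((a + A * t) * expR (C * t)).
Proof.
move=> C0 a0 A0 admK Lc L0 step.
suff H t : 0 <= t -> t <= T -> forall K f, adm K f ->
    `|L t f| <= K * ((a + A * t) * expR (C * t)).
  by move=> t /andP[t0 tT]; exact: H.
move: t; apply: continuous_induction => [T0 K f Kf|t t0 IH|t t0 IH tT K f Kf].
- by rewrite !mulr0 expR0 addr0 mulr1; exact: L0.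
- have [tT|Tt] := leP t T; last first.
    (* Beyond T the claim is vacuous, so any step length will do. *)
    exists 1 => // s /andP[s0 _] tsT; exfalso.
    by move: tsT; rewrite leNgt (lt_trans Tt)// ltrDl.
  have [|r r0 rstep] := step t; first by rewrite t0.
  exists r => // tau tau0r tT' K f Kf.
  have tau0 : 0 <= tau by case/andP: tau0r => /ltW.
  have [g gK Lg] := rstep tau tau0r tT' K f Kf.
  have K0 := admK _ _ Kf.
  apply: (le_trans Lg).
  have /IH/(_ tT _ _ gK) Lt : 0 <= t <= t by rewrite t0 lexx.
  apply: (le_trans (lerD Lt (lexx _))).
  rewrite [C * (t + tau)]mulrDr expRD [C * tau]mulrC.
  set e1 := expR (C * t); set e2 := expR (tau * C).
  have e1p : 1 <= e1 by rewrite -expR0 ler_expR mulr_ge0.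
  have e2p : 1 + tau * C <= e2 by exact: expR_ge1Dx.
  have tC : 0 <= tau * C by rewrite mulr_ge0.
  have e21 : 1 <= e2 by apply: le_trans e2p; rewrite lerDl.
  (* The enlarged radius K (1 + C tau) is absorbed by 1 + C tau <= exp(C tau), and the new error tau
     A K by A (t + tau), both exponentials being at least 1. *)
  rewrite (_ : K * _ * _ + _ = K * ((a + A * t) * e1 * (1 + tau * C) + A * tau)); last by ring.
  rewrite ler_wpM2l//.
  rewrite [leRHS](_ : _ = (a + A * t) * e1 * e2 + A * tau * (e1 * e2)); last by ring.
  rewrite lerD//.
    by rewrite ler_wpM2l// !mulr_ge0 ?addr_ge0 ?mulr_ge0// (le_trans ler01).
  by rewrite ler_peMr ?mulr_ge0// -[leLHS]mulr1 ler_pM.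
- have K0 := admK _ _ Kf.
  apply/ler_addgt0Pr => e e0.
  have [r r0 rc] := Lc K f Kf t (ltW t0) e e0.
  (* Closure on the left: with f fixed, continuity in time carries the bound from s < t to t up to
     e. *)
  pose s := Num.max 0 (t - r / 2).
  have s0 : 0 <= s by rewrite le_max lexx.
  have st : s < t by rewrite gt_max t0 ltrBlDr ltrDl divr_gt0.
  have str : `|s - t| < r.
    rewrite distrC gtr0_norm ?subr_gt0// ltrBlDl -ltrBlDr lt_max; apply/orP; right.
    by rewrite ltrD2l ltrN2 ltr_pdivrMr// ltr_pMr// ltr1n.
  have /IH/(_ (le_trans (ltW st) tT) K f Kf) H1 : 0 <= s < t by rewrite s0.
  have H3 : `|L t f| <= `|L s f| + e.
    by rewrite -(subrK (L s f) (L t f)) (le_trans (ler_normD _ _))// addrC lerD2l// distrC rc.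
  apply: (le_trans H3); rewrite lerD2r (le_trans H1)// ler_wpM2l//.
  apply: ler_pM => //; first by rewrite addr_ge0// mulr_ge0.
  - by rewrite lerD2l ler_wpM2l// ltW.
  - by rewrite ler_expR ler_wpM2l// ltW.
Qed.

(** * Integration of bounded continuous functions against finite measures *)

Section IntegralsOfContinuousFunctions.
Variables (R : realType) (d : nat).
Implicit Types (mu nu : {finite_measure set (borel R d) -> \bar R}).
Implicit Types (f g : 'rV[R]_d -> R).

Lemma continuous_borel_measurable f : continuous f ->
  measurable_fun [set: borel R d] (f : borel R d -> R).
Proof.
move=> cf; apply: (measurability _ (RGenOpens.measurableE R)).
move=> _ [_ [a [b ->] <-]]; rewrite setTI; apply: sub_sigma_algebra.
by move/continuousP : cf; apply; exact: interval_open.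
Qed.

Lemma bounded_continuous_integrable mu f (K : R) : continuous f ->
  (forall x, `|f x| <= K) -> mu.-integrable [set: borel R d] (EFin \o f).
Proof.
move=> cf fK; apply: measurable_bounded_integrable => //.
- exact: fin_num_fun_lty.
- exact: continuous_borel_measurable.
- exists K; split; rewrite ?num_real// => M KM x _.
  by apply: le_trans (fK x) (ltW KM).
Qed.

Lemma continuous_scale (c : R) f : continuous f -> continuous (fun x => c * f x).
Proof.
move=> fc x.
exact: (@continuousM R 'rV[R]_d (cst c) f x (@cst_continuous _ _ c x) (fc x)).
Qed.

Definition mass mu : R := \int[mu]_x (1 : R).

Lemma mass_ge0 mu : 0 <= mass mu.
Proof. exact: Rintegral_ge0. Qed.

Lemma Rint_norm_le mu f (K : R) : continuous f -> (forall x, `|f x| <= K) ->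
  `|\int[mu]_x f x| <= K * mass mu.
Proof.
move=> cf fK; have fi := bounded_continuous_integrable mu cf fK.
have ci (c : R) : mu.-integrable [set: borel R d] (EFin \o cst c).
  by apply: (@bounded_continuous_integrable _ _ `|c|) => //; exact: cst_continuous.
apply: (le_trans (le_normr_Rintegral measurableT fi)).
rewrite /mass -RintegralZl//; last exact: ci.
apply: le_Rintegral => //; last by move=> x _; rewrite mulr1.
  by move/integrable_norm : fi.
by apply: eq_integrable (ci K) => // x _ /=; rewrite mulr1.
Qed.

Lemma RintB mu f g (K M : R) : continuous f -> continuous g ->
  (forall x, `|f x| <= K) -> (forall x, `|g x| <= M) ->
  \int[mu]_x (f x - g x) = \int[mu]_x f x - \int[mu]_x g x.
Proof.
move=> cf cg fK gM.
by rewrite RintegralB//; exact: bounded_continuous_integrable.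
Qed.

Lemma RintD mu f g (K M : R) : continuous f -> continuous g ->
  (forall x, `|f x| <= K) -> (forall x, `|g x| <= M) ->
  \int[mu]_x (f x + g x) = \int[mu]_x f x + \int[mu]_x g x.
Proof.
move=> cf cg fK gM.
by rewrite RintegralD//; exact: bounded_continuous_integrable.
Qed.

Lemma RintZ mu f (c K : R) : continuous f -> (forall x, `|f x| <= K) ->
  \int[mu]_x (c * f x) = c * \int[mu]_x f x.
Proof.
by move=> cf fK; rewrite RintegralZl//; exact: bounded_continuous_integrable.
Qed.

Lemma Rint_dist_le mu f g (K M e : R) : continuous f -> continuous g ->
  (forall x, `|f x| <= K) -> (forall x, `|g x| <= M) ->
  (forall x, `|f x - g x| <= e) ->
  `|\int[mu]_x f x - \int[mu]_x g x| <= e * mass mu.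
Proof.
move=> cf cg fK gM fg; rewrite -(RintB _ cf cg fK gM).
apply: (@Rint_norm_le mu (fun x : 'rV[R]_d => f x - g x)) => // x.
exact: (continuousB (cf x) (cg x)).
Qed.

Lemma Rint_dominated mu (f_ : nat -> 'rV[R]_d -> R) f (K : R) :
  (forall n, continuous (f_ n)) -> continuous f ->
  (forall n x, `|f_ n x| <= K) -> (forall x, f_ n x @[n --> \oo] --> f x) ->
  \int[mu]_x f_ n x @[n --> \oo] --> \int[mu]_x f x.
Proof.
move=> cf_ cf fK ff.
have fK' x : `|f x| <= K.
  have : `|f_ n x| @[n --> \oo] --> `|f x| by exact: cvg_norm.
  by move=> fx; rewrite -(cvg_lim _ fx)//; apply: limr_le;
    [apply/cvg_ex; eexists; exact: fx|apply: nearW => n; exact: fK].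
have fin g : continuous g -> (forall x, `|g x| <= K) ->
    (\int[mu]_x (g x)%:E)%E \is a fin_num.
  move=> cg gK; apply: integrable_fin_num => //; exact: bounded_continuous_integrable gK.
apply: fine_cvg; rewrite fineK; last exact: fin.
have [||||| _ _ +] := @dominated_convergence _ (borel R d) R mu setT measurableT
  (fun n x => (f_ n x)%:E) (fun x => (f x)%:E) (cst K%:E).
- by move=> n; apply/measurable_EFinP; exact: continuous_borel_measurable.
- by apply/measurable_EFinP; exact: continuous_borel_measurable.
- by apply: aeW => x _; apply: cvg_EFin; [exact: nearW|exact: ff].
- apply: (@bounded_continuous_integrable _ (cst K) `|K|) => //.
  exact: cst_continuous.
- by apply: aeW => x n _; rewrite /= lee_fin.
by [].
Qed.

End IntegralsOfContinuousFunctions.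

(** * Weak solutions *)

Section TestFunctions.
Variables (R : realType) (d : nat) (alpha : R).
Hypothesis a01 : 0 < alpha <= 1.
Implicit Types (f w : 'rV[R]_d -> R) (x : 'rV[R]_d).

(** Properness makes limits along this filter unique, so that a convergent quotient determines the
    value of [dt]. *)
Lemma half_line_quotient_proper (t : R) : 0 <= t ->
  ProperFilter (within [set s | 0 <= t + s] (0 : R)^').
Proof.
move=> t0; apply: Build_ProperFilter_ex => P.
move=> /nbhs_ballP[e /= e0 eP].
have e2 : 0 < e / 2 by rewrite divr_gt0.
have ee : `|0 - e / 2| < e by rewrite sub0r normrN gtr0_norm// ltr_pdivrMr// ltr_pMr// ltr1n.
exists (e / 2); apply: (eP _ ee); first by rewrite gt_eqF.
by rewrite /= addr_ge0// ltW.
Qed.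

Section ProductTestFunction.
Variables (chi chi' : R -> R) (f : 'rV[R]_d -> R) (K T r : R).
Hypothesis chid : forall s : R, -1 < s -> is_derive s 1 chi (chi' s).
Hypothesis chi'c : continuous chi'.
Hypothesis chiT : forall s : R, T <= s -> chi s = 0.
Hypotheses (fK : C1bd alpha K f) (fr : csupp r f).

Let phi (s : R) (x : 'rV[R]_d) : R := chi s * f x.

Lemma prod_dt_cvg t x : 0 <= t -> dt_quotient phi t x --> chi' t * f x.
Proof.
move=> t0; apply: cvg_within_filter.
have td : is_derive t 1 chi (chi' t) by apply: chid; rewrite (lt_le_trans _ t0)// ltrN10.
have cd : (s^-1 *: ((chi \o shift t) (s *: (1 : R^o)) - chi t)) @[s --> (0 : R)^'] --> chi' t.
  rewrite -(@derive_val _ _ _ _ _ _ _ td); exact: (@ex_derive _ _ _ _ _ _ _ td).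
have -> : (fun s => s^-1 * (phi (t + s) x - phi t x)) =
    (fun s => (s^-1 *: ((chi \o shift t) (s *: (1 : R^o)) - chi t)) * f x).
  apply/funext => s; rewrite /phi /shift /= [s%:A]mulr1 -mulrBl mulrA.
  by rewrite [s + t]addrC.
exact: (cvgM cd (cvg_cst (f x))).
Qed.

Lemma prod_dt t x : 0 <= t -> dt phi t x = chi' t * f x.
Proof.
move=> t0; have := half_line_quotient_proper t0 => PF.
by apply: cvg_lim => //; exact: prod_dt_cvg.
Qed.

Lemma prod_grad t x : grad (phi t) x = chi t *: grad f x.
Proof.
apply/rowP => i; rewrite !mxE.
have := @is_deriveZ _ _ R^o f (chi t) x _ _ (C1bd_is_derive x i fK).
by move=> /@derive_val.
Qed.

Lemma spacetime_continuous (W : topologicalType) (g : R * 'rV[R]_d -> W) :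
  (forall z, 0 <= z.1 -> {for z, continuous g}) -> {within @spacetime R d, continuous g}.
Proof.
by move=> gc; apply: continuous_in_subspaceT => z /set_mem z0; exact: gc.
Qed.

Lemma grad_continuous : continuous (grad f : 'rV[R]_d -> 'rV[R]_d).
Proof.
have K0 := C1bd_ge0 fK; have [_ _ _ f2] := fK.
apply: (hoelder_continuous a01 (K := K)) => x y.
by apply: rV_norm_le => [|i]; rewrite ?mulr_ge0 ?powR_ge0// !mxE.
Qed.

Lemma prod_C1c_spacetime : C1c_spacetime phi.
Proof.
have chic z : -1 < z -> {for z, continuous chi}.
  move=> z1; apply: differentiable_continuous; apply/derivable1_diffP.
  exact: (@ex_derive _ _ _ _ _ _ _ (chid z1)).
have z1 (z : R) : 0 <= z -> -1 < z by move=> z0; rewrite (lt_le_trans _ z0)// ltrN10.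
have c1 (g : R -> R) (z : R * 'rV[R]_d) : {for z.1, continuous g} ->
    {for z, continuous (fun z : R * 'rV[R]_d => g z.1)}.
  by move=> gc; exact: (@continuous_comp _ _ _ fst g z cvg_fst gc).
have c2 (W : topologicalType) (g : 'rV[R]_d -> W) (z : R * 'rV[R]_d) :
    {for z.2, continuous g} ->
    {for z, continuous (fun z : R * 'rV[R]_d => g z.2)}.
  by move=> gc; exact: (@continuous_comp _ _ _ snd g z cvg_snd gc).
have fc := C1bd_continuous a01 fK.
split.
- move=> t x t0; split; first by apply/cvg_ex; eexists; exact: prod_dt_cvg.
  by move=> i; exact: (@ex_derive _ _ _ _ _ _ _
    (@is_deriveZ _ _ R^o f (chi t) x _ _ (C1bd_is_derive x i fK))).
- apply: spacetime_continuous => z z0.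
  by apply: continuousM; [apply: c1; apply: chic; exact: z1|apply: c2; exact: fc].
- apply: (@subspace_eq_continuous _ _ _ (fun z => chi' z.1 * f z.2)).
    by move=> z /set_mem z0; apply: esym; exact: prod_dt.
  apply: spacetime_continuous => z z0.
  by apply: continuousM; [apply: c1; exact: chi'c|apply: c2; exact: fc].
- rewrite (_ : (fun z => _) = (fun z => chi z.1 *: grad f z.2)); last first.
    by apply/funext => z; rewrite prod_grad.
  apply: spacetime_continuous => z z0.
  by apply: continuousZ; [apply: c1; apply: chic; exact: z1|apply: c2; exact: grad_continuous].
- pose B : set 'rV[R]_d := [set v | forall i, v 0 i \in `[- r, r]].
  have Bc : compact B.
    by apply: (@rV_compact _ _ (fun=> `[- r, r]%classic)) => _; exact: segment_compact.
  have Kc : compact (`[0, T]%classic `*` B).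
    by apply: compact_setX => //; exact: segment_compact.
  apply: (subclosed_compact _ Kc); first exact: closed_closure.
  rewrite [X in _ `<=` X](closure_id _).1; last first.
    by apply: compact_closed => //; exact: norm_hausdorff.
  apply: closureS => -[s x] [/= s0 sx]; split; rewrite /= ?in_itv/=.
    rewrite s0 /=; case: (leP s T) => // /ltW Ts; move: sx; rewrite /phi chiT// mul0r.
    by rewrite eqxx.
  move=> i; rewrite in_itv /= -ler_norml (le_trans (rV_norm_ge x i))//.
  case: (leP `|x| r) => // rx; move: sx; rewrite /phi fr// mulr0.
  by rewrite eqxx.
Qed.

End ProductTestFunction.

End TestFunctions.

(** Continuity into the sup norm, weaker than continuity into C^{1+alpha}. It suffices for comparing
    generators at nearby times, since the derivatives fall on the test function. *)
Definition time_continuous (R : realType) (d : nat) (V : normedModType R)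
    (g : R -> 'rV[R]_d -> V) : Prop :=
  forall t, 0 <= t -> forall e, 0 < e -> exists2 r, 0 < r &
    forall s, 0 <= s -> `|s - t| < r -> forall x, `|g s x - g t x| <= e.

Definition generator (R : realType) (d : nat) (b : 'rV[R]_d -> 'rV[R]_d)
    (w f : 'rV[R]_d -> R) (x : 'rV[R]_d) : R :=
  dotv (grad f x) (b x) + w x * f x.

(** * Bounds for the dual generator *)

Section Generator.
Variables (R : realType) (d : nat) (alpha : R).
Hypothesis a01 : 0 < alpha <= 1.
Implicit Types (f w : 'rV[R]_d -> R) (b : 'rV[R]_d -> 'rV[R]_d) (x y : 'rV[R]_d).

Let D : R := d%:R.
Let D0 : 0 <= D. Proof. exact: ler0n. Qed.

Lemma dotv_grad_continuous (K M : R) b f : C1bd alpha K f -> fbd alpha M b ->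
  continuous (fun x => dotv (grad f x) (b x) : R).
Proof.
move=> fK bM; have [_ _ f1 f2] := fK.
apply: (hoelder_continuous a01 (K := D * (M * K + K * ((D + 2) * M)))) => x y.
rewrite /dotv -sumrB -mulrA; apply: normr_sum_le_dK => i; rewrite !mxE mulrDl.
have [_ b0 _ _] := bM i.
rewrite -!mulrA mulrA [(D + 2) * _]mulrA.
rewrite -[M * K * _]mulrA.
exact: normrMB_le (b0 x) (f1 y i) (C1bd_hoelder a01 x y (bM i)) (f2 x y i).
Qed.

Lemma mul_continuous (K M : R) w f : C1bd alpha K f -> C1bd alpha M w ->
  continuous (fun x => w x * f x : R).
Proof.
by move=> fK wM; exact: (C1bd_continuous a01 (C1bdM a01 wM fK)).
Qed.

Lemma generator_continuous (K M : R) b w f : C1bd alpha K f -> fbd alpha M b ->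
  C1bd alpha M w -> continuous (generator b w f).
Proof.
move=> fK bM wM x.
rewrite /generator.
apply: (@continuousD R R^o 'rV[R]_d (fun x => dotv (grad f x) (b x)) (fun x => w x * f x) x).
  exact: (dotv_grad_continuous fK bM).
exact: (mul_continuous fK wM).
Qed.

Lemma mul_norm_le (K M : R) w f : C1bd alpha K f -> C1bd alpha M w ->
  forall x, `|w x * f x| <= M * K.
Proof. by move=> [_ f0 _ _] [_ w0 _ _] x; rewrite normrM ler_pM. Qed.

Lemma dotv_field_le (K M : R) b f : 0 <= M -> C1bd alpha K f -> fbd alpha M b ->
  forall x, `|dotv (grad f x) (b x)| <= D * K * M.
Proof.
move=> M0 fK bM x; have K0 := C1bd_ge0 fK.
apply: (le_trans (dotv_grad_le x (b x) fK)).
by rewrite ler_wpM2l ?mulr_ge0// (fbd_norm_le x M0 bM).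
Qed.

Lemma generator_norm_le (K M : R) b w f : C1bd alpha K f -> fbd alpha M b ->
  C1bd alpha M w -> forall x, `|generator b w f x| <= (D + 1) * M * K.
Proof.
move=> fK bM wM x; have M0 := C1bd_ge0 wM; apply: (le_trans (ler_normD _ _)).
rewrite (_ : _ * M * K = D * K * M + M * K); last by ring.
by rewrite lerD ?(mul_norm_le fK wM) ?(dotv_field_le M0 fK bM).
Qed.

Lemma dotvB (c u v : 'rV[R]_d) : dotv c (u - v) = dotv c u - dotv c v.
Proof.
by rewrite /dotv -sumrB; apply: eq_bigr => i _; rewrite !mxE mulrBl.
Qed.

Lemma generator_dist_le (K e : R) b b' w w' f x : C1bd alpha K f ->
  `|b x - b' x| <= e -> `|w x - w' x| <= e ->
  `|generator b w f x - generator b' w' f x| <= (D + 1) * e * K.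
Proof.
move=> fK be we; have K0 := C1bd_ge0 fK; have [_ f0 _ _] := fK.
rewrite (_ : _ - _ = dotv (grad f x) (b x - b' x) + (w x - w' x) * f x); last first.
  by rewrite dotvB /generator; ring.
rewrite (le_trans (ler_normD _ _))//.
rewrite (_ : _ * e * K = D * K * e + e * K); last by ring.
rewrite lerD//; last by rewrite normrM ler_pM.
by rewrite (le_trans (dotv_grad_le _ _ fK))// ler_wpM2l ?mulr_ge0.
Qed.

End Generator.

(** * Evolution of integrals along a weak solution *)

Section WeakSolution.
Variables (R : realType) (d : nat) (alpha : R).
Hypothesis a01 : 0 < alpha <= 1.
Variables (b : R -> 'rV[R]_d -> 'rV[R]_d) (w : R -> 'rV[R]_d -> R).
Hypotheses (bc : time_continuous b) (wc : time_continuous w).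
Hypothesis bwM : forall T : R, exists2 M : R, 1 <= M &
  forall s, 0 <= s <= T -> fbd alpha M (b s) /\ C1bd alpha M (w s).
Variables (mu0 : probability (borel R d) R)
  (mu : R -> {finite_measure set (borel R d) -> \bar R}).
Hypothesis weak : weak_solution b w mu0 mu.
Implicit Types (f : 'rV[R]_d -> R) (K : R).

Let D : R := d%:R.
Let D0 : 0 <= D. Proof. exact: ler0n. Qed.
Notation leb := (@lebesgue_measure R).

Lemma narrow f K : continuous f -> (forall x, `|f x| <= K) ->
  half_line_continuous (fun t => \int[mu t]_x f x).
Proof.
move=> fc fK; apply: within_half_line_continuous; apply: weak.1 => //.
by exists K; split; rewrite ?num_real// => M KM x _; exact: le_trans (fK x) (ltW KM).
Qed.

Lemma mass_near t : 0 <= t -> exists2 r, 0 < r &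
  forall s, 0 <= s -> `|s - t| < r -> mass (mu s) <= mass (mu t) + 1.
Proof.
move=> t0; have [||r r0 rm] := @narrow (cst 1) 1 _ _ t t0 1 ltr01.
- exact: cst_continuous.
- by move=> x; rewrite normr1.
by exists r => // s s0 st; have := rm s s0 st; rewrite ler_distl => /andP[].
Qed.

(** The integrand is changed first, at the cost of its uniform distance times the local mass bound;
    then the measure is changed under a fixed integrand, by narrow continuity. *)
Lemma moving_integral (G : R -> 'rV[R]_d -> R) :
  (forall t, 0 <= t -> continuous (G t) /\ exists K, forall x, `|G t x| <= K) ->
  time_continuous G -> half_line_continuous (fun t => \int[mu t]_x G t x).
Proof.
move=> Gc Gt t t0 e e0.
have m0 : 0 < mass (mu t) + 1 by rewrite ltr_wpDl ?mass_ge0.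
have e20 : 0 < e / 2 by rewrite divr_gt0.
have [r1 r10 r1P] := mass_near t0.
have [r2 r20 r2P] := Gt t t0 _ (divr_gt0 e20 m0).
have [Gct [K GK]] := Gc t t0.
have [r3 r30 r3P] := narrow Gct GK t0 e20.
exists (Num.min r1 (Num.min r2 r3)); first by rewrite !lt_min r10 r20.
move=> s s0; rewrite !lt_min => /and3P[s1 s2 s3].
have [Gcs [K' GK']] := Gc s s0.
rewrite -(subrKA (\int[mu s]_x G t x)) (le_trans (ler_normD _ _))// [e]splitr lerD//.
  apply: (le_trans (Rint_dist_le (mu s) Gcs Gct GK' GK (r2P s s0 s2))).
  apply: (@le_trans _ _ (e / 2 / (mass (mu t) + 1) * (mass (mu t) + 1))).
    by rewrite ler_wpM2l ?r1P// ltW// divr_gt0.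
  by rewrite divfK// gt_eqF.
exact: r3P.
Qed.

(** Testing with chi(t) f(x) reduces the problem to the scalar equation of [weak_equation_MVT],
    transport and growth supplying the two continuous source terms. The initial condition at time 0
    is part of the conclusion, because the weak formulation mentions [mu0] only through its integral
    term. *)
Lemma weak_MVT f K r : C1bd alpha K f -> csupp r f ->
  \int[mu 0]_x f x = \int[mu0]_x f x /\
  forall s t, 0 <= s -> s <= t -> exists2 c, s <= c <= t &
    \int[mu t]_x f x - \int[mu s]_x f x
      = (t - s) * \int[mu c]_x generator (b c) (w c) f x.
Proof.
move=> fK fr; have K0 := C1bd_ge0 fK; have [_ f0 _ _] := fK.
have fc := C1bd_continuous a01 fK.
have bw t : 0 <= t -> exists2 M : R, 1 <= M & fbd alpha M (b t) /\ C1bd alpha M (w t).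
  by move=> t0; have [M M1 MP] := bwM t; exists M => //; apply: MP; rewrite t0 lexx.
pose g1 t := \int[mu t]_x dotv (grad f x) (b t x).
pose g2 t := \int[mu t]_x (w t x * f x).
have g1c : half_line_continuous g1.
  apply: (@moving_integral (fun t x => dotv (grad f x) (b t x))) => [t t0|t t0 e e0].
    have [M M1 [bM wM]] := bw t t0; split; first exact: (dotv_grad_continuous a01 fK bM).
    by eexists; exact: (dotv_field_le (le_trans ler01 M1) fK bM).
  have DK1 : 0 < D * K + 1 by rewrite ltr_wpDl ?mulr_ge0.
  have [r' r0 rP] := bc t0 (divr_gt0 e0 DK1).
  exists r' => // s s0 st x; rewrite -dotvB (le_trans (dotv_grad_le _ _ fK))//.
  apply: (@le_trans _ _ ((D * K + 1) * (e / (D * K + 1)))).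
    by rewrite ler_pM ?mulr_ge0// ?lerDl// rP.
  by rewrite mulrCA divff ?mulr1// gt_eqF.
have g2c : half_line_continuous g2.
  apply: (@moving_integral (fun t x => w t x * f x)) => [t t0|t t0 e e0].
    have [M M1 [bM wM]] := bw t t0; split; first exact: (mul_continuous a01 fK wM).
    by eexists; exact: (mul_norm_le fK wM).
  have K1 : 0 < K + 1 by rewrite ltr_wpDl.
  have [r' r0 rP] := wc t0 (divr_gt0 e0 K1).
  exists r' => // s s0 st x; rewrite -mulrBl normrM.
  apply: (@le_trans _ _ (e / (K + 1) * (K + 1))).
    by rewrite ler_pM// ?rP// (le_trans (f0 x))// lerDl.
  by rewrite divfK// gt_eqF.
have mc : half_line_continuous (fun t => \int[mu t]_x f x) by exact: narrow fc f0.
have [|m00 mE] := weak_equation_MVT (m0 := \int[mu0]_x f x) mc g1c g2c.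
  move=> chi chi' chid chi'c [T T0 chiT].
  have := weak.2 _ (prod_C1c_spacetime a01 chid chi'c chiT fK fr).
  rewrite [X in X + _ = _ -> _](_ : _ = \int[leb]_(t in `[0, +oo[)
      (chi' t * \int[mu t]_x f x + chi t * g1 t)); last first.
    apply: eq_Rintegral => t /[!inE]/=; rewrite in_itv/= andbT => t0.
    have [M M1 [bM wM]] := bw t t0.
    have dc := dotv_grad_continuous a01 fK bM.
    have d0 := dotv_field_le (le_trans ler01 M1) fK bM.
    rewrite /g1 -(RintZ (mu t) (chi' t) fc f0) -(RintZ (mu t) (chi t) dc d0).
    have fZ := C1bdZ (chi' t) fK; have [_ fZ0 _ _] := fZ.
    have dcZ := continuous_scale (c := chi t) dc.
    have dZ0 x : `|chi t * dotv (grad f x) (b t x)| <= `|chi t| * (d%:R * K * M).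
      by rewrite normrM ler_wpM2l.
    rewrite -(RintD (mu t) (C1bd_continuous a01 fZ) dcZ fZ0 dZ0).
    apply: eq_Rintegral => x _; rewrite (prod_dt f chid)//; congr (_ + _).
    rewrite /dotv mulr_sumr; apply: eq_bigr => i _.
    by rewrite (prod_grad chi fK) mxE mulrCA.
  rewrite [X in _ + X = _ -> _](_ : _ = chi 0 * \int[mu0]_x f x); last exact: RintZ fc f0.
  rewrite [X in _ = - X -> _](_ : _ = \int[leb]_(t in `[0, +oo[) (chi t * g2 t)); last first.
    apply: eq_Rintegral => t /[!inE]/=; rewrite in_itv/= andbT => t0.
    have [M M1 [bM wM]] := bw t t0.
    rewrite /g2 -(RintZ (mu t) (chi t) (mul_continuous a01 fK wM) (mul_norm_le fK wM)).
    by apply: eq_Rintegral => x _; rewrite mulrCA.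
  by [].
split=> // s t s0 st; have [c sct ->] := mE s t s0 st; exists c => //; congr (_ * _).
have c0 : 0 <= c by case/andP: sct => + _; exact: le_trans.
have [M M1 [bM wM]] := bw c c0.
rewrite /g1 /g2 -(RintD _ (dotv_grad_continuous a01 fK bM) (mul_continuous a01 fK wM)
  (dotv_field_le (le_trans ler01 M1) fK bM) (mul_norm_le fK wM)).
by [].
Qed.

Lemma euler_C1bd_continuous K M tau t f : 1 <= M -> 0 <= tau <= 1 ->
  fbd alpha M (b t) -> C1bd alpha M (w t) -> C1bd alpha K f ->
  exists K', C1bd alpha K' (euler tau (b t) (w t) f).
Proof.
move=> M1 t01 bM wM fK; have [C _ CP] := euler_C1bd d a01 M1.
by eexists; exact: CP t01 bM wM fK.
Qed.

(* The difference quotient [Q = (euler eta f - f) / eta] is a C^{1+alpha}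
   substitute for the merely C^alpha function [generator f]: against it the
   motion of [mu] is Lipschitz in time. *)
Lemma euler_one_step t e : 0 <= t -> 0 < e -> exists2 r0, 0 < r0 &
  forall tau, 0 < tau < r0 -> forall K r f, C1bd alpha K f -> csupp r f ->
    `|\int[mu (t + tau)]_x f x - \int[mu t]_x euler tau (b t) (w t) f x|
      <= e * tau * K.
Proof.
move=> t0 e0.
have [M M1 bw] := bwM (t + 1).
have M0 : 0 <= M := le_trans ler01 M1.
have bwt s : 0 <= s -> s <= t + 1 -> fbd alpha M (b s) /\ C1bd alpha M (w s).
  by move=> s0 st; apply: bw; rewrite s0.
have tt1 : t <= t + 1 by rewrite lerDl.
have [bM wM] := bwt t t0 tt1.
have [C1 C10 consist] := euler_consistent d a01 M1.
have [C2 C20 stable] := euler_C1bd d a01 M1.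
have [r1 r10 massP] := mass_near t0.
set m := mass (mu t) + 1 in massP.
have m0 : 0 < m by rewrite ltr_wpDl ?mass_ge0.
have mt : mass (mu t) <= m by rewrite lerDl.
(* Three quarters of the error are spent on moving the generator from time c to time t, the last one
   on the consistency of the Euler step. *)
pose e4 := e / 4; have e40 : 0 < e4 by rewrite divr_gt0.
have C1m : 0 < 2 * C1 * m + 1 by rewrite ltr_wpDl// !mulr_ge0// ltW.
have [r2 r20 smallP] := powRa_small a01 (divr_gt0 e40 C1m).
have D1m : 0 < (D + 1) * m by rewrite mulr_gt0// ltr_wpDl.
have [r3 r30 bP] := bc t0 (divr_gt0 e40 D1m).
have [r4 r40 wP] := wc t0 (divr_gt0 e40 D1m).
pose eta := Num.min 1 r2.
have eta0 : 0 < eta by rewrite lt_min ltr01.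
have eta1 : eta <= 1 by rewrite ge_min lexx.
have eta01 : 0 <= eta <= 1 by rewrite ltW.
have small s : 0 <= s -> s <= r2 -> 2 * C1 * m * s `^ alpha <= e4.
  move=> s0 sr; apply: (@le_trans _ _ ((2 * C1 * m + 1) * (e4 / (2 * C1 * m + 1)))).
    by rewrite ler_pM ?powR_ge0 ?lerDl// ?smallP// !mulr_ge0// ltW.
  by rewrite mulrCA divff ?mulr1// gt_eqF.
have etas : 2 * C1 * m * eta `^ alpha <= e4 by apply: small; rewrite ?(ltW eta0)// ge_min lexx orbT.
pose q := eta^-1 * (1 + C2 * eta + 1).
have q0 : 0 <= q by rewrite mulr_ge0 ?invr_ge0 ?addr_ge0 ?mulr_ge0 ?(ltW eta0).
(* Up to the factor K, the Lipschitz constant in time of the integral of the quotient [Q] below, q =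
   O(1 / eta) being its size in C^{1+alpha}. As eta is already fixed, tau L can be made small. *)
pose L := (D + 1) * M * q * m.
have DM0 : 0 <= (D + 1) * M by rewrite mulr_ge0// addr_ge0.
have L0 : 0 <= L by exact: mulr_ge0 (mulr_ge0 DM0 q0) (ltW m0).
exists (Num.min (Num.min 1 (e4 / (L + 1))) (Num.min (Num.min r1 r2) (Num.min r3 r4))).
  have L1 : 0 < L + 1 by rewrite ltr_wpDl.
  by rewrite !lt_min ltr01 r10 r20 r30 r40 (divr_gt0 e40 L1).
move=> tau; rewrite !lt_min => /andP[tau0 /andP[/andP[tau1 tauL] /andP[/andP[tr1 tr2] /andP[tr3 tr4]]]].
move=> K r f fK fr; have K0 := C1bd_ge0 fK; have [_ f0 _ _] := fK.
have fc := C1bd_continuous a01 fK.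
have tau01 : 0 <= tau <= 1 by rewrite (ltW tau0) (ltW tau1).
have near c : t <= c <= t + tau -> [/\ 0 <= c, c <= t + 1, `|c - t| <= tau & mass (mu c) <= m].
  move=> /andP[tc ct]; have c0 : 0 <= c := le_trans t0 tc.
  have ctau : `|c - t| <= tau by rewrite ger0_norm ?subr_ge0// lerBlDl.
  split=> //; first by rewrite (le_trans ct)// lerD2l ltW.
  by apply: massP => //; exact: le_lt_trans tr1.
have gc s : 0 <= s -> s <= t + 1 -> continuous (generator (b s) (w s) f).
  by move=> s0 st; have [? ?] := bwt s s0 st; exact: generator_continuous fK _ _.
have g0 s : 0 <= s -> s <= t + 1 -> forall x, `|generator (b s) (w s) f x| <= (D + 1) * M * K.
  by move=> s0 st; have [? ?] := bwt s s0 st; exact: generator_norm_le fK _ _.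
have ttau : t <= t + tau by rewrite lerDl ltW.
have [_ mvt] := weak_MVT fK fr.
have [c ct mE] := mvt t (t + tau) t0 ttau.
rewrite addrAC subrr add0r in mE.
have [c0 c1 ctau mc] := near c ct.
pose Q x := eta^-1 * (euler eta (b t) (w t) f x + (-1) * f x).
have QK : C1bd alpha (K * q) Q.
  have := C1bdZ eta^-1 (C1bdD (stable eta K _ _ f eta01 bM wM fK) (C1bdZ (-1) fK)).
  congr C1bd; rewrite normrN normr1 gtr0_norm ?invr_gt0// /q; ring.
have Qr : csupp (r + M) Q.
  move=> x rx; rewrite /Q (euler_csupp M1 _ eta01 bM fr)// fr ?mulr0 ?addr0 ?mulr0//.
  by rewrite (le_lt_trans _ rx)// lerDl.
have Qc := C1bd_continuous a01 QK; have [_ Q0 _ _] := QK.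
have Qg x : `|Q x - generator (b t) (w t) f x| <= C1 * K * eta `^ alpha.
  have := consist eta K (b t) (w t) f x eta01 bM wM fK; rewrite -/(generator _ _ _ _).
  rewrite (_ : euler _ _ _ _ _ - _ - _ = eta * (Q x - generator (b t) (w t) f x)); last first.
    by rewrite /Q mulrBr mulrA divff ?gt_eqF// mul1r mulN1r.
  by rewrite normrM gtr0_norm// -mulrA mulrCA ler_pM2l// mulrCA mulrA.
(* Second use of the mean value form, now for [Q] itself, between t and the mean value time c of
   f. *)
have [_ Qmvt] := weak_MVT QK Qr.
have [c' ct' QE] := Qmvt t c t0 (proj1 (andP ct)).
have ct'' : t <= c' <= t + tau.
  by case/andP: ct' => -> /le_trans; apply; case/andP: ct.
have [c'0 c'1 _ mc'] := near c' ct''.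
have [bM' wM'] := bwt c' c'0 c'1.
have Qmove : `|\int[mu c]_x Q x - \int[mu t]_x Q x| <= tau * L * K.
  rewrite QE normrM (_ : tau * L * K = tau * ((D + 1) * M * (K * q) * m)); last by rewrite /L; ring.
  apply: ler_pM => //.
  apply: (le_trans (Rint_norm_le (mu c') (generator_continuous a01 QK bM' wM')
    (generator_norm_le QK bM' wM'))).
  by rewrite (ler_wpM2l (mulr_ge0 DM0 (mulr_ge0 K0 q0))).
have gt := gc t t0 tt1; have gt0 := g0 t t0 tt1.
have gcc := gc c c0 c1; have gc0 := g0 c c0 c1.
have S1 : `|\int[mu c]_x generator (b c) (w c) f x - \int[mu c]_x generator (b t) (w t) f x|
    <= e4 * K.
  apply: (le_trans (Rint_dist_le (mu c) (e := (D + 1) * (e4 / ((D + 1) * m)) * K) gcc gt gc0 gt0 _)).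
    move=> x; apply: (generator_dist_le fK).
      by apply: bP => //; exact: le_lt_trans tr3.
    by apply: wP => //; exact: le_lt_trans tr4.
  apply: (@le_trans _ _ ((D + 1) * (e4 / ((D + 1) * m)) * K * m)).
    by rewrite ler_wpM2l// mulr_ge0// mulr_ge0 ?addr_ge0// ltW// (divr_gt0 e40 D1m).
  rewrite le_eqVlt; apply/orP; left; apply/eqP; field.
  by rewrite (gt_eqF m0) gt_eqF// ltr_wpDl.
have S2 (nu : {finite_measure set (borel R d) -> \bar R}) : mass nu <= m ->
    `|\int[nu]_x Q x - \int[nu]_x generator (b t) (w t) f x| <= e4 / 2 * K.
  move=> num; apply: (le_trans (Rint_dist_le nu Qc gt Q0 gt0 Qg)).
  apply: (@le_trans _ _ (C1 * K * eta `^ alpha * m)).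
    by rewrite ler_wpM2l// !mulr_ge0 ?powR_ge0.
  rewrite (_ : _ * m = (2 * C1 * m * eta `^ alpha) / 2 * K); last by field.
  by rewrite ler_wpM2r// ler_wpM2r.
have tL : tau * L <= e4.
  have L1 : 0 < L + 1 by rewrite ltr_wpDl.
  rewrite ltr_pdivlMr// in tauL; apply: le_trans (ltW tauL).
  by rewrite ler_wpM2l ?(ltW tau0)// lerDl.
have [K' eK] := euler_C1bd_continuous M1 tau01 bM wM fK.
have ec := C1bd_continuous a01 eK; have [_ ee0 _ _] := eK.
have S4 : `|\int[mu t]_x euler tau (b t) (w t) f x - \int[mu t]_x f x
     - tau * \int[mu t]_x generator (b t) (w t) f x| <= e4 * tau * K.
  rewrite -(RintB (mu t) ec fc ee0 f0).
  rewrite -(RintZ (mu t) tau gt gt0).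
  have Fc : continuous (fun x => euler tau (b t) (w t) f x - f x).
    by move=> x; exact: (continuousB (ec x) (fc x)).
  have F0 x : `|euler tau (b t) (w t) f x - f x| <= K' + K.
    by rewrite (le_trans (ler_normB _ _))// lerD.
  have tg0 x : `|tau * generator (b t) (w t) f x| <= tau * ((D + 1) * M * K).
    by rewrite normrM gtr0_norm// ler_wpM2l// ltW.
  apply: (le_trans (Rint_dist_le (mu t) Fc (continuous_scale (c := tau) gt) F0 tg0
    (fun x => consist tau K _ _ f x tau01 bM wM fK))).
  apply: (@le_trans _ _ (C1 * K * tau * tau `^ alpha * m)).
    by rewrite ler_wpM2l// !mulr_ge0 ?powR_ge0// ltW.
  rewrite (_ : _ * m = C1 * m * tau `^ alpha * tau * K); last by ring.
  rewrite ler_wpM2r// ler_wpM2r ?(ltW tau0)//.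
  have := small tau (ltW tau0) (ltW tr2).
  by apply: le_trans; rewrite -!mulrA ler_peMl ?ler1n// !mulr_ge0 ?powR_ge0// ltW.
have S5 : `|\int[mu c]_x generator (b c) (w c) f x - \int[mu t]_x generator (b t) (w t) f x|
    <= 3 * e4 * K.
  (* Chain of four: freeze the coefficients at t, replace the generator by [Q], pass from [mu c] to
     [mu t], return to the generator. *)
  rewrite -(subrKA (\int[mu c]_x generator (b t) (w t) f x)).
  rewrite -[X in _ + X](subrKA (\int[mu c]_x Q x)).
  rewrite -[X in _ + (_ + X)](subrKA (\int[mu t]_x Q x)).
  rewrite (_ : 3 * e4 * K = e4 * K + (e4 / 2 * K + (e4 * K + e4 / 2 * K))); last by field.
  rewrite (le_trans (ler_normD _ _))// lerD// (le_trans (ler_normD _ _))// lerD//.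
    by rewrite distrC S2.
  rewrite (le_trans (ler_normD _ _))// lerD// ?S2// (le_trans Qmove)//.
  by rewrite ler_wpM2r.
rewrite (_ : _ - _ = tau * (\int[mu c]_x generator (b c) (w c) f x
    - \int[mu t]_x generator (b t) (w t) f x)
  - (\int[mu t]_x euler tau (b t) (w t) f x - \int[mu t]_x f x
     - tau * \int[mu t]_x generator (b t) (w t) f x)); last first.
  by rewrite mulrBr -mE; ring.
rewrite (le_trans (ler_normB _ _))// normrM gtr0_norm//.
rewrite (_ : e * tau * K = tau * (3 * e4 * K) + e4 * tau * K); last by rewrite /e4; field.
by rewrite lerD// ler_wpM2l// ltW.
Qed.

End WeakSolution.

(** * Cutoff functions *)

Section Cutoff.
Variables (R : realType) (d : nat) (alpha : R).
Hypothesis a01 : 0 < alpha <= 1.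

Let p (u : R) : R := Num.max 0 u ^+ 2.
Let p' (u : R) : R := 2 * Num.max 0 u.

(** The quadratic remainder holds across the kink of p'. It yields the derivative of the spline
    without differentiating a maximum, and the rate at which rescaled cutoffs tend to 1. *)
Let p_quadratic (u v : R) : `|p (u + v) - p u - v * p' u| <= v ^+ 2.
Proof.
rewrite /p /p' ler_norml.
by have [h1|h1] := leP 0 (u + v); have [h2|h2] := leP 0 u; apply/andP; split; nra.
Qed.

Let max0_lip (u v : R) : `|Num.max 0 u - Num.max 0 v| <= `|u - v|.
Proof.
rewrite ler_norml; have [h3|h3] := leP 0 (u - v); [rewrite (ger0_norm h3)|rewrite (ltr0_norm h3)];
  by have [h1|h1] := leP 0 u; have [h2|h2] := leP 0 v; apply/andP; split; lra.
Qed.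

(* the quadratic B-spline with knots -3/2, -1/2, 1/2, 3/2 *)
Let N (u : R) : R :=
  2 / 3 * (p (u + 3 / 2) - 3 * p (u + 1 / 2) + 3 * p (u - 1 / 2) - p (u - 3 / 2)).
Let N' (u : R) : R :=
  2 / 3 * (p' (u + 3 / 2) - 3 * p' (u + 1 / 2) + 3 * p' (u - 1 / 2) - p' (u - 3 / 2)).

(** The normalising factor: 2/3 (9/4 - 3/4) = 1. *)
Let N0 : N 0 = 1.
Proof.
rewrite /N /p max_r; last lra.
rewrite max_r; last lra.
by do 2 (rewrite max_l; last lra); lra.
Qed.

Let N_supp (u : R) : 2 <= `|u| -> N u = 0.
Proof.
rewrite /N /p; have [u0|u0] := leP 0 u; [rewrite (ger0_norm u0)|rewrite (ltr0_norm u0)] => u2.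
  by rewrite !max_r; [ring|lra..].
by rewrite !max_l; [ring|lra..].
Qed.

(** 100 is a generous common constant for N, for N', for the Lipschitz constant of N' and for the
    quadratic remainder. *)
Let N_le (u : R) : `|N u| <= 100.
Proof.
have [u2|u2] := leP 2 `|u|; first by rewrite N_supp// normr0.
move: u2; rewrite ltr_norml => /andP[u2 u2'].
have pb v : -4 <= v <= 4 -> 0 <= p v <= 16.
  by move=> /andP[v1 v2]; rewrite /p; have [v0|v0] := leP 0 v; apply/andP; split; nra.
have /andP[a1 a2] : 0 <= p (u + 3 / 2) <= 16 by apply: pb; lra.
have /andP[b1 b2] : 0 <= p (u + 1 / 2) <= 16 by apply: pb; lra.
have /andP[c1 c2] : 0 <= p (u - 1 / 2) <= 16 by apply: pb; lra.
have /andP[d1 d2] : 0 <= p (u - 3 / 2) <= 16 by apply: pb; lra.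
by rewrite /N ler_norml; apply/andP; split; lra.
Qed.

Let N'_le (u : R) : `|N' u| <= 100.
Proof.
rewrite /N' /p' ler_norml.
by have [h1|h1] := leP 0 (u + 3 / 2); have [h2|h2] := leP 0 (u + 1 / 2);
  have [h3|h3] := leP 0 (u - 1 / 2); have [h4|h4] := leP 0 (u - 3 / 2);
  apply/andP; split; lra.
Qed.

Let N'_lip (u v : R) : `|N' u - N' v| <= 100 * `|u - v|.
Proof.
have m k : `|Num.max 0 (u + k) - Num.max 0 (v + k)| <= `|u - v|.
  by apply: le_trans (max0_lip _ _) _; rewrite (_ : _ - _ = u - v)//; ring.
have := m (3 / 2); have := m (1 / 2); have := m (- (1 / 2)); have := m (- (3 / 2)).
rewrite /N' /p' !ler_norml => /andP[? ?] /andP[? ?] /andP[? ?] /andP[? ?].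
by apply/andP; split; lra.
Qed.

Let N_quadratic (u v : R) : `|N (u + v) - N u - v * N' u| <= 100 * v ^+ 2.
Proof.
have q k : `|p (u + v + k) - p (u + k) - v * p' (u + k)| <= v ^+ 2.
  by rewrite (_ : u + v + k = u + k + v); [exact: p_quadratic|ring].
have := q (3 / 2); have := q (1 / 2); have := q (- (1 / 2)); have := q (- (3 / 2)).
rewrite /N /N' !ler_norml => /andP[? ?] /andP[? ?] /andP[? ?] /andP[? ?].
by apply/andP; split; lra.
Qed.

Lemma is_derive_quadratic (f : 'rV[R]_d -> R) x v (l C : R) :
  (forall h : R, `|f (h *: v + x) - f x - h * l| <= C * h ^+ 2) ->
  is_derive x v (f : _ -> R^o) l.
Proof.
move=> H.
have C0 : 0 <= C by have := le_trans (normr_ge0 _) (H 1); rewrite expr1n mulr1.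
have E : (h^-1 *: ((f \o shift x) (h *: v) - f x) : R^o) @[h --> 0^'] --> (l : R^o).
  apply/cvgrPdist_le => e e0.
  have C1 : 0 < C + 1 by rewrite ltr_wpDl.
  have eC : 0 < e / (C + 1) by rewrite divr_gt0.
  near=> h.
  have h0 : h != 0 by near: h; exact: nbhs_dnbhs_neq.
  have he : `|h| <= e / (C + 1) by near: h; exact: dnbhs0_le.
  rewrite distrC -(mulKf h0 l) -[X in `|X - _|]/(h^-1 * _) -mulrBr normrM normfV.
  rewrite ler_pdivrMl ?normr_gt0//= (le_trans (H h))//.
  rewrite -real_normK ?num_real// expr2 mulrCA ler_wpM2l//.
  apply: (@le_trans _ _ ((C + 1) * (e / (C + 1)))); first by rewrite ler_pM// lerDl.
  by rewrite mulrCA divff ?mulr1// gt_eqF.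
by split; [apply/cvg_ex; exists l|apply: cvg_lim].
Unshelve. all: by end_near. Qed.

(** Rescaling by c <= 1 only shrinks derivatives, whence a bound uniform in c. The value 200 is
    twice the bound of N', needed for the Hoelder condition at distance larger than 1. *)
Let zeta_factor (c : R) (i : 'I_d) : 0 <= c <= 1 ->
  C1bd alpha 200 (fun x : 'rV[R]_d => N (c * x 0 i)).
Proof.
move=> /andP[c0 c1].
pose del (j : 'I_d) : R := (i == j)%:R.
have del01 j : 0 <= del j <= 1 by rewrite /del; case: eqP => _; rewrite ?lexx ?ler01.
apply: (@C1bd_intro _ _ _ _ _ (fun j x => c * del j * N' (c * x 0 i))).
- move=> x j; apply: (@is_derive_quadratic _ _ _ _ 100) => h.
  rewrite !mxE !eqxx /= -/(del j) mulrDr [c * (h * _) + _]addrC.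
  have := N_quadratic (c * x 0 i) (c * (h * del j)).
  have -> : c * (h * del j) * N' (c * x 0 i) = h * (c * del j * N' (c * x 0 i)) by ring.
  move=> /le_trans; apply; rewrite ler_wpM2l//.
  rewrite !exprMn mulrCA ler_piMr ?sqr_ge0//.
  have /andP[j0 j1] := del01 j.
  by rewrite -exprMn exprn_ile1// ?mulr_ge0// mulr_ile1.
- by move=> x; rewrite (le_trans (N_le _))// ler_nat.
- move=> x j; have /andP[j0 j1] := del01 j.
  rewrite normrM ger0_norm ?mulr_ge0// (@le_trans _ _ (1 * 100))//.
    by rewrite ler_pM ?mulr_ge0// mulr_ile1.
  by rewrite mul1r ler_nat.
- move=> x y j; have /andP[j0 j1] := del01 j.
  rewrite -mulrBr normrM ger0_norm ?mulr_ge0//.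
  apply: (@le_trans _ _ (1 * `|N' (c * x 0 i) - N' (c * y 0 i)|)).
    by rewrite ler_wpM2r// mulr_ile1.
  rewrite mul1r; have [xy1|/ltW xy1] := leP `|x - y| 1.
    apply: (le_trans (N'_lip _ _)); rewrite ler_pM// ?ler_nat//.
    rewrite -mulrBr normrM (ger0_norm c0).
    apply: (@le_trans _ _ (1 * `|x - y|)).
      by rewrite ler_pM//; have := rV_norm_ge (x - y) i; rewrite !mxE.
    by rewrite mul1r; exact: powRa_ge_id.
  rewrite (le_trans (ler_normB _ _))// (@le_trans _ _ (200 * 1))//.
    by have := N'_le (c * x 0 i); have := N'_le (c * y 0 i); lra.
  by rewrite ler_wpM2l//; have := powRa_le a01 ler01 xy1; rewrite powR1.
Qed.

Lemma cutoff_exists : exists K : R, exists zeta : nat -> 'rV[R]_d -> R,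
  [/\ forall n, C1bd alpha K (zeta n),
      forall n, exists r, csupp r (zeta n) &
      forall x, zeta n x @[n --> \oo] --> (1 : R)].
Proof.
pose c (n : nat) : R := n.+1%:R^-1.
have c01 n : 0 <= c n <= 1 by rewrite invr_ge0 ler0n/= invf_le1// ler1n.
have bd (s : seq 'I_d) : exists K : R, forall n,
    C1bd alpha K (fun x : 'rV[R]_d => \prod_(i <- s) N (c n * x 0 i)).
  elim: s => [|i s [K IH]].
    exists 1 => n.
    apply: (@C1bd_intro _ _ _ _ _ (fun _ _ => 0)) => *; rewrite ?subrr ?normr0 ?mul1r ?powR_ge0//.
      rewrite (_ : (fun _ => _) = cst 1); first exact: is_derive_cst.
      by apply/funext => x; rewrite big_nil.
    by rewrite big_nil normr1.
  eexists => n; have := C1bdM a01 (zeta_factor i (c01 n)) (IH n).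
  congr C1bd; apply/funext => x; by rewrite big_cons.
have [K KP] := bd (index_enum 'I_d).
exists K, (fun n x => \prod_i N (c n * x 0 i)); split=> //.
(* One large coordinate is enough: N vanishes from 2 on, and it is evaluated at x_i / (n + 1). *)
- move=> n; exists (2 * n.+1%:R) => x xn.
  have [i xi] : exists i, 2 * n.+1%:R < `|x 0 i|.
    apply: contrapT => H; move: xn; rewrite ltNge => /negP; apply.
    apply: rV_norm_le => // i; rewrite leNgt; apply/negP => xi; apply: H; by exists i.
  rewrite (bigD1 i)//= N_supp ?mul0r// normrM ger0_norm; last by case/andP: (c01 n).
  by rewrite mulrC ler_pdivlMr// ltW.
- move=> x; elim: (index_enum 'I_d) => [|i s IH].
    rewrite (_ : (fun _ => _) = cst 1); first exact: cvg_cst.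
    by apply/funext => n; rewrite big_nil.
  rewrite (_ : (fun _ => _) = (fun n => N (c n * x 0 i) * \prod_(j <- s) N (c n * x 0 j))); last first.
    by apply/funext => n; rewrite big_cons.
  rewrite -[1 in X in _ --> X](mulr1 1); apply: cvgM => //.
  apply/cvgrPdist_le => e e0.
  have X0 : 0 < 100 * `|x 0 i| * (1 + `|x 0 i|) + 1 by rewrite ltr_wpDl// !mulr_ge0// addr_ge0.
  have [m _ mP] := near_infty_natSinv_lt (PosNum (divr_gt0 e0 X0)).
  exists m => // n /mP /=; rewrite -/(c n) => cn.
  have /andP[c0 c1] := c01 n.
  (* As N(0) = 1 and N'(0) = 0, the distance of the factor to 1 is at most 100 (c x_i)^2, which one
     factor c <= 1 reduces to a bound linear in c. *)
  have := N_quadratic 0 (c n * x 0 i); rewrite add0r N0.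
  have N'0 : N' 0 = 0.
    rewrite /N' /p' max_r; last lra.
    rewrite max_r; last lra.
    by do 2 (rewrite max_l; last lra); lra.
  rewrite N'0 mulr0 subr0 distrC => /le_trans; apply.
  apply: (@le_trans _ _ (e / (100 * `|x 0 i| * (1 + `|x 0 i|) + 1) *
    (100 * `|x 0 i| * (1 + `|x 0 i|) + 1))); last by rewrite divfK// gt_eqF.
  apply: (@le_trans _ _ (c n * (100 * `|x 0 i| * (1 + `|x 0 i|) + 1))); last first.
    by rewrite ler_wpM2r ?ltW.
  rewrite exprMn -(real_normK (num_real (x 0 i))) mulrCA expr2 -mulrA ler_wpM2l//.
  have x0 := normr_ge0 (x 0 i).
  apply: (@le_trans _ _ (1 * (100 * `|x 0 i| ^+ 2))).
    by rewrite ler_wpM2r// mulr_ge0// sqr_ge0.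
  nra.
Qed.

End Cutoff.

(** * Dependence on the parameter *)

Section Perturbation.
Variables (R : realType) (d : nat) (alpha : R).
Hypothesis a01 : 0 < alpha <= 1.
Variables (b b1 : R -> 'rV[R]_d -> 'rV[R]_d) (w : R -> 'rV[R]_d -> R).
Hypotheses (bc : time_continuous b) (b1c : time_continuous b1) (wc : time_continuous w).
Hypothesis coefM : forall T : R, exists2 M : R, 1 <= M & forall s, 0 <= s <= T ->
  [/\ fbd alpha M (b s), fbd alpha M (b1 s) & C1bd alpha M (w s)].
Variables (mu0 : probability (borel R d) R) (I : set R).
Variable mu : R -> R -> {finite_measure set (borel R d) -> \bar R}.
Hypothesis I1 : forall h, I h -> `|h| <= 1.

Definition perturbed (h t : R) (x : 'rV[R]_d) : 'rV[R]_d := b t x + h *: b1 t x.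

Hypothesis weak : forall h, I h -> weak_solution (perturbed h) w mu0 (mu h).
Implicit Types (f : 'rV[R]_d -> R) (K : R).

Let D : R := d%:R.
Let D0 : 0 <= D. Proof. exact: ler0n. Qed.

(** The radius is only asserted to exist: it grows with every Euler step, and the estimates below
    hold with constants that do not involve it. *)
Definition adm K f : Prop := C1bd alpha K f /\ exists r, csupp r f.

Lemma adm_ge0 K f : adm K f -> 0 <= K.
Proof. by case=> /C1bd_ge0. Qed.

(** Since [|h| <= 1], the constant 2 M serves all perturbed fields at once; the uniformity in h of
    the later constants originates here. *)
Lemma perturbed_coefM (T : R) : exists2 M : R, 1 <= M & forall s, 0 <= s <= T ->
  [/\ fbd alpha M (b1 s), C1bd alpha M (w s) & forall h, I h -> fbd alpha M (perturbed h s)].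
Proof.
have [M M1 MP] := coefM T; have M0 : 0 <= M := le_trans ler01 M1.
have M2 : M <= 2 * M by rewrite ler_peMl// ler1n.
exists (2 * M); first exact: le_trans M2.
move=> s sT; have [bM b1M wM] := MP s sT; split=> [j||h /I1 h1 j].
- exact: C1bd_le M2 (b1M j).
- exact: C1bd_le M2 wM.
- apply: C1bd_le (fbdD bM (fbdZ h b1M) j).
  by rewrite mulrDl mul1r lerD2l ler_piMl.
Qed.

Lemma perturbed_time_continuous h : I h -> time_continuous (perturbed h).
Proof.
move=> /I1 h1 t t0 e e0; have e20 : 0 < e / 2 by rewrite divr_gt0.
have [r r0 rP] := bc t0 e20; have [r' r'0 r'P] := b1c t0 e20.
exists (Num.min r r'); first by rewrite lt_min r0.
move=> s s0; rewrite lt_min => /andP[sr sr'] x.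
rewrite /perturbed opprD addrACA -scalerBr [e]splitr (le_trans (ler_normD _ _))//.
rewrite lerD ?rP// normrZ (le_trans _ (r'P s s0 sr' x))//.
by rewrite ler_piMl.
Qed.

Lemma perturbed_bwM h : I h -> forall T : R, exists2 M : R, 1 <= M &
  forall s, 0 <= s <= T -> fbd alpha M (perturbed h s) /\ C1bd alpha M (w s).
Proof.
move=> Ih T; have [M M1 MP] := perturbed_coefM T; exists M => // s sT.
by have [_ wM hM] := MP s sT; split=> //; exact: hM.
Qed.

Lemma adm_narrow h K f : I h -> adm K f ->
  half_line_continuous (fun s => \int[mu h s]_x f x).
Proof.
move=> Ih [fK _]; have [_ f0 _ _] := fK.
exact: (narrow (weak Ih) (C1bd_continuous a01 fK) f0).
Qed.

Lemma adm_initial h K f : I h -> adm K f -> \int[mu h 0]_x f x = \int[mu0]_x f x.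
Proof.
move=> Ih [fK [r fr]].
exact: (weak_MVT a01 (perturbed_time_continuous Ih) wc (perturbed_bwM Ih) (weak Ih) fK fr).1.
Qed.

(** The threshold on tau may depend on h and t. This is harmless: [dual_gronwall] asks only for a
    local step at each time, and its conclusion does not see the thresholds. *)
Lemma adm_one_step h t e : I h -> 0 <= t -> 0 < e -> exists2 r, 0 < r &
  forall tau, 0 < tau < r -> forall K f, adm K f ->
    `|\int[mu h (t + tau)]_x f x - \int[mu h t]_x euler tau (perturbed h t) (w t) f x|
      <= e * tau * K.
Proof.
move=> Ih t0 e0.
have [r r0 rP] := euler_one_step a01 (perturbed_time_continuous Ih) wc
  (perturbed_bwM Ih) (weak Ih) t0 e0.
by exists r => // tau taur K f [fK [r' fr]]; exact: rP fK fr.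
Qed.

Lemma adm_euler (M C : R) tau h s : 1 <= M -> 0 <= tau <= 1 ->
  (forall tau K b w f, 0 <= tau <= 1 -> fbd alpha M b -> C1bd alpha M w ->
     C1bd alpha K f -> C1bd alpha (K * (1 + C * tau)) (euler tau b w f)) ->
  fbd alpha M (perturbed h s) -> C1bd alpha M (w s) ->
  forall K f, adm K f -> adm (K * (1 + C * tau)) (euler tau (perturbed h s) (w s) f).
Proof.
move=> M1 t01 CP bM wM K f [fK [r fr]]; split; first exact: CP.
by exists (r + M); exact: (euler_csupp M1 _ t01 bM fr).
Qed.

Variable T : R.

(** The mass is the integral of 1, which has no compact support; it is reached as the limit of the
    integrals of the cutoffs, whose C^{1+alpha} bound is common to all n. *)
Lemma mass_bound : exists2 B : R, 0 <= B & forall h s, I h -> 0 <= s <= T -> mass (mu h s) <= B.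
Proof.
have [M M1 MP] := perturbed_coefM T.
have [C C0 CP] := euler_C1bd d a01 M1.
have [K [zeta [zK zr z1]]] := cutoff_exists d a01.
have K0 := C1bd_ge0 (zK 0).
exists (K * ((1 + 1 * `|T|) * expR (C * `|T|))).
  by rewrite !mulr_ge0 ?expR_ge0// addr_ge0// mulr_ge0.
move=> h s Ih sT.
have G : forall f, adm K f -> `|\int[mu h s]_x f x| <= K * ((1 + 1 * s) * expR (C * s)).
  move=> f fK.
  (* Here a = 1 is the mass of [mu0], and A = 1 the accuracy requested from each Euler step. *)
  apply: (@dual_gronwall R _ adm (fun s f => \int[mu h s]_x f x) C 1 1 T) => //.
  - exact: adm_ge0.
  - by move=> K' g; exact: adm_narrow.
  - move=> K' g gK; rewrite (adm_initial Ih gK) mulr1; have [gK' _] := gK.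
    have [_ g0 _ _] := gK'.
    have := Rint_norm_le mu0 (C1bd_continuous a01 gK') g0.
    have -> : mass mu0 = 1.
      by rewrite /mass Rintegral_cst// mul1r -[RHS]/(fine 1%:E) -(@probability_setT _ _ _ mu0).
    by rewrite mulr1.
  - move=> t tT; have t0 : 0 <= t by case/andP: tT.
    have [_ wM hM] := MP t tT.
    have [r r0 rP] := adm_one_step Ih t0 ltr01.
    exists (Num.min 1 r); first by rewrite lt_min ltr01.
    move=> tau /andP[tau0]; rewrite lt_min => /andP[tau1 taur] _ K' g gK.
    have tau01 : 0 <= tau <= 1 by rewrite !ltW.
    exists (euler tau (perturbed h t) (w t) g).
      exact: (adm_euler M1 tau01 CP (hM h Ih) wM gK).
    have := rP tau _ K' g gK; rewrite tau0 taur => /(_ isT) H.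
    rewrite -[X in `|X|](subrK (\int[mu h t]_x euler tau (perturbed h t) (w t) g x)).
    by rewrite (le_trans (ler_normD _ _))// addrC lerD2l (le_trans H)// mul1r mulr1.
have zc n : continuous (zeta n) by exact: (C1bd_continuous a01 (zK n)).
have z0 n x : `|zeta n x| <= K by have [_ + _ _] := zK n; exact.
have onec : continuous (cst 1 : 'rV[R]_d -> R) by exact: cst_continuous.
have zlim := @Rint_dominated R d (mu h s) zeta (cst 1) K zc onec z0 z1.
have /andP[s0 sT'] := sT.
rewrite /mass -[leLHS](cvg_lim _ zlim)//; apply: limr_le.
  by apply/cvg_ex; eexists; exact: zlim.
apply: nearW => n; apply: le_trans (ler_norm _) _.
apply: (le_trans (G (zeta n) (conj (zK n) (zr n)))); rewrite ler_wpM2l//.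
have sT'' : s <= `|T| by apply: le_trans sT' (ler_norm _).
apply: ler_pM; rewrite ?expR_ge0 ?addr_ge0 ?mulr_ge0//.
  by rewrite lerD2l ler_wpM2l.
by rewrite ler_expR ler_wpM2l.
Qed.

(** Both measures are propagated with the Euler step of h; replacing it by that of k under [mu k]
    costs O(tau [|h - k|]) times the mass. The initial data agree, so no other error enters. *)
Lemma adm_lipschitz : exists2 C : R, 0 <= C & forall h k s, I h -> I k -> 0 <= s <= T ->
  forall K f, adm K f ->
    `|\int[mu h s]_x f x - \int[mu k s]_x f x| <= C * `|h - k| * K.
Proof.
have [M M1 MP] := perturbed_coefM T.
have [C C0 CP] := euler_C1bd d a01 M1.
have [C' C'0 C'P] := euler_lip_field d alpha M1.
have [B B0 BP] := mass_bound.
exists ((C' * B + 2) * `|T| * expR (C * `|T|)).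
  by rewrite !mulr_ge0 ?expR_ge0// addr_ge0// mulr_ge0.
move=> h k s Ih Ik sT K f fK; have K0 := adm_ge0 fK.
have [->|hk] := eqVneq h k.
  by rewrite !subrr normr0 mulr0 mul0r.
have hk0 : 0 < `|h - k| by rewrite normr_gt0 subr_eq0.
(* The 2 stands for the two one-step errors, each requested with accuracy [|h - k|], which is
   positive at this point. *)
pose A := (C' * B + 2) * `|h - k|.
have A0 : 0 <= A by rewrite mulr_ge0// addr_ge0// mulr_ge0.
have G : `|\int[mu h s]_x f x - \int[mu k s]_x f x| <= K * ((0 + A * s) * expR (C * s)).
  apply: (@dual_gronwall R _ adm
    (fun s f => \int[mu h s]_x f x - \int[mu k s]_x f x) C 0 A T) => //.
  - exact: adm_ge0.
  - move=> K' g gK.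
    by apply: half_line_continuousB; [exact: adm_narrow Ih gK|exact: adm_narrow Ik gK].
  - move=> K' g gK.
    by rewrite (adm_initial Ih gK) (adm_initial Ik gK) subrr normr0 mulr0.
  - move=> t tT; have t0 : 0 <= t by case/andP: tT.
    have [b1M wM hM] := MP t tT.
    have [r r0 rP] := adm_one_step Ih t0 hk0.
    have [r' r'0 r'P] := adm_one_step Ik t0 hk0.
    exists (Num.min 1 (Num.min r r')); first by rewrite !lt_min ltr01 r0.
    move=> tau /andP[tau0]; rewrite !lt_min => /and3P[tau1 taur taur'] _ K' g gK.
    have K'0 := adm_ge0 gK.
    have tau01 : 0 <= tau <= 1 by rewrite !ltW.
    have hgK := adm_euler M1 tau01 CP (hM h Ih) wM gK.
    have kgK := adm_euler M1 tau01 CP (hM k Ik) wM gK.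
    exists (euler tau (perturbed h t) (w t) g) => //.
    have hc := C1bd_continuous a01 hgK.1; have [_ hg0 _ _] := hgK.1.
    have kc := C1bd_continuous a01 kgK.1; have [_ kg0 _ _] := kgK.1.
    have := rP tau _ K' g gK; rewrite tau0 taur => /(_ isT) H.
    have := r'P tau _ K' g gK; rewrite tau0 taur' => /(_ isT) H'.
    have H'' : `|\int[mu k t]_x euler tau (perturbed h t) (w t) g x -
        \int[mu k t]_x euler tau (perturbed k t) (w t) g x| <= C' * K' * tau * `|h - k| * B.
      apply: (@le_trans _ _ (C' * K' * tau * `|h - k| * mass (mu k t))); last first.
        by rewrite ler_wpM2l ?BP// !mulr_ge0// ltW.
      apply: (Rint_dist_le (mu k t) hc kc hg0 kg0) => x.
      have := C'P tau (h - k) K' (perturbed k t) (b1 t) (w t) g x tau01 b1M wM gK.1.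
      rewrite (_ : (fun y => _) = perturbed h t)//.
      by apply/funext => y; rewrite /perturbed -addrA -scalerDl [k + _]addrC subrK.
    cbv beta; move: H H' H''.
    set a := \int[mu h (t + tau)]_x g x; set a' := \int[mu k (t + tau)]_x g x.
    set c := \int[mu h t]_x _; set c' := \int[mu k t]_x euler _ _ _ _ _.
    set c'' := \int[mu k t]_x _ => H H' H''.
    rewrite (_ : a - a' = (c - c'') + ((a - c) - (a' - c') + (c'' - c'))); last by ring.
    rewrite (le_trans (ler_normD _ _))// lerD2l.
    rewrite (_ : tau * A * K' = (`|h - k| * tau * K' + `|h - k| * tau * K') +
      C' * K' * tau * `|h - k| * B); last by rewrite /A; ring.
    rewrite (le_trans (ler_normD _ _))// lerD//.
    by rewrite (le_trans (ler_normB _ _))// lerD.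
apply: (le_trans G).
have /andP[s0 sT'] := sT.
have sT'' : s <= `|T| by apply: le_trans sT' (ler_norm _).
rewrite add0r mulrC ler_wpM2r//.
rewrite (_ : _ * `|h - k| = A * `|T| * expR (C * `|T|)); last by rewrite /A; ring.
have e1 : expR (C * s) <= expR (C * `|T|) by rewrite ler_expR ler_wpM2l.
by apply: ler_pM e1; rewrite ?expR_ge0//; [exact: mulr_ge0|exact: ler_wpM2l].
Qed.

Definition diff_quotient h l s f : R :=
  l^-1 * (\int[mu (h + l) s]_x f x - \int[mu h s]_x f x).

(* a C^{1+alpha} approximation of the C^alpha function [grad f . b1 t] *)
Definition dir_quotient eta t f (x : 'rV[R]_d) : R :=
  eta^-1 * (euler eta (b1 t) (fun=> 0) f x + (-1) * f x).

Lemma dir_quotient_adm : exists2 C : R, 0 <= C & forall eta t, 0 < eta <= 1 ->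
  0 <= t <= T -> forall K f, adm K f -> adm (K * (C / eta)) (dir_quotient eta t f).
Proof.
have [M M1 MP] := perturbed_coefM T.
have [C C0 CP] := euler_C1bd d a01 M1.
exists (2 + C); first by rewrite addr_ge0.
move=> eta t /andP[eta0 eta1] tT K f [fK [r fr]]; have K0 := C1bd_ge0 fK.
have [b1M _ _] := MP t tT.
have eta01 : 0 <= eta <= 1 by rewrite ltW.
have z0 : C1bd alpha M ((fun=> 0) : 'rV[R]_d -> R).
  by apply: C1bd_le (C1bd0 _ _); exact: le_trans M1.
split.
  have := C1bdZ eta^-1 (C1bdD (CP eta K _ _ f eta01 b1M z0 fK) (C1bdZ (-1) fK)).
  apply: C1bd_le; rewrite normrN normr1 gtr0_norm ?invr_gt0//.
  rewrite (_ : K * (_ / eta) = eta^-1 * (K * (2 + C))); last by ring.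
  rewrite ler_wpM2l ?invr_ge0 ?(ltW eta0)//.
  rewrite (_ : _ + 1 * K = K * (1 + C * eta + 1)); last by ring.
  rewrite ler_wpM2l//.
  have : C * eta <= C by rewrite ler_piMr.
  lra.
exists (r + M) => x rx; rewrite /dir_quotient (euler_csupp M1 _ eta01 b1M fr)//.
by rewrite fr ?mulr0 ?addr0 ?mulr0// (le_lt_trans _ rx)// lerDl (le_trans ler01).
Qed.

(** The one-step estimates for h + l and h are subtracted and divided by l: the quotient follows the
    Euler step of h, with a source tested against the measure at h + l. The error e is at disposal
    through r; the error in eta^alpha is not, and is paid for by the choice of eta in
    [adm_cauchy]. *)
Lemma diff_quotient_step : exists2 C : R, 0 <= C & forall h l t eta e,
  I h -> I (h + l) -> l != 0 -> `|l| <= 1 -> 0 <= t <= T -> 0 < eta <= 1 -> 0 < e ->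
  exists2 r, 0 < r & forall tau, 0 < tau < r -> tau <= 1 -> forall K f, adm K f ->
    `|diff_quotient h l (t + tau) f
      - diff_quotient h l t (euler tau (perturbed h t) (w t) f)
      - tau * \int[mu (h + l) t]_x dir_quotient eta t f x|
    <= tau * (e + C * eta `^ alpha) * K.
Proof.
have [M M1 MP] := perturbed_coefM T; have M0 : 0 <= M := le_trans ler01 M1.
have [C C0 CP] := euler_C1bd d a01 M1.
have [C1 C10 consist] := euler_consistent d a01 M1.
have [C2 C20 diffP] := euler_diff_field d a01 M1.
have [C3 C30 dqP] := dir_quotient_adm.
have [B B0 BP] := mass_bound.
exists (C1 * B); first by rewrite mulr_ge0.
move=> h l t eta e Ih Ihl l0 l1 tT eta01 e0.
have /andP[eta0 eta1] := eta01; have /andP[t0 _] := tT.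
have nl0 : 0 < `|l| by rewrite normr_gt0.
(* After division by l each one-step error contributes e / 4; the other half of e covers the
   tau^alpha remainder of [euler_diff_field]. *)
have e40 : 0 < e * `|l| / 4 by rewrite divr_gt0// mulr_gt0.
have [r1 r10 r1P] := adm_one_step Ihl t0 e40.
have [r2 r20 r2P] := adm_one_step Ih t0 e40.
have CB : 0 < C2 * B + 1 by rewrite ltr_wpDl// mulr_ge0.
have e20 : 0 < e / 2 by rewrite divr_gt0.
have [r3 r30 r3P] := powRa_small a01 (divr_gt0 e20 CB).
exists (Num.min r1 (Num.min r2 r3)); first by rewrite !lt_min r10 r20.
move=> tau /andP[tau0]; rewrite !lt_min => /and3P[tr1 tr2 tr3] tau1 K f fK.
have K0 := adm_ge0 fK; have tau01 : 0 <= tau <= 1 by rewrite ltW.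
have [b1M wM hM] := MP t tT.
have H1 := r1P tau (introT andP (conj tau0 tr1)) K f fK.
have H2 := r2P tau (introT andP (conj tau0 tr2)) K f fK.
have hgK := adm_euler M1 tau01 CP (hM h Ih) wM fK.
have kgK := adm_euler M1 tau01 CP (hM _ Ihl) wM fK.
have QK := dqP eta t eta01 tT K f fK.
have hc := C1bd_continuous a01 hgK.1; have [_ h0 _ _] := hgK.1.
have kc := C1bd_continuous a01 kgK.1; have [_ k0 _ _] := kgK.1.
have Qc := C1bd_continuous a01 QK.1; have [_ Q0 _ _] := QK.1.
set Ph := euler tau (perturbed h t) (w t) f in H2 hc h0 *.
set Pk := euler tau (perturbed (h + l) t) (w t) f in H1 kc k0.
set Q := dir_quotient eta t f in Qc Q0 *.
have z0 : C1bd alpha M ((fun=> 0) : 'rV[R]_d -> R) by exact: C1bd_le M0 (C1bd0 _ _).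
have pt x : `|Pk x - (Ph x + tau * l * Q x)|
    <= tau * `|l| * (C2 * tau `^ alpha + C1 * eta `^ alpha) * K.
  have E1 := diffP tau l K (perturbed h t) (b1 t) (w t) f x tau01 l1 (hM h Ih) b1M wM fK.1.
  rewrite (_ : (fun y => perturbed h t y + l *: b1 t y) = perturbed (h + l) t) in E1; last first.
    by apply/funext => y; rewrite /perturbed -addrA -scalerDl.
  rewrite -/Ph -/Pk in E1.
  have eta01' : 0 <= eta <= 1 by rewrite ltW.
  have E2 := consist eta K (b1 t) (fun=> 0) f x eta01' b1M z0 fK.1.
  rewrite mul0r addr0 in E2.
  have E3 : `|Q x - dotv (grad f x) (b1 t x)| <= C1 * K * eta `^ alpha.
    move: E2; rewrite (_ : _ - _ - _ = eta * (Q x - dotv (grad f x) (b1 t x))); last first.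
      by rewrite /Q /dir_quotient mulrBr mulrA divff ?gt_eqF// mul1r mulN1r.
    by rewrite normrM gtr0_norm// -mulrA mulrCA ler_pM2l// mulrCA mulrA.
  rewrite (_ : Pk x - _ = (Pk x - Ph x - tau * l * dotv (grad f x) (b1 t x))
    - tau * l * (Q x - dotv (grad f x) (b1 t x))); last by ring.
  rewrite (le_trans (ler_normB _ _))//.
  rewrite (_ : tau * `|l| * _ * K = C2 * K * tau * `|l| * tau `^ alpha +
    tau * `|l| * (C1 * K * eta `^ alpha)); last by ring.
  by rewrite lerD// !normrM gtr0_norm// ler_wpM2l// mulr_ge0// ltW.
have H3 : `|\int[mu (h + l) t]_x Pk x - (\int[mu (h + l) t]_x Ph x
    + tau * l * \int[mu (h + l) t]_x Q x)|
    <= tau * `|l| * (C2 * tau `^ alpha + C1 * eta `^ alpha) * K * B.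
  have Qlc := continuous_scale (c := tau * l) Qc.
  have Ql0 x : `|tau * l * Q x| <= `|tau * l| * (K * (C3 / eta)).
    by rewrite normrM ler_wpM2l.
  have Sc : continuous (fun x => Ph x + tau * l * Q x).
    by move=> x; exact: (continuousD (hc x) (Qlc x)).
  have S0 x : `|Ph x + tau * l * Q x| <= K * (1 + C * tau) + `|tau * l| * (K * (C3 / eta)).
    by rewrite (le_trans (ler_normD _ _))// lerD.
  rewrite -(RintZ (mu (h + l) t) (tau * l) Qc Q0) -(RintD (mu (h + l) t) hc Qlc h0 Ql0).
  apply: (le_trans (Rint_dist_le (mu (h + l) t) kc Sc k0 S0 pt)).
  rewrite ler_wpM2l ?BP//.
  by rewrite !mulr_ge0 ?addr_ge0 ?mulr_ge0 ?powR_ge0// ltW.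
move: H1 H2 H3; rewrite /diff_quotient.
set a := \int[mu (h + l) (t + tau)]_x f x; set a' := \int[mu h (t + tau)]_x f x.
set pk := \int[mu (h + l) t]_x Pk x; set pkh := \int[mu (h + l) t]_x Ph x.
set ph := \int[mu h t]_x Ph x; set q := \int[mu (h + l) t]_x Q x => H1 H2 H3.
rewrite (_ : _ - _ - tau * q = l^-1 * ((a - pk) - (a' - ph) + (pk - (pkh + tau * l * q)))); last by field.
rewrite normrM normfV ler_pdivrMl//.
rewrite (_ : `|l| * _ = (e * `|l| / 4 * tau * K + e * `|l| / 4 * tau * K) +
   (e / 2 * tau * `|l| * K + tau * `|l| * C1 * eta `^ alpha * K * B)); last by field.
rewrite (le_trans (ler_normD _ _))// lerD//.
  by rewrite (le_trans (ler_normB _ _))// lerD.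
apply: (le_trans H3).
rewrite (_ : _ * B = (C2 * B) * tau `^ alpha * (tau * `|l| * K) +
   tau * `|l| * C1 * eta `^ alpha * K * B); last by ring.
rewrite lerD2r (_ : e / 2 * _ * _ * _ = e / 2 * (tau * `|l| * K)); last by ring.
rewrite ler_wpM2r ?mulr_ge0 ?(ltW tau0)//.
apply: (@le_trans _ _ ((C2 * B + 1) * (e / 2 / (C2 * B + 1)))).
  by rewrite ler_pM ?mulr_ge0 ?powR_ge0// ?lerDl// r3P// ltW.
by rewrite mulrCA divff ?mulr1// gt_eqF.
Qed.

Lemma adm_cauchy h e : I h -> 0 <= T -> 0 < e -> exists2 rho, 0 < rho & forall l l',
  0 < `|l| < rho -> 0 < `|l'| < rho -> I (h + l) -> I (h + l') ->
  forall K f, adm K f -> `|diff_quotient h l T f - diff_quotient h l' T f| <= e * K.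
Proof.
move=> Ih T0 e0.
have [M M1 MP] := perturbed_coefM T.
have [C C0 CP] := euler_C1bd d a01 M1.
have [C1 C10 stepP] := diff_quotient_step.
have [C2 C20 dqP] := dir_quotient_adm.
have [C3 C30 lipP] := adm_lipschitz.
pose E := T * expR (C * T) + 1.
have E0 : 0 < E by rewrite ltr_wpDl// mulr_ge0// expR_ge0.
(* Each of the two quotients contributes 2 shares, its step error and its eta^alpha error; the fifth
   is for the difference of the sources. [E] is the Gronwall factor, made positive by adding 1. *)
pose e5 := e / (5 * E); have e50 : 0 < e5 by rewrite divr_gt0// mulr_gt0.
have C11 : 0 < C1 + 1 by rewrite ltr_wpDl.
have [r r0 rP] := powRa_small a01 (divr_gt0 e50 C11).
pose eta := Num.min 1 r.
have eta0 : 0 < eta by rewrite lt_min ltr01.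
have eta01 : 0 < eta <= 1 by rewrite eta0 ge_min lexx.
have etaC : C1 * eta `^ alpha <= e5.
  apply: (@le_trans _ _ ((C1 + 1) * (e5 / (C1 + 1)))).
    by rewrite ler_pM ?powR_ge0 ?lerDl// rP ?(ltW eta0)// ge_min lexx orbT.
  by rewrite mulrCA divff ?mulr1// gt_eqF.
(* Size O(1 / eta) of the directional quotient times the Lipschitz constant in h. It is known before
   rho is chosen, and rho makes L ([|l|] + [|l'|]) at most [e5]. *)
pose L := C3 * (C2 / eta); have L0 : 0 <= L by rewrite mulr_ge0// divr_ge0// ltW.
have L1 : 0 < 2 * L + 1 by rewrite ltr_wpDl// mulr_ge0.
exists (Num.min 1 (e5 / (2 * L + 1))); first by rewrite lt_min ltr01 divr_gt0.
move=> l l' /andP[l0]; rewrite lt_min => /andP[l1 lL] /andP[l'0].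
rewrite lt_min => /andP[l'1 l'L] Ihl Ihl' K f fK.
have K0 := adm_ge0 fK.
rewrite normr_gt0 in l0; rewrite normr_gt0 in l'0.
have ll' : L * `|l - l'| <= e5.
  apply: (@le_trans _ _ (L * (`|l| + `|l'|))); first by rewrite ler_wpM2l// ler_normB.
  apply: (@le_trans _ _ (L * (e5 / (2 * L + 1) + e5 / (2 * L + 1)))).
    by rewrite ler_wpM2l// lerD// ltW.
  rewrite (_ : L * _ = e5 / (2 * L + 1) * (2 * L)); last by ring.
  apply: (@le_trans _ _ (e5 / (2 * L + 1) * (2 * L + 1))).
    by rewrite ler_wpM2l ?lerDl// ltW// divr_gt0.
  by rewrite divfK// gt_eqF.
have G : `|diff_quotient h l T f - diff_quotient h l' T f|
    <= K * ((0 + 5 * e5 * T) * expR (C * T)).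
  apply: (@dual_gronwall R _ adm
    (fun s f => diff_quotient h l s f - diff_quotient h l' s f) C 0 (5 * e5) T) => //.
  - by rewrite mulr_ge0// ltW.
  - exact: adm_ge0.
  - move=> K' g gK; rewrite /diff_quotient.
    by apply: half_line_continuousB; apply: half_line_continuousZ;
      apply: half_line_continuousB; exact: (adm_narrow _ gK).
  - move=> K' g gK; rewrite /diff_quotient.
    by rewrite !(adm_initial _ gK)// !subrr !mulr0 subrr normr0.
  - move=> t tT; have t0 : 0 <= t by case/andP: tT.
    have [b1M wM hM] := MP t tT.
    have [r1 r10 r1P] := stepP h l t eta e5 Ih Ihl l0 (ltW l1) tT eta01 e50.
    have [r2 r20 r2P] := stepP h l' t eta e5 Ih Ihl' l'0 (ltW l'1) tT eta01 e50.
    exists (Num.min 1 (Num.min r1 r2)); first by rewrite !lt_min ltr01 r10.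
    move=> tau /andP[tau0]; rewrite !lt_min => /and3P[tau1 tr1 tr2] _ K' g gK.
    have K'0 := adm_ge0 gK; have tau01 : 0 <= tau <= 1 by rewrite !ltW.
    exists (euler tau (perturbed h t) (w t) g).
      exact: (adm_euler M1 tau01 CP (hM h Ih) wM gK).
    have H1 := r1P tau (introT andP (conj tau0 tr1)) (ltW tau1) K' g gK.
    have H2 := r2P tau (introT andP (conj tau0 tr2)) (ltW tau1) K' g gK.
    have QK := dqP eta t eta01 tT K' g gK.
    have H3 := lipP (h + l) (h + l') t Ihl Ihl' tT _ _ QK.
    cbv beta; move: H1 H2 H3.
    set a := diff_quotient h l (t + tau) g; set a' := diff_quotient h l' (t + tau) g.
    set c := diff_quotient h l t _; set c' := diff_quotient h l' t _.
    set q := \int[mu (h + l) t]_x _; set q' := \int[mu (h + l') t]_x _ => H1 H2 H3.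
    rewrite (_ : a - a' = (c - c') +
      ((a - c - tau * q) - (a' - c' - tau * q') + tau * (q - q'))); last by ring.
    rewrite (le_trans (ler_normD _ _))// lerD2l (le_trans (ler_normD _ _))//.
    rewrite (_ : tau * _ * K' = (tau * (e5 + e5) * K' + tau * (e5 + e5) * K') +
      tau * (e5 * K')); last by ring.
    apply: lerD.
      rewrite (le_trans (ler_normB _ _))// lerD//.
        by rewrite (le_trans H1)// ler_wpM2r// ler_wpM2l ?(ltW tau0)// lerD2l.
      by rewrite (le_trans H2)// ler_wpM2r// ler_wpM2l ?(ltW tau0)// lerD2l.
    rewrite normrM gtr0_norm// ler_wpM2l ?(ltW tau0)// (le_trans H3)//.
    rewrite (_ : h + l - (h + l') = l - l'); last by ring.
    rewrite (_ : _ * (K' * _) = L * `|l - l'| * K'); last by rewrite /L; ring.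
    by rewrite ler_wpM2r.
  by rewrite T0 lexx.
apply: (le_trans G); rewrite add0r mulrC ler_wpM2r//.
rewrite (_ : 5 * e5 * T * _ = e / E * (T * expR (C * T))); last first.
  by rewrite /e5; field; rewrite gt_eqF.
apply: (@le_trans _ _ (e / E * E)); last by rewrite divfK// gt_eqF.
by rewrite ler_wpM2l ?lerDl// ltW// divr_gt0.
Qed.

(** Cutting f off costs only the fixed factor C in the C^{1+alpha} bound, and l, l' stay fixed while
    the cutoffs tend to 1; hence rho remains independent of f. *)
Lemma C1bd_cauchy h e : I h -> 0 <= T -> 0 < e -> exists2 rho, 0 < rho & forall l l',
  0 < `|l| < rho -> 0 < `|l'| < rho -> I (h + l) -> I (h + l') ->
  forall K f, C1bd alpha K f ->
    `|diff_quotient h l T f - diff_quotient h l' T f| <= e * K.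
Proof.
move=> Ih T0 e0.
have [Kz [zeta [zK zr z1]]] := cutoff_exists d a01.
have Kz0 := C1bd_ge0 (zK 0).
pose C := (2 * D + 6) * Kz; have C0 : 0 <= C by rewrite mulr_ge0// addr_ge0// mulr_ge0.
have C1 : 0 < C + 1 by rewrite ltr_wpDl.
have [rho rho0 rhoP] := adm_cauchy Ih T0 (divr_gt0 e0 C1).
exists rho => // l l' lr l'r Ihl Ihl' K f fK.
have K0 := C1bd_ge0 fK; have [_ f0 _ _] := fK; have fc := C1bd_continuous a01 fK.
pose f_ n x := zeta n x * f x.
have f_K n := C1bdM a01 (zK n) fK.
have f_c n : continuous (f_ n) := C1bd_continuous a01 (f_K n).
have f_0 n x : `|f_ n x| <= (2 * D + 6) * (Kz * K) by have [_ + _ _] := f_K n; exact.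
have f_f x : f_ n x @[n --> \oo] --> f x.
  by rewrite -[X in _ --> X]mul1r; apply: cvgM; [exact: z1|exact: cvg_cst].
have lim0 k := @Rint_dominated R d (mu k T) f_ f _ f_c fc f_0 f_f.
have limD k : diff_quotient h k T (f_ n) @[n --> \oo] --> diff_quotient h k T f.
  by apply: cvgM; [exact: cvg_cst|apply: cvgB; exact: lim0].
have limN : `|diff_quotient h l T (f_ n) - diff_quotient h l' T (f_ n)| @[n --> \oo]
    --> `|diff_quotient h l T f - diff_quotient h l' T f|.
  by apply: cvg_norm; apply: cvgB; exact: limD.
rewrite -(cvg_lim _ limN)//; apply: limr_le; first by apply/cvg_ex; eexists; exact: limN.
apply: nearW => n; have f_r : exists r, csupp r (f_ n).
  by have [r rP] := zr n; exists r => x rx; rewrite /f_ rP// mul0r.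
apply: (le_trans (rhoP l l' lr l'r Ihl Ihl' _ _ (conj (f_K n) f_r))).
rewrite (_ : _ * _ = e / (C + 1) * C * K); last by rewrite /C; ring.
rewrite ler_wpM2r// -[leRHS](divfK (lt0r_neq0 C1)) ler_wpM2l ?lerDl// ltW// divr_gt0//.
Qed.

End Perturbation.

(** * Regularity of the coefficients *)

Section HoelderNorm.
Variables (R : realType) (V W G : normedModType R) (alpha : R) (D : set V).
Variables (f : V -> W) (Df : V -> G).

Let sup_f := ereal_sup [set (`|f x|)%:E | x in D].
Let sup_Df := ereal_sup [set (`|Df x|)%:E | x in D].
Let sup_H := ereal_sup [set (`|Df z.1 - Df z.2| / `|z.1 - z.2| `^ alpha)%:E
  | z in [set z : V * V | [/\ D z.1, D z.2 & z.1 != z.2]]].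

(** Two distinct points make the set of Hoelder quotients nonempty. Over an empty set its supremum
    would be -oo, and a bound on the sum would bound nothing. *)
Hypothesis D2 : exists z : V * V, [/\ D z.1, D z.2 & z.1 != z.2].

Let sup_f_ge0 : (0 <= sup_f)%E.
Proof.
case: D2 => -[x y] [/= Dx _ _]; apply: (@le_trans _ _ (`|f x|)%:E); first by rewrite lee_fin.
by apply: ereal_sup_ubound; exists x.
Qed.

Let sup_Df_ge0 : (0 <= sup_Df)%E.
Proof.
case: D2 => -[x y] [/= Dx _ _]; apply: (@le_trans _ _ (`|Df x|)%:E); first by rewrite lee_fin.
by apply: ereal_sup_ubound; exists x.
Qed.

Let sup_H_ge0 : (0 <= sup_H)%E.
Proof.
case: D2 => z Dz; apply: (@le_trans _ _ (`|Df z.1 - Df z.2| / `|z.1 - z.2| `^ alpha)%:E).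
  by rewrite lee_fin divr_ge0// powR_ge0.
by apply: ereal_sup_ubound; exists z.
Qed.

Lemma holder1_norm_ge0 : (0 <= holder1_norm alpha D f Df)%E.
Proof. by rewrite /holder1_norm !adde_ge0. Qed.

Lemma holder1_norm_bounds (K : R) : (holder1_norm alpha D f Df <= K%:E)%E ->
  [/\ forall x, D x -> `|f x| <= K, forall x, D x -> `|Df x| <= K &
      forall x y, D x -> D y -> `|Df x - Df y| <= K * `|x - y| `^ alpha].
Proof.
rewrite /holder1_norm -/sup_f -/sup_Df -/sup_H => H.
have Hf : (sup_f <= K%:E)%E.
  by apply: le_trans H; rewrite -addeA leeDl// adde_ge0.
have HDf : (sup_Df <= K%:E)%E.
  by apply: le_trans H; rewrite -addeA addeCA leeDl// adde_ge0.
have HH : (sup_H <= K%:E)%E.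
  by apply: le_trans H; rewrite leeDr// adde_ge0.
have K0 : 0 <= K by rewrite -lee_fin; exact: le_trans sup_f_ge0 Hf.
split=> [x Dx|x Dx|x y Dx Dy].
- by rewrite -lee_fin; apply: le_trans Hf; apply: ereal_sup_ubound; exists x.
- by rewrite -lee_fin; apply: le_trans HDf; apply: ereal_sup_ubound; exists x.
- have [->|xy] := eqVneq x y; first by rewrite subrr normr0 mulr_ge0// powR_ge0.
  have n0 : 0 < `|x - y| `^ alpha by rewrite powR_gt0// normr_gt0 subr_eq0.
  rewrite -ler_pdivrMr// -lee_fin; apply: le_trans HH.
  by apply: ereal_sup_ubound; exists (x, y).
Qed.

Lemma holder1_norm_fine : (holder1_norm alpha D f Df < +oo)%E ->
  (holder1_norm alpha D f Df <= (fine (holder1_norm alpha D f Df))%:E)%E.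
Proof. by move=> H; rewrite fineK// ge0_fin_numE// holder1_norm_ge0. Qed.

End HoelderNorm.

Section Coefficients.
Variables (R : realType) (d : nat) (alpha : R).
Hypothesis d0 : (0 < d)%N.
Hypothesis a01 : 0 < alpha <= 1.
Implicit Types (f : 'rV[R]_d -> R) (b : 'rV[R]_d -> 'rV[R]_d).

Lemma rV_two_points : exists z : 'rV[R]_d * 'rV[R]_d,
  [/\ [set: 'rV[R]_d] z.1, [set: 'rV[R]_d] z.2 & z.1 != z.2].
Proof.
exists (0, const_mx 1); split => //=; apply/eqP => /rowP/(_ (Ordinal d0)).
by rewrite !mxE => /eqP; rewrite eq_sym oner_eq0.
Qed.

Lemma mx_norm_ge (m n : nat) (A : 'M[R]_(m, n)) i j : `|A i j| <= `|A|.
Proof. by rewrite [leRHS]/Num.Def.normr/= mx_normrE; exact: (le_bigmax _ _ (i, j)). Qed.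

Lemma C1a_C1bd f (K : R) : (forall x, has_partials (f : _ -> R^o) x) ->
  (C1a_norm alpha f <= K%:E)%E -> C1bd alpha K f.
Proof.
move=> fd /(holder1_norm_bounds rV_two_points)[f0 f1 f2]; split=> // [x|x i|x y i].
- exact: f0.
- have -> : 'D_(delta_mx 0 i) f x = grad f x 0 i by rewrite mxE.
  exact: le_trans (rV_norm_ge _ _) (f1 x I).
- have -> : 'D_(delta_mx 0 i) f x - 'D_(delta_mx 0 i) f y = (grad f x - grad f y) 0 i.
    by rewrite !mxE.
  exact: le_trans (rV_norm_ge _ _) (f2 x y I I).
Qed.

Lemma C1a_field_fbd b (K : R) : (forall x, has_partials b x) ->
  (C1a_field_norm alpha b <= K%:E)%E -> fbd alpha K b.
Proof.
move=> bd /(holder1_norm_bounds rV_two_points)[b0 b1 b2] j.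
have E x i : 'D_(delta_mx 0 i) (fun y => b y 0 j) x = jac b x i j.
  by rewrite mxE derive_mx ?mxE//; exact: bd.
split=> [x i|x|x i|x y i].
- exact: ((derivable_mxP _ _ _).1 (bd x i) 0 j).
- exact: le_trans (rV_norm_ge _ _) (b0 x I).
- rewrite E; exact: le_trans (mx_norm_ge _ _ _) (b1 x I).
- have -> : 'D_(delta_mx 0 i) (fun y => b y 0 j) x - 'D_(delta_mx 0 i) (fun y => b y 0 j) y
      = (jac b x - jac b y) i j by rewrite !E !mxE.
  exact: le_trans (mx_norm_ge _ _ _) (b2 x y I I).
Qed.

Lemma fbd_le b (K M : R) : K <= M -> fbd alpha K b -> fbd alpha M b.
Proof. by move=> KM bK j; exact: C1bd_le KM (bK j). Qed.

(** Compactness of [0, T] by real induction: monotonicity in M lets the bound up to t and the local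
    bound around t merge into their maximum. *)
Lemma half_line_locally_bounded (Q : R -> R -> Prop) :
  (forall M M' s, M <= M' -> Q M s -> Q M' s) ->
  (forall t, 0 <= t -> exists2 r, 0 < r & exists M, forall s, 0 <= s -> `|s - t| < r -> Q M s) ->
  forall T : R, exists2 M, 1 <= M & forall s, 0 <= s <= T -> Q M s.
Proof.
move=> Qle Qloc T.
have [T0|T0] := leP 0 T; last first.
  by exists 1 => // s /andP[s0 sT]; move: T0; rewrite ltNge (le_trans s0 sT).
move: T T0; apply: continuous_induction.
- have [r r0 [M MP]] := Qloc 0 (lexx 0).
  exists (Num.max 1 M); first by rewrite le_max lexx.
  move=> s s0; apply: (Qle M); first by rewrite le_max lexx orbT.
  have -> : s = 0 by apply/eqP; rewrite eq_le andbC.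
  by apply: MP => //; rewrite subrr normr0.
- move=> t t0 IH; have [r r0 [M MP]] := Qloc t t0.
  have [M' M'1 M'P] := IH t (introT andP (conj t0 (lexx t))).
  exists r => // s /andP[s0 sr]; exists (Num.max M' M); first by rewrite le_max M'1.
  move=> u /andP[u0 ut]; have [tu|tu] := leP u t.
    by apply: (Qle M'); [rewrite le_max lexx|apply: M'P; rewrite u0].
  apply: (Qle M); first by rewrite le_max lexx orbT.
  apply: MP => //; rewrite gtr0_norm ?subr_gt0// ltrBlDl (le_lt_trans ut)//.
  by rewrite ltrD2l.
- move=> t t0 IH; have [r r0 [M MP]] := Qloc t (ltW t0).
  pose s := Num.max 0 (t - r / 2).
  have s0 : 0 <= s by rewrite le_max lexx.
  have st : s < t by rewrite gt_max t0 ltrBlDr ltrDl divr_gt0.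
  have [M' M'1 M'P] := IH s (introT andP (conj s0 st)).
  exists (Num.max M' M); first by rewrite le_max M'1.
  move=> u /andP[u0 ut]; have [us|us] := leP u s.
    by apply: (Qle M'); [rewrite le_max lexx|apply: M'P; rewrite u0].
  apply: (Qle M); first by rewrite le_max lexx orbT.
  apply: MP => //; rewrite distrC ger0_norm ?subr_ge0// ltrBlDl -ltrBlDr.
  apply: le_lt_trans us; rewrite le_max; apply/orP; right.
  by rewrite lerD2l lerN2 ler_pdivrMr// ler_pMr// ler1n.
Qed.

Section Field.
Variable b : R -> 'rV[R]_d -> 'rV[R]_d.
Hypothesis hb : C0_C1a_field alpha b.

Lemma C0_C1a_field_near t e : 0 <= t -> 0 < e -> exists2 r, 0 < r &
  forall s, 0 <= s -> `|s - t| < r -> fbd alpha e (fun x => b s x - b t x).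
Proof.
move=> t0 e0; have [[bt _] bcvg] := hb t0.
have : \forall s \near within [set s | 0 <= s] (nbhs t),
    (C1a_field_norm alpha (fun x => b s x - b t x)%R < e%:E)%E.
  apply: (bcvg [set y | (y < e%:E)%E]); apply: open_nbhs_nbhs; split => /=.
    exact: open_ereal_lt_ereal.
  by rewrite lte_fin.
rewrite near_withinE => /nbhs_ballP[r /= r0 rP]; exists r => // s s0 st.
apply: C1a_field_fbd.
  by move=> x i; apply: derivableB; [exact: (hb s0).1.1|exact: bt].
by apply: ltW; apply: rP => //; rewrite -ball_normE /= distrC.
Qed.

Lemma C0_C1a_field_time_continuous : time_continuous b.
Proof.
move=> t t0 e e0; have [r r0 rP] := C0_C1a_field_near t0 e0.
by exists r => // s s0 st x; exact: (fbd_norm_le x (ltW e0) (rP s s0 st)).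
Qed.

Lemma C0_C1a_field_bounded (T : R) : exists2 M, 1 <= M &
  forall s, 0 <= s <= T -> fbd alpha M (b s).
Proof.
apply: half_line_locally_bounded => [M M' s|t t0]; first exact: fbd_le.
have [r r0 rP] := C0_C1a_field_near t0 ltr01.
have [[bt btn] _] := hb t0.
have := C1a_field_fbd bt (holder1_norm_fine rV_two_points btn).
set M := fine _ => bM.
exists r => //; exists (1 + M) => s s0 st.
have := fbdD (rP s s0 st) bM; congr fbd; apply/funext => x.
by rewrite subrK.
Qed.

End Field.

Section Growth.
Variable w : R -> 'rV[R]_d -> R.
Hypothesis hw : C1a_spacetime alpha w.

(** Freezing the time: between (s, x) and (s, y) the space-time distance is [|x - y|], and the norm
    of the pair of derivatives dominates each component. *)
Lemma C1a_spacetime_bounds : exists K : R, 0 <= K /\ forall s, 0 <= s ->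
  C1bd alpha K (w s) /\ forall x, `|dt w s x| <= K.
Proof.
have D2 : exists z : (R * 'rV[R]_d) * (R * 'rV[R]_d),
    [/\ @spacetime R d z.1, @spacetime R d z.2 & z.1 != z.2].
  exists ((0, 0), (1, 0)); split; rewrite /spacetime /= ?lexx ?ler01//.
  by apply/eqP => -[/eqP]; rewrite eq_sym oner_eq0.
have [wd /(holder1_norm_fine D2)/(holder1_norm_bounds D2)] := hw.
set K := fine _ => -[w0 w1 w2]; exists K.
have K0 : 0 <= K by apply: le_trans (w0 (0, 0) _) => //; exact: lexx.
split=> // s s0.
have pair_le2 (a : R) (v : 'rV[R]_d) : `|v| <= `|(a, v)| by rewrite prod_normE le_max lexx orbT.
have pair_le1 (a : R) (v : 'rV[R]_d) : `|a| <= `|(a, v)| by rewrite prod_normE le_max lexx.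
split=> [|x]; last exact: le_trans (pair_le1 _ _) (w1 (s, x) s0).
split=> [x|x|x i|x y i].
- exact: (wd s x s0).2.
- exact: w0 (s, x) s0.
- have -> : 'D_(delta_mx 0 i) (w s) x = grad (w s) x 0 i by rewrite mxE.
  apply: le_trans (rV_norm_ge _ _) _.
  exact: le_trans (pair_le2 _ _) (w1 (s, x) s0).
- have -> : 'D_(delta_mx 0 i) (w s) x - 'D_(delta_mx 0 i) (w s) y =
      (grad (w s) x - grad (w s) y) 0 i by rewrite !mxE.
  apply: le_trans (rV_norm_ge _ _) _.
  have := w2 (s, x) (s, y) s0 s0; rewrite /= => H.
  apply: le_trans (pair_le2 (dt w s x - dt w s y) _) _; apply: (le_trans H).
  rewrite [X in `|X|](_ : _ = (0, x - y)); last by congr pair; rewrite subrr.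
  by rewrite prod_normE /= normr0 max_r.
Qed.

(** At a positive time the constraint 0 <= s + h holds for all small h, so the restricted quotient
    is the ordinary two-sided one. *)
Lemma dt_is_derive (s : R) x : 0 < s -> is_derive s 1 (fun u : R => w u x) (dt w s x).
Proof.
move=> s0; have [wd _] := hw; have [wc _] := wd s x (ltW s0).
have PF := half_line_quotient_proper (ltW s0).
have H : (fun h : R => h^-1 *: (((fun u => w u x) \o shift s) (h *: (1 : R^o)) - w s x))
    @ (0 : R)^' --> dt w s x.
  have -> : (fun h : R => h^-1 *: (((fun u => w u x) \o shift s) (h *: (1 : R^o)) - w s x))
      = (fun h => h^-1 * (w (s + h) x - w s x)).
    by apply/funext => h; rewrite /shift /= [h%:A]mulr1 [h + s]addrC.
  move=> A /wc; rewrite /dt_quotient /= /within /= => wA.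
  have sn : \forall h \near (0 : R)^', 0 <= s + h.
    have : \forall h \near (0 : R)^', `|h| <= s by exact: dnbhs0_le.
    by apply: filterS => h; rewrite ler_norml => /andP[+ _]; rewrite -subr_ge0 opprK addrC.
  by apply: filterS2 sn wA => h s1 s2; exact: s2.
by split; [apply/cvg_ex; eexists; exact: H|exact: cvg_lim H].
Qed.

Lemma C1a_spacetime_half_line x : half_line_continuous (fun s => w s x).
Proof.
move=> t t0 e e0; have [wd _] := hw; have [wc _] := wd t x t0.
have PF := half_line_quotient_proper t0.
set l := lim (dt_quotient w t x).
have : \forall s \near within [set s | 0 <= t + s] (0 : R)^',
    `|l - s^-1 * (w (t + s) x - w t x)| <= 1.
  by move/cvgrPdist_le : wc => /(_ _ ltr01).
move=> /nbhs_ballP[r /= r0 rP].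
have l1 : 0 < `|l| + 1 by rewrite ltr_wpDl.
exists (Num.min r (e / (`|l| + 1))); first by rewrite lt_min r0 divr_gt0.
move=> s s0; rewrite lt_min => /andP[sr se].
have [->|st] := eqVneq s t; first by rewrite subrr normr0 ltW.
have st0 : s - t != 0 by rewrite subr_eq0.
have sr' : `|0 - (s - t)| < r by rewrite sub0r normrN.
have := rP (s - t) sr' st0; rewrite /= addrC subrK => /(_ s0) H.
have Q : `|(s - t)^-1 * (w s x - w t x)| <= `|l| + 1.
  rewrite -(subrK l (_ * _)) addrC (le_trans (ler_normD _ _))// lerD2l distrC//.
rewrite -(mulVKf st0 (w s x - w t x)) normrM.
apply: (@le_trans _ _ (e / (`|l| + 1) * (`|l| + 1))); last by rewrite divfK// gt_eqF.
by rewrite ler_pM// ltW.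
Qed.

Lemma C1a_spacetime_time_continuous : time_continuous (w : R -> 'rV[R]_d -> R).
Proof.
have [K [K0 KP]] := C1a_spacetime_bounds.
have lip (s t : R) x : 0 <= s -> s <= t -> `|w t x - w s x| <= K * (t - s).
  move=> s0 st.
  have wder (u : R) : u \in `]s, t[ -> is_derive u 1 (fun u : R => w u x) (dt w u x).
    by move=> /[!in_itv]/= /andP[su _]; apply: dt_is_derive; exact: le_lt_trans su.
  (* The derivative is two-sided only at positive times. Continuity up to s, possibly 0, comes from
     the extension by [max 0 u], which agrees with w on [s, t]. *)
  have c : {within `[s, t], continuous (fun u : R => w u x)}.
    apply: (@subspace_eq_continuous _ _ R (fun u : R => w (Num.max 0 u) x)).
      move=> u /set_mem; rewrite /= in_itv/= => /andP[su _].
      by rewrite max_r// (le_trans s0).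
    by apply: continuous_subspaceT; exact: (half_line_continuous_max (C1a_spacetime_half_line x)).
  have [u /[!in_itv]/= /andP[su _] ->] := MVT_segment st wder c.
  rewrite normrM (ger0_norm (_ : 0 <= t - s)) ?subr_ge0// ler_wpM2r ?subr_ge0//.
  by apply: (KP u _).2; exact: le_trans su.
move=> t t0 e e0; have K1 : 0 < K + 1 by rewrite ltr_wpDl.
exists (e / (K + 1)); first by rewrite divr_gt0.
move=> s s0 st x; apply: (@le_trans _ _ (K * `|s - t|)).
  have [ts|ts] := leP t s; first by rewrite (ger0_norm (_ : 0 <= s - t)) ?subr_ge0// lip.
  by rewrite distrC (distrC s) (gtr0_norm (_ : 0 < t - s)) ?subr_gt0// lip// ltW.
apply: (@le_trans _ _ ((K + 1) * (e / (K + 1)))).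
  by rewrite ler_pM// ?lerDl// ltW.
by rewrite mulrCA divff ?mulr1// gt_eqF.
Qed.

End Growth.

Lemma coefficients_bounded (b b1 : R -> 'rV[R]_d -> 'rV[R]_d) (w : R -> 'rV[R]_d -> R) :
  C0_C1a_field alpha b -> C0_C1a_field alpha b1 -> C1a_spacetime alpha w ->
  forall T : R, exists2 M : R, 1 <= M & forall s, 0 <= s <= T ->
  [/\ fbd alpha M (b s), fbd alpha M (b1 s) & C1bd alpha M (w s)].
Proof.
move=> hb hb1 hw T; have [M M1 MP] := C0_C1a_field_bounded hb T.
have [M' M'1 M'P] := C0_C1a_field_bounded hb1 T.
have [K [K0 KP]] := C1a_spacetime_bounds hw.
exists (M + M' + K); first by lra.
move=> s sT; have /andP[s0 _] := sT; split.
- by apply: fbd_le (MP s sT); lra.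
- by apply: fbd_le (M'P s sT); lra.
- by apply: C1bd_le (KP s s0).1; lra.
Qed.

End Coefficients.

(** * Charges and the derivative in Z *)

Section ChargeOfDifference.
Variables (R : realType) (d : nat).
Implicit Types (m : {finite_measure set (borel R d) -> \bar R}).

(** An identity between signed measures, with negative parts moved across, becomes an equality of
    positive measures, for which integrals of nonnegative functions are additive. *)
Lemma ge0_Rint_measure_add m1 m2 (m3 m4 : {finite_measure set (borel R d) -> \bar R})
    (c : R) (f : 'rV[R]_d -> R) (K : R) : 0 <= c ->
  (forall A, measurable A -> (m3 A + c%:E * m2 A = m4 A + c%:E * m1 A)%E) ->
  continuous f -> (forall x, `|f x| <= K) -> (forall x, 0 <= f x) ->
  \int[m3]_x f x + c * \int[m2]_x f x = \int[m4]_x f x + c * \int[m1]_x f x.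
Proof.
move=> c0 mE fc fK f0; pose k := NngNum c0.
have mf : measurable_fun [set: borel R d] (fun x : borel R d => (f x)%:E).
  by apply/measurable_EFinP; exact: continuous_borel_measurable.
have f0' (x : borel R d) : [set: borel R d] x -> (0 <= (f x)%:E)%E by rewrite lee_fin.
have fin m : (\int[m]_x (f x)%:E)%E \is a fin_num.
  by apply: integrable_fin_num => //; exact: bounded_continuous_integrable fK.
have E (m m' : {finite_measure set (borel R d) -> \bar R}) :
    (\int[measure_add m (mscale k m')]_x (f x)%:E)%E
      = (\int[m]_x f x + c * \int[m']_x f x)%:E.
  rewrite ge0_integral_measure_add// ge0_integral_mscale//=.
  by rewrite /Rintegral EFinD EFinM !fineK ?fin.
apply: EFin_inj; rewrite -!E; apply: eq_measure_integral => A mA _.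
have aE (m m' : {finite_measure set (borel R d) -> \bar R}) :
    measure_add m (mscale k m') A = (m A + c%:E * m' A)%E by exact: measure_addE.
exact: etrans (aE m3 m2) (etrans (mE A mA) (esym (aE m4 m1))).
Qed.

(** The Jordan parts of c (m1 - m2) need not be c m1 and c m2, but the differences agree, so pos + c
    m2 = neg + c m1. *)
Lemma charge_pairing_difference m1 m2 (c : R) : 0 <= c ->
  exists (nu : {charge set (borel R d) -> \bar R}) (P N : set (borel R d))
    (nuPN : hahn_decomposition nu P N), forall f (K : R), continuous f ->
      (forall x, `|f x| <= K) ->
      charge_pairing nuPN f = c * (\int[m1]_x f x - \int[m2]_x f x).
Proof.
move=> c0.
have alg (u v kp kn i1 i2 k1 k2 : R) : (u + kp) + c * (i2 + k2) = (v + kn) + c * (i1 + k1) ->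
    kp + c * k2 = kn + c * k1 -> u - v = c * (i1 - i2).
  by move=> H1 H2; lra.
pose nu : {charge set (borel R d) -> \bar R} :=
  cscale c (cadd (charge_of_finite_measure m1) (copp (charge_of_finite_measure m2))).
have [P [N nuPN]] := Hahn_decomposition nu.
exists nu, P, N, nuPN => f K fc fK.
have mE A : measurable A ->
    (jordan_pos nuPN A + c%:E * m2 A = jordan_neg nuPN A + c%:E * m1 A)%E.
  move=> mA.
  have : (c%:E * (m1 A - m2 A) = jordan_pos nuPN A - jordan_neg nuPN A)%E.
    by rewrite -[RHS]/((jordan_pos nuPN \- jordan_neg nuPN) A)%E -[LHS]/(nu A)
      (jordan_decomp nuPN mA) /cadd/= cscaleN1.
  have : jordan_pos nuPN A \is a fin_num by exact: fin_num_measure.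
  have : jordan_neg nuPN A \is a fin_num by exact: fin_num_measure.
  have : m1 A \is a fin_num by exact: fin_num_measure.
  have : m2 A \is a fin_num by exact: fin_num_measure.
  move: (jordan_pos nuPN A) (jordan_neg nuPN A) (m1 A) (m2 A).
  move=> [p| |]// [n| |]// [u| |]// [v| |]// _ _ _ _.
  by rewrite -?EFinN -?EFinD -?EFinM -?EFinD => -[H]; congr EFin; lra.
have K0 : 0 <= K by apply: le_trans (fK 0).
have ge0 := ge0_Rint_measure_add c0 mE.
have cc : continuous ((fun=> K) : 'rV[R]_d -> R) by exact: cst_continuous.
have cK (x : 'rV[R]_d) : `|K| <= K by rewrite ger0_norm.
have fKc : continuous (fun x : 'rV[R]_d => f x + K).
  by move=> x; exact: (continuousD (fc x) (cc x)).
have fKK (x : 'rV[R]_d) : `|f x + K| <= K + K.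
  by rewrite (le_trans (ler_normD _ _))// lerD// ger0_norm.
have fK0 (x : 'rV[R]_d) : 0 <= f x + K.
  by have := fK x; rewrite ler_norml => /andP[+ _]; rewrite -subr_ge0 opprK.
(* The identity is available for nonnegative functions; it is applied to f + K and to the constant
   K, then subtracted. *)
have E1 := ge0 _ _ fKc fKK fK0.
have E2 := ge0 _ _ cc cK (fun=> K0).
rewrite !(RintD _ fc cc fK cK) in E1.
exact: alg E1 E2.
Qed.

End ChargeOfDifference.

(** * Convergence in the dual norm *)

Section DualNorm.
Variables (R : realType) (d : nat) (alpha : R).
Hypothesis d0 : (0 < d)%N.
Hypothesis a01 : 0 < alpha <= 1.
Implicit Types (f g : 'rV[R]_d -> R) (L : ('rV[R]_d -> R) -> R).

Lemma C1a_ex_C1bd f : C1a alpha f -> exists K, C1bd alpha K f.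
Proof.
move=> [fd fn]; exists (fine (C1a_norm alpha f)).
apply: (C1a_C1bd d0 fd); move: fn; rewrite /C1a_norm => fn.
exact: (holder1_norm_fine (rV_two_points R d0) fn).
Qed.

Lemma dual_norm_le L (c : R) : (forall f, C1bd alpha 1 f -> `|L f| <= c) ->
  (dual_norm alpha L <= c%:E)%E.
Proof.
move=> Lc; apply: ub_ereal_sup => _ [f [[fd _] fn] <-]; rewrite lee_fin.
by apply: Lc; exact: C1a_C1bd.
Qed.

(** The zero function shows that the supremum in [dual_norm] runs over a nonempty set, hence is
    nonnegative. *)
Lemma zero_C1a : C1a alpha ((fun=> 0%R) : 'rV[R]_d -> R) /\
  (C1a_norm alpha ((fun=> 0%R) : 'rV[R]_d -> R) <= 1)%E.
Proof.
pose z : 'rV[R]_d -> R := fun=> 0.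
have z0 : C1bd alpha 0 z by exact: C1bd0.
have [zd _ z1 _] := z0.
have gz x : grad z x = 0.
  by apply/rowP => i; rewrite !mxE; apply/eqP; rewrite -normr_le0; exact: z1.
suff H : (C1a_norm alpha z <= 0)%E.
  by split; [split => //; exact: le_lt_trans H _|exact: le_trans H _].
rewrite /C1a_norm /holder1_norm; apply: adde_le0; first apply: adde_le0.
- by apply: ub_ereal_sup => _ [x _ <-]; rewrite /z normr0.
- by apply: ub_ereal_sup => _ [x _ <-]; rewrite gz normr0.
- by apply: ub_ereal_sup => _ [x _ <-]; rewrite !gz subrr normr0 mul0r.
Qed.

Lemma dual_norm_ge0 L : (0 <= dual_norm alpha L)%E.
Proof.
apply: (@le_trans _ _ (`|L ((fun=> 0%R) : 'rV[R]_d -> R)|)%:E); first by rewrite lee_fin.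
by apply: ereal_sup_ubound; exists (fun=> 0%R) => //; exact: zero_C1a.
Qed.

Lemma dual_norm_cvg0 (F : set_system R) (L : R -> ('rV[R]_d -> R) -> R) : Filter F ->
  (forall e, 0 < e -> \forall l \near F, forall f, C1bd alpha 1 f -> `|L l f| <= e) ->
  dual_norm alpha (L l) @[l --> F] --> 0%E.
Proof.
move=> FF Le A A0.
have /nbhs_ballP[r /= r0 rA] : nbhs (0 : R) (fun r => A r%:E) by exact: A0.
have r20 : 0 < r / 2 by rewrite divr_gt0.
apply: filterS (Le _ r20) => l /dual_norm_le lr.
have l0 := dual_norm_ge0 (L l).
have fin : dual_norm alpha (L l) \is a fin_num.
  by rewrite ge0_fin_numE//; exact: le_lt_trans lr (ltry _).
have lt_r : `|0 - fine (dual_norm alpha (L l))| < r.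
  rewrite sub0r normrN ger0_norm ?fine_ge0// -lte_fin fineK//.
  apply: (le_lt_trans lr).
  by rewrite lte_fin ltr_pdivrMr// ltr_pMr// ltr1n.
by have := rA _ lt_r; rewrite /= fineK.
Qed.

End DualNorm.

(** * The limit of the difference quotients *)

Section LimitFunctional.
Variables (R : realType) (d : nat) (alpha : R).
Hypothesis d0 : (0 < d)%N.
Hypothesis a01 : 0 < alpha <= 1.
Variables (nu : R -> {finite_measure set (borel R d) -> \bar R}) (h : R).
Implicit Types (f g : 'rV[R]_d -> R).
Variable I : set R.

Let F := within [set l | I (h + l)] (0 : R)^'.
Let Q l f : R := l^-1 * (\int[nu (h + l)]_x f x - \int[nu h]_x f x).

Hypothesis FP : ProperFilter F.
Hypothesis Qcauchy : forall e, 0 < e -> exists2 rho, 0 < rho & forall l l',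
  0 < `|l| < rho -> 0 < `|l'| < rho -> I (h + l) -> I (h + l') ->
  forall K f, C1bd alpha K f -> `|Q l f - Q l' f| <= e * K.

(** Where the quotients diverge [lim] is a default value; on C^{1+alpha} functions they converge by
    [Q_cvg]. *)
Let T f : R := lim (Q l f @[l --> F]).

Let F_small (rho : R) : 0 < rho -> F [set l | 0 < `|l| < rho /\ I (h + l)].
Proof.
move=> rho0; apply/nbhs_ballP; exists rho => //= l lr l0 Il; split => //.
rewrite normr_gt0 l0 /=; have : `|0 - l| < rho by exact: lr.
by rewrite sub0r normrN.
Qed.

Let Q_cvg K f : C1bd alpha K f -> Q l f @[l --> F] --> T f.
Proof.
move=> fK; have K0 := C1bd_ge0 fK.
apply/cauchy_cvgP; apply: cauchy_exP => e e0.
have K1 : 0 < K + 1 by rewrite ltr_wpDl.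
have e20 : 0 < e / 2 by rewrite divr_gt0.
have [rho rho0 rhoP] := Qcauchy (divr_gt0 e20 K1).
have [l [lr Il]] := filter_ex (F_small rho0).
exists (Q l f); apply: filterS (F_small rho0) => l' [l'r Il'].
apply: le_lt_trans (rhoP l l' lr l'r Il Il' K f fK) _.
apply: (@le_lt_trans _ _ (e / 2)).
  by rewrite -[leRHS](divfK (lt0r_neq0 K1)) ler_wpM2l ?lerDl// ltW// divr_gt0.
by rewrite ltr_pdivrMr// ltr_pMr// ltr1n.
Qed.

(** The increment l' tends to 0 in the Cauchy estimate with l fixed. The same rho serves all K and
    f, which pointwise convergence would not give. *)
Let Q_near (e : R) : 0 < e -> exists2 rho, 0 < rho & forall l, 0 < `|l| < rho -> I (h + l) ->
  forall K f, C1bd alpha K f -> `|Q l f - T f| <= e * K.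
Proof.
move=> e0; have [rho rho0 rhoP] := Qcauchy e0.
exists rho => // l lr Il K f fK; apply/ler_addgt0Pr => e' e'0.
have /cvgrPdist_le/(_ e' e'0) H := Q_cvg fK.
have [l' [[l'r Il'] H']] := filter_ex (filterI (F_small rho0) H).
rewrite -(subrKA (Q l' f)) (le_trans (ler_normD _ _))// lerD//.
  exact: rhoP.
by rewrite distrC.
Qed.

Let Q_linear l (a : R) f g Kf Kg : C1bd alpha Kf f -> C1bd alpha Kg g ->
  Q l (fun x => a * f x + g x) = a * Q l f + Q l g.
Proof.
move=> fK gK; have [_ f0 _ _] := fK; have [_ g0 _ _] := gK.
have fc := C1bd_continuous a01 fK; have gc := C1bd_continuous a01 gK.
have afK := C1bdZ a fK; have [_ af0 _ _] := afK; have afc := C1bd_continuous a01 afK.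
rewrite /Q !(RintD _ afc gc af0 g0) !(RintZ _ a fc f0); ring.
Qed.

Lemma Z_derivative_of_cauchy : is_Z_derivative alpha I nu h T.
Proof.
have Tlin (a : R) f g : C1a alpha f -> C1a alpha g ->
    T (fun x => a * f x + g x) = a * T f + T g.
  move=> /(C1a_ex_C1bd d0)[Kf fK] /(C1a_ex_C1bd d0)[Kg gK].
  apply: cvg_lim => //.
  rewrite (_ : (fun l => Q l _) = (fun l => a * Q l f + Q l g)); last first.
    by apply/funext => l; exact: Q_linear fK gK.
  apply: cvgD; last exact: Q_cvg gK.
  by apply: cvgM; [exact: cvg_cst|exact: Q_cvg fK].
split; last first.
  apply: dual_norm_cvg0 => // e e0; have [rho rho0 rhoP] := Q_near e0.
  apply: filterS (F_small rho0) => l [lr Il] f fK.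
  by rewrite -[e]mulr1; exact: rhoP.
split; first split => //.
- have [rho rho0 rhoP] := Q_near ltr01.
  have [l [lr Il]] := filter_ex (F_small rho0).
  (* A single quotient, bounded through the masses, lies within 1 of the limit on the unit ball. *)
  pose c := `|l^-1| * (mass (nu (h + l)) + mass (nu h)) + 1.
  apply: (@le_lt_trans _ _ c%:E); last exact: ltry.
  apply: dual_norm_le => // f fK; have [_ f0 _ _] := fK.
  have fc := C1bd_continuous a01 fK.
  rewrite -(subrK (Q l f) (T f)) addrC (le_trans (ler_normD _ _))// lerD//.
    rewrite /Q normrM ler_wpM2l// (le_trans (ler_normB _ _))//.
    by rewrite lerD// (le_trans (Rint_norm_le _ fc f0))// mul1r.
  by rewrite distrC -[leRHS](mulr1 1); exact: rhoP.
- move=> e e0; have e20 : 0 < e / 2 by rewrite divr_gt0.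
  have [rho rho0 rhoP] := Q_near e20.
  have [l [lr Il]] := filter_ex (F_small rho0).
  have [nu' [P [N [nuPN nuE]]]] : exists (nu' : {charge set (borel R d) -> \bar R})
      (P N : set (borel R d)) (nuPN : hahn_decomposition nu' P N),
      forall f (K : R), continuous f -> (forall x, `|f x| <= K) ->
      charge_pairing nuPN f = Q l f.
    (* The coefficient must be nonnegative, so for negative l the two measures are exchanged. *)
    have [l0|l0] := leP 0 l^-1; first exact: charge_pairing_difference.
    have l0' : 0 <= - l^-1 by rewrite oppr_ge0 ltW.
    have [nu' [P [N [nuPN nuE]]]] := charge_pairing_difference (nu h) (nu (h + l)) l0'.
    exists nu', P, N, nuPN => f K fc f0; rewrite (nuE f K fc f0) /Q; ring.
  exists nu', P, N, nuPN; apply: (@le_lt_trans _ _ (e / 2)%:E); last first.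
    by rewrite lte_fin ltr_pdivrMr// ltr_pMr// ltr1n.
  apply: dual_norm_le => // f fK; have [_ f0 _ _] := fK.
  rewrite (nuE f 1 (C1bd_continuous a01 fK) f0) distrC -[leRHS]mulr1.
  exact: rhoP.
Qed.

End LimitFunctional.

(** From any h there is room 1/2 on one side: increments are taken to the left for h >= 0 and to the
    right otherwise, which covers the endpoints. *)
Lemma unit_interval_quotient_proper (R : realType) (h : R) : `[- 2^-1, 2^-1]%classic h ->
  ProperFilter (within [set l | `[- 2^-1, 2^-1]%classic (h + l)] (0 : R)^').
Proof.
rewrite /= in_itv/= => /andP[h1 h2]; apply: Build_ProperFilter_ex => P.
move=> /nbhs_ballP[e /= e0 eP].
pose s := Num.min (e / 2) 2^-1.
have s0 : 0 < s by rewrite lt_min divr_gt0//= invr_gt0.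
have se : s < e by rewrite gt_min ltr_pdivrMr// ltr_pMr// ltr1n.
have s2 : s <= 2^-1 by rewrite ge_min lexx orbT.
have [h0|h0] := leP 0 h.
  have ss : `|0 - - s| < e by rewrite sub0r opprK gtr0_norm.
  exists (- s); apply: (eP _ ss); first by rewrite oppr_eq0 gt_eqF.
  by rewrite /= in_itv/=; apply/andP; split; lra.
have ss : `|0 - s| < e by rewrite sub0r normrN gtr0_norm.
exists s; apply: (eP _ ss); first by rewrite gt_eqF.
by rewrite /= in_itv/=; apply/andP; split; lra.
Qed.

Theorem theorem1p1 (R : realType) (d : nat) (hd : (0 < d)%N) (alpha : R)
    (halpha : 0 < alpha <= 1)
    (b b1 : R -> 'rV[R]_d -> 'rV[R]_d)
    (hb : C0_C1a_field alpha b) (hb1 : C0_C1a_field alpha b1)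
    (w : R -> 'rV[R]_d -> R) (hw : C1a_spacetime alpha w)
    (mu0 : probability (borel R d) R)
    (mu : R -> R -> {finite_measure set (borel R d) -> \bar R})
    (hmu : forall h : R, `[- 2^-1, 2^-1]%classic h ->
       weak_solution (fun t x => b t x + h *: b1 t x) w mu0 (mu h))
    (t : R) (ht : 0 <= t) (h : R) (hh : `[- 2^-1, 2^-1]%classic h) :
  exists T : ('rV[R]_d -> R) -> R,
    is_Z_derivative alpha `[- 2^-1, 2^-1]%classic (fun k => mu k t) h T.
Proof.
have hI (k : R) : `[- 2^-1, 2^-1]%classic k -> `|k| <= 1.
  by rewrite /= in_itv/= => /andP[k1 k2]; rewrite ler_norml; apply/andP; split; lra.
have bc := C0_C1a_field_time_continuous hd hb.
have b1c := C0_C1a_field_time_continuous hd hb1.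
have wc := C1a_spacetime_time_continuous hw.
have cM := coefficients_bounded hd hb hb1 hw.
eexists; apply: (Z_derivative_of_cauchy hd halpha (unit_interval_quotient_proper hh)).
move=> e e0.
exact: (C1bd_cauchy halpha bc b1c wc cM hI hmu hh ht e0).
Qed.
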